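(* Let $\alpha\in(0,1)\cup(1,2)$, $\gamma\in\mathbb R$ with $|\gamma|\le\min\{\alpha,2-\alpha\}$, $k\in\mathbb Z$ and $s\in(0,\pi)$. Then $$D_\gamma^\alpha[\lambda_k](\cot(s))=-\frac{c_\alpha e^{i\,\mathrm{sgn}(k)\gamma\frac\pi2}\sin^{\alpha-1}(s)}{2\tan(\alpha\frac\pi2)}\sum_{l=-\infty}^\infty e^{i2ls}\big((1-\alpha)k^2-2kl\big)\frac{\Gamma\left(\frac{-1+\alpha}{2}+|l|\right)\Gamma\left(\frac{-1-\alpha}{2}+|k-l|\right)}{\Gamma\left(\frac{3-\alpha}{2}+|l|\right)\Gamma\left(\frac{3+\alpha}{2}+|k-l|\right)}.$$ Moreover, when $\alpha=1$, $|\gamma|\le1$, $k\in\mathbb Z$ and $s\in(0,\pi)$, $$D_\gamma^1[\lambda_k](\cot(s))=-2e^{i\,\mathrm{sgn}(k)\gamma\frac\pi2}|k|\sin^2(s)e^{i2ks}.$$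
   Context: For $k\in\mathbb Z$, the complex Higgins functions are $\lambda_k(x)=\left(\frac{ix-1}{ix+1}\right)^k=\frac{(x+i)^{2k}}{(1+x^2)^k}$, $x\in\mathbb R$. For $\beta\in(0,1)$, $$\mathcal D^{\beta}[u](x)=\frac{1}{\Gamma(1-\beta)}\int_0^\infty\frac{u'(x-z)}{z^\beta}\,dz,\qquad \overline{\mathcal D^{\beta}}[u](x)=\frac{1}{\Gamma(1-\beta)}\int_0^\infty\frac{u'(x+z)}{z^\beta}\,dz$$ (the bar is part of the name of the operator, not complex conjugation). For $\alpha\in(1,2)$, $\partial_x\mathcal D^{\alpha-1}[u]$ and $\partial_x\overline{\mathcal D^{\alpha-1}}[u]$ denote the $x$-derivatives of $\mathcal D^{\alpha-1}[u]$ and $\overline{\mathcal D^{\alpha-1}}[u]$. For $\alpha\in(0,2)$, the fractional Laplacian is $(-\Delta)^{\alpha/2}u(x)=c_\alpha\,\mathrm{p.v.}\!\int_{-\infty}^\infty\frac{u(x)-u(x+y)}{|y|^{1+\alpha}}dy$, with $c_\alpha=\alpha\frac{2^{\alpha-1}\Gamma(\frac12+\frac\alpha2)}{\sqrt\pi\,\Gamma(1-\frac\alpha2)}$. The Riesz-Feller operator $D_\gamma^\alpha$ of order $\alpha\in(0,2)$ and skewness $\gamma$, $|\gamma|\le\min\{\alpha,2-\alpha\}$, is given, with $c^1_{\gamma,\alpha}=\frac{\Gamma(1+\alpha)}{\pi}\sin\left((\alpha-\gamma)\frac\pi2\right)$ and $c^2_{\gamma,\alpha}=\frac{\Gamma(1+\alpha)}{\pi}\sin\left((\alpha+\gamma)\frac\pi2\right)$,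 by - $D_\gamma^\alpha[u](x)=\Gamma(-\alpha)\left(c^1_{\gamma,\alpha}\mathcal D^\alpha[u](x)-c^2_{\gamma,\alpha}\overline{\mathcal D^\alpha}[u](x)\right)$ if $\alpha\in(0,1)$; - $D_\gamma^\alpha[u](x)=\Gamma(-\alpha)\left(c^1_{\gamma,\alpha}\partial_x\mathcal D^{\alpha-1}[u](x)+c^2_{\gamma,\alpha}\partial_x\overline{\mathcal D^{\alpha-1}}[u](x)\right)$ if $\alpha\in(1,2)$; - $D_\gamma^1[u](x)=-\cos\left(\gamma\frac\pi2\right)(-\Delta)^{1/2}u(x)+\sin\left(\gamma\frac\pi2\right)u'(x)$ if $\alpha=1$. $D_\gamma^\alpha[u](\cot(s))$ means $D_\gamma^\alpha[u](x)$ evaluated at $x=\cot(s)$; $\mathrm{sgn}$ is the sign function. *)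

(* Defs.v *)
From Stdlib Require Export Reals ZArith.
From Coquelicot Require Export Coquelicot.
Open Scope R_scope.

(* C is used below both as a real normed space (derivatives and integrals in a
   real variable) and as a normed space over itself (series). The operators are
   relations [is_... x l], "is defined at x with value l", as in Coquelicot:
   all the derivatives, integrals and limits involved are required to exist. *)

Definition Gamma_int (x : R) : R :=
  RInt_gen (fun t => Rpower t (x - 1) * exp (- t))
           (at_right 0) (Rbar_locally p_infty).

(* Continuation by Gamma (x) = Gamma (x + 1) / x, iterated n times. *)
Fixpoint Gamma_shift (n : nat) (x : R) : R :=
  match n with
  | O => Gamma_int x
  | S m => Gamma_shift m (x + 1) / x
  end.

(* The number of shifts is 0 for x > 0; for x <= 0 it is the least n with
   x + n > 0, since up y is the integer in the interval (y, y + 1]. The value at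
   the poles 0, -1, -2, ... is meaningless. *)
Definition Gamma (x : R) : R := Gamma_shift (Z.to_nat (up (- x))) x.

Definition cis (t : R) : C := (cos t, sin t).

Definition Cpow_Z (z : C) (k : Z) : C :=
  match k with
  | Z0 => RtoC 1
  | Zpos p => Cpow z (Pos.to_nat p)
  | Zneg p => Cinv (Cpow z (Pos.to_nat p))
  end.

Definition higgins (k : Z) (x : R) : C :=
  Cpow_Z ((Ci * x - 1) / (Ci * x + 1))%C k.

Definition cot (s : R) : R := cos s / sin s.

Definition is_cderive (u : R -> C) (x : R) (l : C) : Prop :=
  is_derive (V := C_R_NormedModule) u x l.

Definition is_cRInt_gen (f : R -> C) (Fa Fb : (R -> Prop) -> Prop) (l : C)
  : Prop := is_RInt_gen (V := C_R_NormedModule) f Fa Fb l.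

Definition is_caputo_left (beta : R) (u : R -> C) (x : R) (l : C) : Prop :=
  exists (u' : R -> C) (v : C),
    (forall y, is_cderive u y (u' y)) /\
    is_cRInt_gen (fun z => u' (x - z)%R / Rpower z beta)%C
      (at_right 0) (Rbar_locally p_infty) v /\
    l = (/ Gamma (1 - beta) * v)%C.

Definition is_caputo_right (beta : R) (u : R -> C) (x : R) (l : C) : Prop :=
  exists (u' : R -> C) (v : C),
    (forall y, is_cderive u y (u' y)) /\
    is_cRInt_gen (fun z => u' (x + z)%R / Rpower z beta)%C
      (at_right 0) (Rbar_locally p_infty) v /\
    l = (/ Gamma (1 - beta) * v)%C.

Definition is_derive_caputo_left
  (beta : R) (u : R -> C) (x : R) (l : C) : Prop :=
  exists g : R -> C,
    (forall y, is_caputo_left beta u y (g y)) /\ is_cderive g x l.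

Definition is_derive_caputo_right
  (beta : R) (u : R -> C) (x : R) (l : C) : Prop :=
  exists g : R -> C,
    (forall y, is_caputo_right beta u y (g y)) /\ is_cderive g x l.

Definition frac_lap_const (alpha : R) : R :=
  alpha * (Rpower 2 (alpha - 1) * Gamma (1 / 2 + alpha / 2)
           / (sqrt PI * Gamma (1 - alpha / 2))).

(* The principal value is the limit, as eps -> 0+, of the integral over the
   complement of (-eps, eps); Im eps and Ip eps are its two halves. *)
Definition is_frac_laplacian
  (alpha : R) (u : R -> C) (x : R) (l : C) : Prop :=
  let f := fun y => ((u x - u (x + y)%R) / Rpower (Rabs y) (1 + alpha))%C in
  exists (Im Ip : R -> C) (v : C),
    (forall eps, 0 < eps ->
       is_cRInt_gen f (Rbar_locally m_infty) (at_point (- eps)) (Im eps) /\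
       is_cRInt_gen f (at_point eps) (Rbar_locally p_infty) (Ip eps)) /\
    filterlim (fun eps => (Im eps + Ip eps)%C) (at_right 0)
      (locally (T := C_R_NormedModule) v) /\
    l = (frac_lap_const alpha * v)%C.

Definition rf_c1 (gamma alpha : R) : R :=
  Gamma (1 + alpha) / PI * sin ((alpha - gamma) * (PI / 2)).

Definition rf_c2 (gamma alpha : R) : R :=
  Gamma (1 + alpha) / PI * sin ((alpha + gamma) * (PI / 2)).

Definition is_riesz_feller
  (alpha gamma : R) (u : R -> C) (x : R) (l : C) : Prop :=
  (0 < alpha < 1 /\
   exists a b : C,
     is_caputo_left alpha u x a /\ is_caputo_right alpha u x b /\
     l = (Gamma (- alpha) * (rf_c1 gamma alpha * a - rf_c2 gamma alpha * b))%C)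
  \/
  (1 < alpha < 2 /\
   exists a b : C,
     is_derive_caputo_left (alpha - 1) u x a /\
     is_derive_caputo_right (alpha - 1) u x b /\
     l = (Gamma (- alpha) * (rf_c1 gamma alpha * a + rf_c2 gamma alpha * b))%C)
  \/
  (alpha = 1 /\
   exists a b : C,
     is_frac_laplacian 1 u x a /\ is_cderive u x b /\
     l = (- cos (gamma * (PI / 2)) * a + sin (gamma * (PI / 2)) * b)%C).

(* Sum over all integers: both one-sided series converge. *)
Definition is_zseries (a : Z -> C) (l : C) : Prop :=
  exists lp lm : C,
    is_series (V := C_NormedModule) (fun n : nat => a (Z.of_nat n)) lp /\
    is_series (V := C_NormedModule) (fun n : nat => a (- Z.of_nat (S n))%Z) lm /\
    l = (lp + lm)%C.

Definition rf_term (alpha : R) (k : Z) (s : R) (l : Z) : C :=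
  (cis (2 * IZR l * s)
   * ((1 - alpha) * IZR k ^ 2 - 2 * IZR k * IZR l)%R
   * (Gamma ((-1 + alpha) / 2 + IZR (Z.abs l))
      * Gamma ((-1 - alpha) / 2 + IZR (Z.abs (k - l)))
      / (Gamma ((3 - alpha) / 2 + IZR (Z.abs l))
         * Gamma ((3 + alpha) / 2 + IZR (Z.abs (k - l)))))%R)%C.

(* Main.v *)
Require Import Defs.
From Stdlib Require Import Lra Lia Psatz FunctionalExtensionality.

(** Put w = 1 + i x, so that lambda_1 = 1 - 2/w, and lambda_1 (cot s) = e^{2is}.
    For k > 0 the derivative of lambda_k is 2 i k lambda_{k-1} w^{-2}, a combination
    of powers w^{-j}, all of which oscillate with frequencies of one sign only. Both
    one-sided Caputo derivatives of lambda_k are therefore multiples of one and the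
    same function, by the phases e^{-i alpha pi} and 1 up to sign, and the skewness
    only contributes a factor e^{i gamma pi/2} when they are combined.

    - Integrals. Everything reduces to the Stieltjes transforms
      int_0^oo t^{-b} (t+z)^{-n} dt ([stieltjes]). Integration by parts shifts n
      ([stieltjes_succ]). This makes the transform for n = 2 a solution of a linear
      equation z f' = -(1+b) f on the slit plane, so it is C(b) z^{-1-b}
      ([stieltjes2_polar]), where C(b) is a Beta value ([betar]). Comparing the
      values at z = i and z = 1 gives C(b/2) = cos(pi b/2) C(b), and halving b
      for ever gives C(b) = pi b / sin(pi b) ([betar_eq]).
    - Gamma. Integrals of t^{x-1} satisfy f(x+s) <= (x+1)^s f(x) for 0 <= s <= 1;
      together with f(x+1) = x f(x) this determines f up to a constant
      ([Wendel_unique]). The duplication formula and the Beta integral follow, then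
      the reflection formula, and c_alpha = Gamma(1+alpha) sin(alpha pi/2)/pi
      ([frac_lap_const_eq]).
    - Recursion. With u(k,j) = lambda_k w^{-j} one has
      u(k+1,j) = u(k,j) - 2 u(k,j+1). Any linear operator respects this recursion.
      When its values at k = 0 have the right ratios the recursion is solved by the
      polynomial of degree k in lambda_1 whose coefficients are products of two
      multiset coefficients ([pascal_solution]). Hence the operator applied to
      lambda_k is (sin s)^{1+alpha} e^{i(1+alpha)s} times a polynomial in e^{2is}
      ([riesz_feller_higgins]).
    - Fourier series. The function sin(s) e^{i alpha s} has coefficients
      1/((2l-alpha)^2-1) up to a constant ([base_series]). The partial sums W_N of
      its series, freed of the factor e^{i alpha s}, satisfy
      sin W_N' - cos W_N -> 0 because the sum telescopes, so that W/sin is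
      constant. Multiplying by the polynomial
      turns the coefficients into finite sums of partial fractions, which a second
      telescoping evaluates in closed form ([psum_closed]); the quotient of Gamma
      values in the statement is that closed form ([rf_coef]).
    - Order one. The same recursion reduces the principal value to powers of 1/w,
      where the antiderivatives are explicit ([PV_hig]).
    - Complex conjugation exchanges k and -k ([riesz_feller_conj]). *)

(** * Complex-valued functions of a real variable *)

Notation RN := R_NormedModule.
Notation RNc := R_CompleteNormedModule.
Notation CR := C_R_NormedModule.
Notation CRc := C_R_CompleteNormedModule.
Notation at0 := (at_right 0).
Notation at_oo := (Rbar_locally p_infty).

Ltac C_parts := apply injective_projections; cbn.
Ltac smooth := apply (ex_derive_continuous (V:=RN)); auto_derive.

Lemma is_cderive_comp (u : R -> C) (x : R) (l : C) :
  is_cderive u x l <->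
  is_derive (fun t => Re (u t)) x (Re l) /\ is_derive (fun t => Im (u t)) x (Im l).
Proof.
  unfold is_cderive; split.
  - intros H; split.
    + apply (filterdiff_comp (U:=RN) (V := CR) (W:=RN) u fst (fun y => scal y l) fst).
      * exact H.
      * apply filterdiff_linear, is_linear_fst.
    + apply (filterdiff_comp (U:=RN) (V := CR) (W:=RN) u snd (fun y => scal y l) snd).
      * exact H.
      * apply filterdiff_linear, is_linear_snd.
  - intros [H1 H2].
    apply (is_derive_ext (V:=CR)
      (fun t => plus (scal (Re (u t)) (RtoC 1)) (scal (Im (u t)) Ci))).
    { intros t; rewrite !scal_R_Cmult. destruct (u t) as [a b]; unfold plus; cbn.
      C_parts; ring. }
    replace l with (plus (scal (Re l) (RtoC 1)) (scal (Im l) Ci) : CR).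
    2:{ rewrite !scal_R_Cmult. destruct l as [a b]; unfold plus; cbn.
      C_parts; ring. }
    apply (is_derive_plus (V:=CR));
     apply (is_derive_scal_l (V:=CR)); assumption.
Qed.

Lemma is_derive_eq (f : R -> R) (x a b : R) : a = b -> is_derive f x a -> is_derive f x b.
Proof. intros <-; trivial. Qed.

Lemma is_rderive_mult (f g : R -> R) (x a b : R) :
  is_derive f x a -> is_derive g x b ->
  is_derive (fun t => f t * g t) x (a * g x + f x * b).
Proof.
  intros Hf Hg. auto_derive.
  - repeat split; eexists; eassumption.
  - change (fun x0 : R => f x0) with f. change (fun x0 : R => g x0) with g.
    rewrite (is_derive_unique _ _ _ Hf), (is_derive_unique _ _ _ Hg). ring.
Qed.

Lemma is_cderive_mult (u v : R -> C) (x : R) (a b : C) :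
  is_cderive u x a -> is_cderive v x b ->
  is_cderive (fun t => u t * v t)%C x (a * v x + u x * b)%C.
Proof.
  rewrite !is_cderive_comp; intros [Hu1 Hu2] [Hv1 Hv2]; split.
  - generalize (is_derive_minus (V:=RN) _ _ _ _ _
      (is_rderive_mult _ _ _ _ _ Hu1 Hv1) (is_rderive_mult _ _ _ _ _ Hu2 Hv2)).
    apply is_derive_eq. destruct (u x), (v x), a, b; cbn; unfold minus, plus, opp; cbn; ring.
  - generalize (is_derive_plus (V:=RN) _ _ _ _ _
      (is_rderive_mult _ _ _ _ _ Hu1 Hv2) (is_rderive_mult _ _ _ _ _ Hu2 Hv1)).
    apply is_derive_eq. destruct (u x), (v x), a, b; cbn; unfold minus, plus, opp; cbn; ring.
Qed.

Lemma is_cderive_const (c : C) (x : R) : is_cderive (fun _ => c) x 0%C.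
Proof. apply (is_derive_const (V:=CR)). Qed.

Lemma is_cderive_val (u : R -> C) (x : R) (a b : C) :
  is_cderive u x a -> a = b -> is_cderive u x b.
Proof. intros H <-; exact H. Qed.

Lemma is_cderive_ext (u v : R -> C) (x : R) (a : C) :
  (forall t, u t = v t) -> is_cderive u x a -> is_cderive v x a.
Proof. intros; eapply (is_derive_ext (V:=CR)); eassumption. Qed.

Lemma is_cderive_plus (u v : R -> C) (x : R) (a b : C) :
  is_cderive u x a -> is_cderive v x b ->
  is_cderive (fun t => u t + v t)%C x (a + b)%C.
Proof. intros; apply (is_derive_plus (V:=CR)); assumption. Qed.

Lemma is_cderive_minus (u v : R -> C) (x : R) (a b : C) :
  is_cderive u x a -> is_cderive v x b ->
  is_cderive (fun t => u t - v t)%C x (a - b)%C.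
Proof. intros; apply (is_derive_minus (V:=CR)); assumption. Qed.

Lemma is_cderive_scal (c : C) (u : R -> C) (x : R) (a : C) :
  is_cderive u x a -> is_cderive (fun t => c * u t)%C x (c * a)%C.
Proof.
  intros H. eapply is_cderive_val.
  apply is_cderive_mult; [apply is_cderive_const | exact H]. cbv beta. rewrite Cmult_0_l, Cplus_0_l; reflexivity.
Qed.

Lemma is_cderive_RtoC (f : R -> R) (x l : R) :
  is_derive f x l -> is_cderive (fun t => RtoC (f t)) x (RtoC l).
Proof.
  intros H. rewrite is_cderive_comp; split; [exact H|].
  apply (is_derive_const (K:=R_AbsRing) (V:=RN) 0 x).
Qed.

Lemma is_cderive_inv (u : R -> C) (x : R) (a : C) :
  u x <> 0%C -> is_cderive u x a ->
  is_cderive (fun t => / u t)%C x (- a / (u x * u x))%C.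
Proof.
  rewrite !is_cderive_comp; intros Hx [Hu1 Hu2].
  assert (Hn : Re (u x) ^ 2 + Im (u x) ^ 2 <> 0).
  { intros E. apply Hx. C_parts; unfold Re, Im in E; nra. }
  assert (Hd : is_derive (fun t => Re (u t) * Re (u t) + Im (u t) * Im (u t)) x
     ((Re a * Re (u x) + Re (u x) * Re a) + (Im a * Im (u x) + Im (u x) * Im a))).
  { apply (is_derive_plus (V:=RN)); apply is_rderive_mult; assumption. }
  assert (Hn2 : Re (u x) * Re (u x) + Im (u x) * Im (u x) <> 0)
    by (intros E; apply Hn; rewrite <- E; ring).
  assert (Hi := is_derive_inv _ _ _ Hd Hn2); cbv beta in Hi.
  split.
  - eapply is_derive_ext; [|eapply is_derive_eq; [|exact (is_rderive_mult _ _ _ _ _ Hu1 Hi)]].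
    { intros t; unfold Re, Im; cbn. unfold Rdiv; do 2 f_equal; ring. }
    { cbv beta. destruct a as [a b]. unfold Re, Im in *. cbn. cbn in Hn, Hn2.
      destruct (u x) as [p q]; cbn in *. field. split; [|exact Hn2].
      intros E; apply Hn2. apply Rsqr_0_uniq; unfold Rsqr. rewrite <- E; ring. }
  - assert (Hu3 : is_derive (fun t => - Im (u t)) x (- Im a)) by exact (is_derive_opp (V:=RN) _ _ _ Hu2).
    eapply is_derive_ext; [|eapply is_derive_eq; [|exact (is_rderive_mult _ _ _ _ _ Hu3 Hi)]].
    { intros t; unfold Re, Im; cbn. unfold Rdiv; do 2 f_equal; ring. }
    { cbv beta. destruct a as [a b]. unfold Re, Im in *. cbn. cbn in Hn, Hn2.
      destruct (u x) as [p q]; cbn in *. field. split; [|exact Hn2].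
      intros E; apply Hn2. apply Rsqr_0_uniq; unfold Rsqr. rewrite <- E; ring. }
Qed.

Lemma is_cderive_cis (a x : R) :
  is_cderive (fun t => cis (a * t)) x (Ci * a * cis (a * x))%C.
Proof.
  rewrite is_cderive_comp; split; cbn; auto_derive; trivial; cbn; ring.
Qed.

Lemma cis_add a b : cis (a + b) = (cis a * cis b)%C.
Proof. unfold cis; C_parts; [apply cos_plus | rewrite sin_plus; ring]. Qed.

Lemma cis_0 : cis 0 = 1%C.
Proof. unfold cis; rewrite cos_0, sin_0; reflexivity. Qed.

Lemma Cmod_cis a : Cmod (cis a) = 1.
Proof.
  unfold Cmod, cis; cbn. apply (eq_trans (y := sqrt 1)); [|apply sqrt_1]. f_equal.
  generalize (sin2_cos2 a); unfold Rsqr; lra.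
Qed.

Lemma is_cderive_continuous u x l : is_cderive u x l -> continuous (U:=CR) u x.
Proof. intros H. apply (ex_derive_continuous (V:=CR)). eexists; exact H. Qed.

(** The values of [is_RInt_gen] are limits, so a continuous map that commutes with
    proper integrals commutes with improper ones. It is used for maps that are
    linear over the reals only, such as conjugation and imaginary part. *)
Lemma is_RInt_gen_map {V W : NormedModule R_AbsRing} (T : V -> W) (f : R -> V) (g : R -> W)
  Fa Fb (FFa : Filter Fa) (FFb : Filter Fb) (l : V) :
  (forall a b y, is_RInt f a b y -> is_RInt g a b (T y)) -> continuous T l ->
  is_RInt_gen f Fa Fb l -> is_RInt_gen g Fa Fb (T l).
Proof.
  intros HT Hc H P HP. specialize (H _ (Hc P HP)). unfold filtermapi in *.
  eapply filter_imp; [|exact H]. intros [a b] [y [Hy Py]]. exists (T y); split; auto.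
Qed.

Lemma continuous_Cpair (f g : C -> R) (z : C) :
  continuous (T:=CR) f z -> continuous (T:=CR) g z ->
  continuous (T:=CR) (U:=CR) (fun z => (f z, g z)) z.
Proof.
  intros Hf Hg. apply (continuous_comp_2 f g (fun a b : R => (a, b) : CR)); trivial.
  apply continuous_ext with (f := fun p => p); [intros [a b]; reflexivity|apply continuous_id].
Qed.

Lemma continuous_Im (z : C) : continuous (T:=CR) Im z.
Proof. apply continuous_snd. Qed.

Lemma continuous_conj (z : C) : continuous (T:=CR) (U:=CR) Cconj z.
Proof.
  apply (continuous_Cpair fst (fun z => - snd z)); [apply continuous_fst|].
  apply (continuous_opp (V:=RN)), continuous_Im.
Qed.

(** Complex multiplication as a real-linear combination of the identity and the
    rotation by a right angle: the integral over the reals only knows about real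
    scalars. *)
Lemma Cmult_split (c z : C) : (c * z)%C = (Re c * z + Im c * ((- Im z)%R, Re z))%C.
Proof. destruct c, z; C_parts; ring. Qed.

Lemma continuous_cmult (c z : C) :
  continuous (T:=CR) (U:=CR) (fun z => c * z)%C z.
Proof.
  apply (continuous_ext (T:=CR) (U:=CR)
    (fun z => plus (scal (Re c) z) (scal (Im c) ((- Im z, Re z) : CR)))).
  { intros t. rewrite !scal_R_Cmult. symmetry. apply Cmult_split. }
  apply (continuous_plus (V:=CR)); apply (continuous_scal_r (V:=CR)).
  - apply continuous_id.
  - apply (continuous_Cpair (fun z => - snd z) fst); [|apply continuous_fst].
    apply (continuous_opp (V:=RN)), continuous_Im.
Qed.

Lemma is_RInt_Re_Im (f : R -> C) (a b : R) (l : C) :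
  is_RInt (V:=CR) f a b l <->
  is_RInt (fun t => Re (f t)) a b (Re l) /\ is_RInt (fun t => Im (f t)) a b (Im l).
Proof.
  split.
  - intros H; split; [exact (is_RInt_fct_extend_fst (U:=RN) (V:=RN) f a b l H)
      |exact (is_RInt_fct_extend_snd (U:=RN) (V:=RN) f a b l H)].
  - intros [H1 H2]. rewrite (surjective_pairing l).
    apply (is_RInt_fct_extend_pair (U:=RN) (V:=RN)); assumption.
Qed.

Lemma is_cRInt_gen_cmult (c : C) (f : R -> C) Fa Fb (FFa : Filter Fa) (FFb : Filter Fb) (l : C) :
  is_cRInt_gen f Fa Fb l -> is_cRInt_gen (fun t => c * f t)%C Fa Fb (c * l)%C.
Proof.
  apply (is_RInt_gen_map (V:=CR) (W:=CR) (fun z => c * z)%C); trivial;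
    [|apply continuous_cmult].
  intros a b y Hy. assert (Hi : is_RInt (V:=CR) (fun t => (- Im (f t), Re (f t))) a b (- Im y, Re y)).
  { apply is_RInt_Re_Im in Hy as [H1 H2]. apply is_RInt_Re_Im. split; [|exact H1].
    apply (is_RInt_opp (V:=RN)), H2. }
  assert (H := is_RInt_plus (V:=CR) _ _ _ _ _ _
    (is_RInt_scal (V:=CR) _ _ _ (Re c) _ Hy) (is_RInt_scal (V:=CR) _ _ _ (Im c) _ Hi)).
  rewrite !scal_R_Cmult in H. rewrite Cmult_split.
  eapply (is_RInt_ext (V:=CR)); [|exact H].
  intros t _. cbv beta. rewrite !scal_R_Cmult. symmetry. apply Cmult_split.
Qed.

Lemma is_cRInt_gen_conj (f g : R -> C) Fa Fb (FFa : Filter Fa) (FFb : Filter Fb) (l : C) :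
  (forall t, g t = Cconj (f t)) ->
  is_cRInt_gen f Fa Fb l -> is_cRInt_gen g Fa Fb (Cconj l).
Proof.
  intros E. apply (is_RInt_gen_map (V:=CR) (W:=CR) Cconj); trivial;
    [|apply continuous_conj].
  intros a b y Hy. apply is_RInt_Re_Im in Hy as [H1 H2]. apply is_RInt_Re_Im.
  split; (eapply is_RInt_ext; [intros t _; rewrite E; reflexivity|]); [exact H1|].
  apply (is_RInt_opp (V:=RN)), H2.
Qed.

Lemma is_cRInt_gen_Im (f : R -> C) Fa Fb (FFa : Filter Fa) (FFb : Filter Fb) (l : C) :
  is_cRInt_gen f Fa Fb l -> is_RInt_gen (fun t => Im (f t)) Fa Fb (Im l).
Proof.
  apply (is_RInt_gen_map (V:=CR) (W:=RN) Im); trivial; [|apply continuous_Im].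
  intros a b y Hy. apply is_RInt_Re_Im in Hy. apply Hy.
Qed.

Lemma is_cRInt_gen_RtoC (f : R -> R) Fa Fb (FFa : Filter Fa) (FFb : Filter Fb) (l : R) :
  is_RInt_gen f Fa Fb l -> is_cRInt_gen (fun t => RtoC (f t)) Fa Fb (RtoC l).
Proof.
  apply (is_RInt_gen_map (V:=RN) (W:=CR) RtoC); trivial.
  - intros a b y Hy. apply is_RInt_Re_Im. split; [exact Hy|].
    assert (H : is_RInt (fun _ => 0) a b ((b - a) * 0)) by apply (is_RInt_const (V:=RN)).
    rewrite Rmult_0_r in H. exact H.
  - apply (ex_derive_continuous (V:=CR)). eexists.
    apply is_cderive_RtoC, (is_derive_id (K:=R_AbsRing)).
Qed.

(** * Improper integrals over the half-line *)

Lemma improper_FTC {V : CompleteNormedModule R_AbsRing} (F f : R -> V)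
  (Fa Fb : (R -> Prop) -> Prop) (FFa : Filter Fa) (FFb : Filter Fb) (la lb : V) :
  filter_prod Fa Fb (fun ab => forall x, Rmin (fst ab) (snd ab) <= x <= Rmax (fst ab) (snd ab) ->
     is_derive F x (f x) /\ continuous f x) ->
  filterlim F Fa (locally la) -> filterlim F Fb (locally lb) ->
  is_RInt_gen f Fa Fb (minus lb la).
Proof.
  intros HD Ha Hb.
  apply (filterlimi_lim_ext_loc (fun ab => minus (F (snd ab)) (F (fst ab)))).
  - eapply filter_imp; [|exact HD]. intros [a b] H; cbn in *.
    apply (is_RInt_derive F f); intros x Hx; apply H; exact Hx.
  - unfold minus.
    eapply (filterlim_comp_2 (G := locally lb) (H := locally (opp la))).
    + eapply filterlim_comp; [apply filterlim_snd|exact Hb].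
    + eapply filterlim_comp; [eapply filterlim_comp; [apply filterlim_fst|exact Ha]|].
      apply (filterlim_opp (V:=V)).
    + apply (filterlim_plus (V:=V)).
Qed.

Lemma continuous_at_right {V : UniformSpace} (f : R -> V) a :
  continuous f a -> filterlim f (at_right a) (locally (f a)).
Proof.
  intros H P HP. destruct (H P HP) as [eps He]. exists eps. intros; apply He; assumption.
Qed.

Lemma at_right_gt a : at_right a (fun t => a < t).
Proof. exists (mkposreal 1 Rlt_0_1); trivial. Qed.

Lemma at_right_lt a b : a < b -> at_right a (fun t => t < b).
Proof.
  intros H. assert (Hp : 0 < b - a) by lra. exists (mkposreal _ Hp).
  intros t Ht Hat. unfold ball in Ht; cbn in Ht.
  unfold AbsRing_ball, abs, minus, plus, opp in Ht; cbn in Ht.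
  apply Rabs_def2 in Ht. lra.
Qed.

Lemma p_infty_gt a : Rbar_locally p_infty (fun t => a < t).
Proof. exists a; trivial. Qed.

Lemma halfline_pos (P : R -> Prop) :
  (forall x, 0 < x -> P x) ->
  filter_prod at0 at_oo
    (fun ab => forall x, Rmin (fst ab) (snd ab) <= x <= Rmax (fst ab) (snd ab) -> P x).
Proof.
  intros H. apply (Filter_prod _ _ _ (fun t => 0 < t) (fun t => 0 < t)).
  - apply at_right_gt.
  - apply p_infty_gt.
  - intros a b Ha Hb x Hx; cbn in Hx. apply H.
    eapply Rlt_le_trans; [|apply Hx]. apply Rmin_glb_lt; assumption.
Qed.

Lemma halfline_le :
  filter_prod at0 at_oo (fun ab => fst ab <= snd ab).
Proof.
  apply (Filter_prod _ _ _ (fun t => t < 1) (fun t => 1 < t)).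
  - apply at_right_lt; lra.
  - apply p_infty_gt.
  - cbn; intros; lra.
Qed.

Lemma halfline_pos_le (P : R -> Prop) :
  (forall x, 0 < x -> P x) ->
  filter_prod at0 at_oo
    (fun ab => forall x, fst ab <= x <= snd ab -> P x).
Proof.
  intros H. generalize (filter_and _ _ (halfline_pos P H) halfline_le).
  apply filter_imp. intros [a b] [H1 H2] x Hx; cbn in *. apply H1.
  rewrite Rmin_left, Rmax_right; auto.
Qed.

Lemma halfline_ext {V : NormedModule R_AbsRing} (f g : R -> V) l :
  (forall x, 0 < x -> f x = g x) ->
  is_RInt_gen f at0 at_oo l ->
  is_RInt_gen g at0 at_oo l.
Proof.
  intros H. apply is_RInt_gen_ext.
  generalize (halfline_pos (fun x => f x = g x) H). apply filter_imp.
  intros [a b] H1 x Hx. apply H1. lra.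
Qed.

Lemma halfline_unique {V : CompleteNormedModule R_AbsRing} (f : R -> V) l1 l2 :
  is_RInt_gen f at0 at_oo l1 ->
  is_RInt_gen f at0 at_oo l2 -> l1 = l2.
Proof.
  intros H1 H2. rewrite <- (is_RInt_gen_unique _ _ H1). apply is_RInt_gen_unique, H2.
Qed.

Lemma halfline_FTC {V : CompleteNormedModule R_AbsRing} (F f : R -> V) (la lb : V) :
  (forall x, 0 < x -> is_derive F x (f x)) -> (forall x, 0 < x -> continuous f x) ->
  filterlim F at0 (locally la) -> filterlim F at_oo (locally lb) ->
  is_RInt_gen f at0 at_oo (minus lb la).
Proof.
  intros H1 H2. apply improper_FTC; try typeclasses eauto.
  apply (halfline_pos (fun x => is_derive F x (f x) /\ continuous f x)). auto.
Qed.

(** The primitive of [f] inherits the Cauchy property of [G] at both ends of the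
    half-line, so it has limits there. *)
Lemma ex_halfline_dominated {V : CompleteNormedModule R_AbsRing} (f : R -> V) (g G : R -> R) (l0 l1 : R) :
  (forall x, 0 < x -> continuous f x) ->
  (forall x, 0 < x -> continuous g x) ->
  (forall x, 0 < x -> is_derive G x (g x)) ->
  filterlim G at0 (locally l0) -> filterlim G at_oo (locally l1) ->
  (forall x, 0 < x -> norm (f x) <= g x) ->
  exists l, is_RInt_gen f at0 at_oo l /\ norm l <= l1 - l0.
Proof.
  intros Cf Cg DG L0 L1 Hfg.
  assert (If : forall a b, 0 < a -> 0 < b -> ex_RInt f a b).
  { intros a b Ha Hb. apply (ex_RInt_continuous f). intros z Hz. apply Cf.
    eapply Rlt_le_trans; [|apply Hz]. apply Rmin_glb_lt; assumption. }
  set (Phi := fun t => RInt f 1 t).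
  assert (DPhi : forall x, 0 < x -> is_derive Phi x (f x)).
  { intros x Hx. apply (is_derive_RInt f Phi 1 x).
    - apply (locally_interval _ x 0 p_infty); cbn; trivial.
      intros y Hy _. apply RInt_correct, If; lra.
    - apply Cf; exact Hx. }
  assert (HC0 : forall s t, 0 < s -> s <= t -> norm (minus (Phi t) (Phi s)) <= G t - G s).
  { intros s t Hs Ht.
    assert (Hst : is_RInt f s t (minus (Phi t) (Phi s))).
    { apply (is_RInt_derive Phi f); intros x Hx; rewrite Rmin_left, Rmax_right in Hx by lra.
      - apply DPhi; lra.
      - apply Cf; lra. }
    assert (Gst : is_RInt g s t (minus (G t) (G s))).
    { apply (is_RInt_derive G g); intros x Hx; rewrite Rmin_left, Rmax_right in Hx by lra.
      - apply DG; lra.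
      - apply Cg; lra. }
    refine (norm_RInt_le f g s t _ _ Ht _ Hst Gst).
    intros x Hx; apply Hfg; lra. }
  assert (HC : forall s t, 0 < s -> 0 < t -> norm (minus (Phi t) (Phi s)) <= Rabs (G t - G s)).
  { intros s t Hs Ht. destruct (Rle_dec s t) as [h|h].
    - eapply Rle_trans; [apply HC0; lra|apply Rle_abs].
    - rewrite <- norm_opp, opp_minus, Rabs_minus_sym.
      eapply Rle_trans; [apply HC0; lra|apply Rle_abs]. }
  assert (Hlim : forall F : (R -> Prop) -> Prop, ProperFilter F -> F (fun t => 0 < t) ->
    forall l, filterlim G F (locally l) -> exists y, filterlim Phi F (locally y)).
  { intros F PF HF l HG. apply filterlim_locally_cauchy. intros eps.
    assert (He : 0 < eps / 2) by (destruct eps; cbn; lra).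
    exists (fun t => 0 < t /\ Rabs (G t - l) < eps / 2). split.
    - apply filter_and; [exact HF|].
      apply (HG (fun y => Rabs (y - l) < eps / 2)).
      exists (mkposreal _ He). intros y Hy; exact Hy.
    - intros u v [Hu Hu'] [Hv Hv']. apply (norm_compat1 (V:=V)).
      eapply Rle_lt_trans; [apply HC; assumption|].
      replace (G v - G u) with ((G v - l) - (G u - l)) by ring.
      eapply Rle_lt_trans; [apply Rabs_triang|]. rewrite Rabs_Ropp. lra. }
  destruct (Hlim at0 _ (at_right_gt 0) _ L0) as [y0 Hy0].
  destruct (Hlim at_oo _ (p_infty_gt 0) _ L1) as [y1 Hy1].
  exists (minus y1 y0).
  assert (Hf := halfline_FTC Phi f y0 y1 DPhi Cf Hy0 Hy1).
  assert (Hg := halfline_FTC G g l0 l1 DG Cg L0 L1).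
  split; [exact Hf|].
  apply (RInt_gen_norm f g _ _ halfline_le (halfline_pos_le _ Hfg) Hf Hg).
Qed.

Lemma Rpower_pos x y : 0 < Rpower x y.
Proof. apply exp_pos. Qed.

Lemma is_derive_Rpower x a : 0 < x -> is_derive (fun t => Rpower t a) x (a * Rpower x (a - 1)).
Proof.
  intros H. apply is_derive_Reals. apply derivable_pt_lim_power. exact H.
Qed.

Lemma continuous_Rpower x a : 0 < x -> continuous (fun t => Rpower t a) x.
Proof.
  intros H. apply (ex_derive_continuous (V:=RN)). eexists. apply is_derive_Rpower; exact H.
Qed.

Lemma Rpower_lim_0 a : 0 < a -> filterlim (fun t => Rpower t a) at0 (locally 0).
Proof.
  intros Ha P [eps HP].
  exists (mkposreal _ (Rpower_pos eps (/ a))). intros t Ht Hpos. apply HP.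
  unfold ball in *; cbn in *; unfold AbsRing_ball, abs, minus, plus, opp in *; cbn in *.
  rewrite Ropp_0, Rplus_0_r in *. rewrite Rabs_pos_eq in Ht by lra.
  rewrite Rabs_pos_eq by (left; apply Rpower_pos).
  replace (pos eps) with (Rpower (Rpower eps (/ a)) a).
  - unfold Rpower. apply exp_increasing. apply Rmult_lt_compat_l; trivial.
    apply ln_increasing; trivial.
  - rewrite Rpower_mult, Rinv_l, Rpower_1; trivial; [destruct eps; trivial| lra].
Qed.

(** The integrable majorant for all the integrals below. It behaves like [t^(x-1)]
    at zero and [t^(-2)] at infinity, and has the explicit primitive [(t/(1+t))^x /
    x]. *)
Definition dom (x t : R) : R := Rpower (t / (1 + t)) (x - 1) * / (1 + t) ^ 2.

Lemma frac_pos t : 0 < t -> 0 < t / (1 + t).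
Proof. intros; apply Rdiv_lt_0_compat; lra. Qed.

Lemma is_derive_dom x t : 0 < t -> x <> 0 ->
  is_derive (fun t => Rpower (t / (1 + t)) x / x) t (dom x t).
Proof.
  intros Ht Hx.
  assert (H1 : is_derive (fun t => t / (1 + t)) t (/ (1 + t) ^ 2)).
  { auto_derive; [lra|field; lra]. }
  assert (H2 := is_derive_comp (fun y => Rpower y x) (fun t => t / (1 + t)) t _ _
     (is_derive_Rpower _ x (frac_pos t Ht)) H1).
  assert (H3 := is_derive_scal _ _ (/ x) _ H2).
  eapply is_derive_ext; [|eapply is_derive_eq; [|exact H3]].
  - intros; cbn. unfold Rdiv; apply Rmult_comm.
  - unfold dom, scal; cbn. unfold mult; cbn. field. split; lra.
Qed.

Lemma dom_continuous x t : 0 < t -> continuous (dom x) t.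
Proof.
  intros Ht. unfold dom.
  apply (continuous_mult (K:=R_AbsRing)).
  - apply (continuous_comp (fun t => t / (1 + t)) (fun y => Rpower y (x - 1))).
    + smooth; lra.
    + apply continuous_Rpower, frac_pos, Ht.
  - smooth.
    apply Rgt_not_eq. nra.
Qed.

Lemma frac_lim_0 : filterlim (fun t => t / (1 + t)) at0 at0.
Proof.
  intros P [eps HP]. exists eps. intros t Ht Hpos. apply HP; [|apply frac_pos, Hpos].
  unfold ball in *; cbn in *; unfold AbsRing_ball, abs, minus, plus, opp in *; cbn in *.
  rewrite Ropp_0, Rplus_0_r in *. rewrite Rabs_pos_eq in Ht |- * by (try apply Rlt_le, frac_pos; lra).
  eapply Rle_lt_trans; [|exact Ht]. apply Rle_div_l; nra.
Qed.

Lemma frac_lim_infty : filterlim (fun t => t / (1 + t)) at_oo (locally 1).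
Proof.
  intros P [eps HP]. exists (/ eps). intros t Ht. apply HP.
  assert (He := cond_pos eps).
  assert (0 < / eps) by (apply Rinv_0_lt_compat; trivial).
  unfold ball in *; cbn in *; unfold AbsRing_ball, abs, minus, plus, opp in *; cbn in *.
  replace (t / (1 + t) + - (1)) with (- / (1 + t)) by (field; lra).
  rewrite Rabs_Ropp, Rabs_pos_eq by (left; apply Rinv_0_lt_compat; lra).
  rewrite <- (Rinv_inv eps). apply Rinv_lt_contravar; nra.
Qed.

Lemma ex_halfline_dom {V : CompleteNormedModule R_AbsRing} (f : R -> V) (c x : R) :
  0 < x ->
  (forall t, 0 < t -> continuous f t) ->
  (forall t, 0 < t -> norm (f t) <= c * dom x t) ->
  exists l, is_RInt_gen f at0 at_oo l /\ norm l <= c / x.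
Proof.
  intros Hx Cf Hf.
  destruct (ex_halfline_dominated f (fun t => c * dom x t) (fun t => c * (Rpower (t / (1 + t)) x / x)) (c * (0 / x)) (c * (1 / x)))
   as [l [H1 H2]]; trivial.
  - intros t Ht. apply (continuous_scal_r (V:=RN)). apply dom_continuous, Ht.
  - intros t Ht. apply (is_derive_scal (fun t => Rpower (t / (1 + t)) x / x)). apply is_derive_dom; lra.
  - apply (filterlim_comp _ _ _ (fun t => Rpower (t / (1 + t)) x) (fun y => c * (y / x)) _ (locally 0)).
    + apply (filterlim_comp _ _ _ (fun t => t / (1 + t)) (fun y => Rpower y x) _ at0); [apply frac_lim_0|]. apply Rpower_lim_0, Hx.
    + change (continuous (fun y => c * (y / x)) 0).
      smooth; trivial.
  - apply (filterlim_comp _ _ _ (fun t => Rpower (t / (1 + t)) x) (fun y => c * (y / x)) _ (locally 1)).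
    + apply (filterlim_comp _ _ _ (fun t => t / (1 + t)) (fun y => Rpower y x) _ (locally 1)); [apply frac_lim_infty|].
      assert (E : Rpower 1 x = 1) by (unfold Rpower; rewrite ln_1, Rmult_0_r, exp_0; trivial).
      apply (filterlim_filter_le_2 (G := locally (Rpower 1 x))); [rewrite E; intros P HP; exact HP|].
      apply continuous_Rpower. lra.
    + change (continuous (fun y => c * (y / x)) 1).
      smooth; trivial.
  - exists l; split; trivial. eapply Rle_trans; [exact H2|]. right; field; lra.
Qed.

(** * Gamma as the solution of a functional inequality *)

Lemma exp_mono x y : x <= y -> exp x <= exp y.
Proof. intros [H| ->]; [left; apply exp_increasing, H|right; trivial]. Qed.

Lemma ln_le_minus1 y : 0 < y -> ln y <= y - 1.
Proof.
  intros Hy. generalize (exp_ineq1_le (ln y)). rewrite exp_ln; lra.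
Qed.

(** Weighted arithmetic-geometric mean inequality for 1 and [u]; equivalently, the
    concave function [u^s] lies below its tangent at 1. *)
Lemma Rpower_tangent u s : 0 < u -> 0 <= s <= 1 -> Rpower u s <= 1 - s + s * u.
Proof.
  intros Hu Hs. set (m := 1 - s + s * u).
  assert (Hm : 0 < m) by (unfold m; nra).
  assert (H1 := ln_le_minus1 (/ m) (Rinv_0_lt_compat _ Hm)).
  assert (H2 := ln_le_minus1 (u / m) (Rdiv_lt_0_compat _ _ Hu Hm)).
  rewrite ln_Rinv in H1 by trivial. rewrite ln_div in H2 by trivial.
  assert (H3 : s * (u / m - 1) + (1 - s) * (/ m - 1) = 0).
  { replace (s * (u / m - 1) + (1 - s) * (/ m - 1)) with ((1 - s + s * u) / m - 1) by (field; lra).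
    fold m. field; lra. }
  unfold Rpower. rewrite <- (exp_ln m Hm). apply exp_mono. nra.
Qed.

Lemma Rpower_tangent_at u c s : 0 < u -> 0 < c -> 0 <= s <= 1 ->
  Rpower u s <= Rpower c s * (1 - s) + Rpower c s * s / c * u.
Proof.
  intros Hu Hc Hs.
  assert (H := Rpower_tangent (u / c) s (Rdiv_lt_0_compat _ _ Hu Hc) Hs).
  assert (E : Rpower u s = Rpower c s * Rpower (u / c) s).
  { rewrite Rpower_mult_distr; [|exact Hc|apply Rdiv_lt_0_compat; assumption].
    f_equal; field; lra. }
  rewrite E.
  replace (Rpower c s * (1 - s) + Rpower c s * s / c * u) with (Rpower c s * (1 - s + s * (u / c))) by (field; lra).
  apply Rmult_le_compat_l; [left; apply Rpower_pos|exact H].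
Qed.

(** An inequality that follows from log-convexity, weak enough to be preserved by
    the products in the duplication and Beta formulas (there the factor (x+1)^s is
    needed instead of the x^s that holds for Gamma). *)
Definition Wendel (f : R -> R) : Prop :=
  (forall x, 0 < x -> 0 <= f x) /\ (forall x, 0 < x -> f (x + 1) = x * f x) /\
  (forall x s, 0 < x -> 0 <= s <= 1 -> f (x + s) <= Rpower (x + 1) s * f x).

Fixpoint rising (x : R) (n : nat) : R :=
  match n with O => 1 | S m => (x + INR m) * rising x m end.

Lemma rising_pos x n : 0 < x -> 0 < rising x n.
Proof.
  intros Hx; induction n; cbn; [lra|].
  apply Rmult_lt_0_compat; trivial. generalize (pos_INR n); lra.
Qed.

Lemma Wendel_rising f x n : Wendel f -> 0 < x -> f (x + INR n) = rising x n * f x.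
Proof.
  intros [_ [H _]] Hx. induction n.
  - cbn. rewrite Rplus_0_r; ring.
  - rewrite S_INR, <- Rplus_assoc, H, IHn by (generalize (pos_INR n); lra). cbn; ring.
Qed.

Lemma div_INR_small (c eps : R) : 0 < eps ->
  exists N, (1 <= N)%nat /\ forall n, (N <= n)%nat -> c / INR n < eps.
Proof.
  intros He. assert (Hc := Rabs_pos c). assert (Hc2 := Rle_abs c).
  destruct (archimed_cor1 (eps / (1 + Rabs c))) as [N [HN1 HN2]]; [apply Rdiv_lt_0_compat; lra|].
  exists N. split; [exact HN2|]. intros n Hn.
  assert (HN : 0 < INR N) by (apply lt_0_INR; trivial).
  assert (HN3 : / INR n <= / INR N) by (apply Rinv_le_contravar; [|apply le_INR]; trivial).
  assert (Hn0 : 0 < / INR n) by (apply Rinv_0_lt_compat, (Rlt_le_trans _ _ _ HN), le_INR, Hn).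
  apply Rle_lt_trans with ((1 + Rabs c) * / INR N); [unfold Rdiv; nra|].
  apply (Rmult_lt_compat_l (1 + Rabs c)) in HN1; [|lra].
  replace ((1 + Rabs c) * (eps / (1 + Rabs c))) with eps in HN1 by (field; lra). exact HN1.
Qed.

Lemma small_of_inv (x c : R) : (forall n, (2 <= n)%nat -> x <= c / INR n) -> x <= 0.
Proof.
  intros H. destruct (Rle_dec x 0) as [h|h]; trivial. exfalso.
  destruct (div_INR_small c x) as [N [_ HN]]; [lra|].
  generalize (H (S (S N)) ltac:(lia)) (HN (S (S N)) ltac:(lia)). lra.
Qed.

Lemma le_of_asymp A B : (forall n : nat, (1 <= n)%nat -> INR n * A <= (INR n + 2) * B) -> A <= B.
Proof.
  intros H. cut (A - B <= 0); [lra|]. apply (small_of_inv _ (2 * B)). intros n Hn.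
  assert (Hn0 : 0 < INR n) by (apply lt_0_INR; lia). specialize (H n ltac:(lia)).
  apply Rle_div_r; lra.
Qed.

(** The product f(x) g(1) exceeds g(x) f(1) by a factor at most (n+2)/n: shift the
    argument by [n], bound f(n+x) above by f(n) and g(n+x) below by g(n+1). The
    rising factorials cancel. *)
Lemma Wendel_le f g x : Wendel f -> Wendel g -> 0 < x <= 1 -> f x * g 1 <= g x * f 1.
Proof.
  intros Hf Hg Hx. apply le_of_asymp. intros n Hn.
  destruct n as [|m]; [lia|]. clear Hn. set (n := S m).
  assert (Hn : 0 < INR n) by (apply lt_0_INR; unfold n; lia).
  assert (Hf0 := Hf). assert (Hg0 := Hg).
  destruct Hf as [Pf [Rf Wf]], Hg as [Pg [Rg Wg]].
  assert (Ef := Wendel_rising f x n Hf0 (proj1 Hx)).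
  assert (Eg := Wendel_rising g x n Hg0 (proj1 Hx)).
  assert (Ef1 : f (INR n) = rising 1 m * f 1).
  { rewrite <- (Wendel_rising f 1 m Hf0 Rlt_0_1). unfold n; rewrite S_INR; f_equal; ring. }
  assert (Eg1 : g (INR n + 1) = INR n * rising 1 m * g 1).
  { rewrite (Rplus_comm (INR n)), (Wendel_rising g 1 n Hg0 Rlt_0_1). unfold n; cbn [rising]. rewrite S_INR. ring. }
  assert (U : f (INR n + x) <= Rpower (INR n + 1) x * f (INR n)) by (apply Wf; lra).
  assert (L : g (INR n + x + (1 - x)) <= Rpower (INR n + x + 1) (1 - x) * g (INR n + x)) by (apply Wg; lra).
  replace (INR n + x + (1 - x)) with (INR n + 1) in L by ring.
  rewrite Eg1 in L. rewrite (Rplus_comm (INR n) x) in U, L. rewrite Ef, Ef1 in U. rewrite Eg in L.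
  assert (Hp := rising_pos x n (proj1 Hx)). assert (Hq := rising_pos 1 m Rlt_0_1).
  set (p := rising x n) in *. set (q := rising 1 m) in *.
  assert (0 <= f 1) by (apply Pf; lra). assert (0 <= g 1) by (apply Pg; lra).
  assert (0 <= f x) by (apply Pf; lra). assert (0 <= g x) by (apply Pg; lra).
  (* Raise both bases to n + 2, so that the two powers multiply to n + 2. *)
  assert (P1 : Rpower (INR n + 1) x <= Rpower (INR n + 2) x) by (apply Rle_Rpower_l; lra).
  assert (P2 : Rpower (x + INR n + 1) (1 - x) <= Rpower (INR n + 2) (1 - x)) by (apply Rle_Rpower_l; lra).
  assert (P3 : Rpower (INR n + 2) x * Rpower (INR n + 2) (1 - x) = INR n + 2).
  { rewrite <- Rpower_plus. replace (x + (1 - x)) with 1 by ring. apply Rpower_1; lra. }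
  assert (PP1 := Rpower_pos (INR n + 2) x). assert (PP2 := Rpower_pos (INR n + 2) (1 - x)).
  set (a := Rpower (INR n + 2) x) in *. set (b := Rpower (INR n + 2) (1 - x)) in *.
  assert (U' : p * f x <= a * (q * f 1)).
  { eapply Rle_trans; [exact U|]. apply Rmult_le_compat_r; [nra|exact P1]. }
  assert (L' : INR n * q * g 1 <= b * (p * g x)).
  { eapply Rle_trans; [exact L|]. apply Rmult_le_compat_r; [nra|exact P2]. }
  assert (UL : (p * f x) * (INR n * q * g 1) <= (a * (q * f 1)) * (b * (p * g x))).
  { apply Rmult_le_compat; try assumption; [nra|]. apply Rmult_le_pos; [nra|trivial]. }
  apply (Rmult_le_reg_l (p * q)); [nra|].
  replace (p * q * (INR n * (f x * g 1))) with ((p * f x) * (INR n * q * g 1)) by ring.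
  replace (p * q * ((INR n + 2) * (g x * f 1))) with ((a * (q * f 1)) * (b * (p * g x))) by (rewrite <- P3; ring).
  exact UL.
Qed.

Lemma Wendel_unique f g x : Wendel f -> Wendel g -> 0 < x -> f x * g 1 = g x * f 1.
Proof.
  intros Hf Hg Hx.
  destruct (nfloor_ex x) as [n [Hn1 Hn2]]; [lra|].
  assert (Hn : x <= INR n + 1) by lra. clear Hn1 Hn2.
  revert x Hx Hn; induction n; intros x Hx Hn.
  - cbn in Hn. apply Rle_antisym; apply Wendel_le; trivial; lra.
  - destruct (Rle_dec x 1) as [h|h].
    + apply Rle_antisym; apply Wendel_le; trivial; lra.
    + rewrite S_INR in Hn.
      replace x with (x - 1 + 1) by ring.
      destruct Hf as [Pf [Rf Wf]], Hg as [Pg [Rg Wg]].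
      rewrite Rf, Rg by lra. rewrite !Rmult_assoc. f_equal.
      apply IHn; lra.
Qed.

Notation gam x := (fun t : R => Rpower t (x - 1) * exp (- t)).

(** From [1 + t <= p (1 + t/p) <= p exp(t/p)] with [p = x+1]. *)
Lemma pow_exp_bound x t : 0 < x -> 0 < t ->
  Rpower (1 + t) (x + 1) * exp (- t) <= Rpower (x + 1) (x + 1).
Proof.
  intros Hx Ht.
  assert (H : 1 + t <= (x + 1) * exp (t / (x + 1))).
  { generalize (exp_ineq1_le (t / (x + 1))). intros H.
    apply (Rmult_le_compat_l (x + 1)) in H; [|lra].
    replace ((x + 1) * (1 + t / (x + 1))) with (x + 1 + t) in H by (field; lra). lra. }
  assert (H2 : Rpower (1 + t) (x + 1) <= Rpower ((x + 1) * exp (t / (x + 1))) (x + 1)) by (apply Rle_Rpower_l; lra).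
  clear H; rename H2 into H.
  rewrite <- Rpower_mult_distr in H by (try apply exp_pos; lra).
  assert (E : Rpower (exp (t / (x + 1))) (x + 1) = exp t).
  { unfold Rpower. rewrite ln_exp. f_equal; field; lra. }
  rewrite E in H. rewrite exp_Ropp.
  apply (Rmult_le_reg_r (exp t)); [apply exp_pos|]. rewrite Rmult_assoc, Rinv_l; [lra|].
  apply Rgt_not_eq, exp_pos.
Qed.

Lemma Rpower_frac t a : 0 < t -> Rpower (t / (1 + t)) a = Rpower t a * Rpower (1 + t) (- a).
Proof.
  intros Ht. unfold Rdiv. rewrite <- Rpower_mult_distr; [|trivial|apply Rinv_0_lt_compat; lra].
  f_equal. unfold Rpower. rewrite ln_Rinv by lra. f_equal; ring.
Qed.

Lemma Rpower_2 t : 0 < t -> Rpower t (-2) = / t ^ 2.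
Proof.
  intros Ht. rewrite <- Rpower_pow by trivial. rewrite <- Rpower_Ropp. f_equal.
Qed.

Lemma gam_dom x t : 0 < x -> 0 < t ->
  Rpower t (x - 1) * exp (- t) <= Rpower (x + 1) (x + 1) * dom x t.
Proof.
  intros Hx Ht. unfold dom. rewrite Rpower_frac by trivial.
  assert (H := pow_exp_bound x t Hx Ht).
  replace (x + 1) with ((x - 1) + 2) in H at 1 by ring.
  rewrite Rpower_plus in H.
  assert (E1 : Rpower (1 + t) (- (x - 1)) = / Rpower (1 + t) (x - 1)) by apply Rpower_Ropp.
  assert (E2 : Rpower (1 + t) 2 = (1 + t) ^ 2) by (rewrite <- Rpower_pow by lra; f_equal).
  rewrite E1, E2 in *.
  assert (P1 := Rpower_pos (1 + t) (x - 1)).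
  assert (P2 := Rpower_pos t (x - 1)).
  assert (P3 : 0 < (1 + t) ^ 2) by nra.
  replace (Rpower (x + 1) (x + 1) * (Rpower t (x - 1) * / Rpower (1 + t) (x - 1) * / (1 + t) ^ 2))
    with (Rpower t (x - 1) * (Rpower (x + 1) (x + 1) / (Rpower (1 + t) (x - 1) * (1 + t) ^ 2))) by (field; lra).
  apply Rmult_le_compat_l; [lra|].
  apply Rle_div_r; [nra|]. lra.
Qed.

Lemma gam_continuous x t : 0 < t -> continuous (gam x) t.
Proof.
  intros Ht. apply (continuous_mult (K:=R_AbsRing)).
  - apply continuous_Rpower, Ht.
  - smooth; trivial.
Qed.

Lemma gam_pos x t : 0 <= Rpower t (x - 1) * exp (- t).
Proof. left; apply Rmult_lt_0_compat; [apply Rpower_pos|apply exp_pos]. Qed.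

Lemma halfline_le_int (f g : R -> R) lf lg :
  (forall t, 0 < t -> 0 <= f t <= g t) ->
  is_RInt_gen f at0 at_oo lf ->
  is_RInt_gen g at0 at_oo lg -> lf <= lg.
Proof.
  intros H Hf Hg. apply Rle_trans with (norm lf); [apply Rle_abs|].
  refine (RInt_gen_norm (V:=RNc) f g lf lg halfline_le _ Hf Hg).
  apply (halfline_pos_le (fun t => norm (f t) <= g t)).
  intros t Ht. destruct (H t Ht). unfold norm; cbn; unfold abs; cbn. rewrite Rabs_pos_eq; lra.
Qed.

Lemma halfline_int_ge0 (f : R -> R) lf :
  (forall t, 0 < t -> 0 <= f t) ->
  is_RInt_gen f at0 at_oo lf -> 0 <= lf.
Proof.
  intros H Hf. apply (halfline_le_int (fun _ => 0 * 0) f); trivial.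
  - intros t Ht. rewrite Rmult_0_l. split; [lra|auto].
  - replace 0 with (scal 0 lf) at 2 by (unfold scal; cbn; unfold mult; cbn; ring).
    eapply halfline_ext; [|apply (is_RInt_gen_scal (V:=RN) f 0 lf); exact Hf].
    intros; unfold scal; cbn; unfold mult; cbn; ring.
Qed.

Lemma Gamma_int_correct x : 0 < x ->
  is_RInt_gen (gam x) at0 at_oo (Gamma_int x).
Proof.
  intros Hx. apply (RInt_gen_correct (V:=RNc)).
  destruct (ex_halfline_dom (V:=RNc) (gam x) (Rpower (x + 1) (x + 1)) x Hx) as [l [H _]].
  - intros; apply gam_continuous; trivial.
  - intros t Ht. unfold norm; cbn; unfold abs; cbn. rewrite Rabs_pos_eq by apply gam_pos. apply gam_dom; trivial.
  - exists l; exact H.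
Qed.

Lemma infty_lim_0 (f : R -> R) c : (forall t, 0 < t -> Rabs (f t) <= c / (1 + t)) ->
  filterlim f at_oo (locally 0).
Proof.
  intros H P [eps HP]. exists (Rmax 1 (c / eps)). intros t Ht. apply HP.
  assert (1 < t) by (eapply Rle_lt_trans; [apply Rmax_l|exact Ht]).
  assert (c / eps < t) by (eapply Rle_lt_trans; [apply Rmax_r|exact Ht]).
  assert (He := cond_pos eps).
  unfold ball; cbn; unfold AbsRing_ball, abs, minus, plus, opp; cbn. rewrite Ropp_0, Rplus_0_r.
  eapply Rle_lt_trans; [apply H; lra|]. apply Rlt_div_l; [lra|].
  apply Rlt_div_l in H1; nra.
Qed.

Lemma Gamma_int_succ x : 0 < x -> Gamma_int (x + 1) = x * Gamma_int x.
Proof.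
  intros Hx.
  assert (H : is_RInt_gen (fun t => x * (Rpower t (x - 1) * exp (- t)) - Rpower t (x + 1 - 1) * exp (- t))
     at0 at_oo (minus 0 0)).
  { apply (halfline_FTC (V:=RNc) (fun t => Rpower t x * exp (- t))).
    - intros t Ht. eapply is_derive_eq; [|apply is_rderive_mult; [apply is_derive_Rpower, Ht|]].
      2:{ auto_derive; [trivial|reflexivity]. }
      cbn. replace (x + 1 - 1) with x by ring. ring.
    - intros t Ht. apply (continuous_minus (V:=RN)).
      + apply (continuous_scal_r (V:=RN)). apply gam_continuous; trivial.
      + apply (gam_continuous (x + 1)); trivial.
    - intros P HP.
      assert (L := Rpower_lim_0 x Hx P HP). unfold filtermap in *.
      destruct HP as [eps HP].
      generalize (Rpower_lim_0 x Hx (ball 0 eps) (locally_ball 0 eps)). unfold filtermap.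
      intros L2. generalize (filter_and _ _ L2 (at_right_gt 0)). apply filter_imp.
      intros t [Ht Hp]. apply HP.
      unfold ball in *; cbn in *; unfold AbsRing_ball, abs, minus, plus, opp in *; cbn in *.
      rewrite Ropp_0, Rplus_0_r in *. eapply Rle_lt_trans; [|exact Ht].
      rewrite Rabs_mult. rewrite <- (Rmult_1_r (Rabs (Rpower t x))) at 2.
      apply Rmult_le_compat_l; [apply Rabs_pos|].
      rewrite Rabs_pos_eq by (left; apply exp_pos).
      rewrite <- exp_0. apply exp_mono; lra.
    - apply (infty_lim_0 _ (Rpower (x + 1) (x + 1))). intros t Ht.
      rewrite Rabs_pos_eq by (left; apply Rmult_lt_0_compat; [apply Rpower_pos|apply exp_pos]).
      apply (Rmult_le_reg_r (1 + t)); [lra|].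
      replace (Rpower (x + 1) (x + 1) / (1 + t) * (1 + t)) with (Rpower (x + 1) (x + 1)) by (field; lra).
      eapply Rle_trans; [|apply (pow_exp_bound x t Hx Ht)].
      rewrite Rpower_plus, Rpower_1 by lra.
      assert (Rpower t x <= Rpower (1 + t) x) by (apply Rle_Rpower_l; lra).
      assert (P := exp_pos (- t)).
      replace (Rpower t x * exp (- t) * (1 + t)) with (Rpower t x * (exp (- t) * (1 + t))) by ring.
      replace (Rpower (1 + t) x * (1 + t) * exp (- t)) with (Rpower (1 + t) x * (exp (- t) * (1 + t))) by ring.
      apply Rmult_le_compat_r; [nra|trivial]. }
  assert (H2 := is_RInt_gen_minus (V:=RN) _ _ _ _
    (is_RInt_gen_scal (V:=RN) _ x _ (Gamma_int_correct x Hx)) (Gamma_int_correct (x + 1) ltac:(lra))).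
  assert (E := halfline_unique (V:=RNc) _ _ _ H H2).
  change (0 - 0 = x * Gamma_int x - Gamma_int (x + 1)) in E. lra.
Qed.

Lemma Gamma_int_1 : Gamma_int 1 = 1.
Proof.
  assert (H : is_RInt_gen (gam 1) at0 at_oo (minus 0 (-1))).
  2:{ rewrite (halfline_unique (V:=RNc) _ _ _ (Gamma_int_correct 1 Rlt_0_1) H).
      unfold minus, plus, opp; cbn; ring. }
  apply (halfline_ext (V:=RN) (fun t => exp (- t))).
  { intros t Ht. change (exp (- t) = Rpower t (1 - 1) * exp (- t) :> R). replace (1 - 1) with 0 by ring. rewrite Rpower_O by trivial. ring. }
  apply (halfline_FTC (V:=RNc) (fun t => - exp (- t))).
  - intros t Ht. auto_derive; [trivial|ring].
  - intros t Ht. smooth; trivial.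
  - replace (-1) with (- exp (- 0)) by (rewrite Ropp_0, exp_0; ring).
    apply (continuous_at_right (fun t => - exp (- t))).
    smooth; trivial.
  - apply (infty_lim_0 _ 1). intros t Ht. rewrite Rabs_Ropp, Rabs_pos_eq by (left; apply exp_pos).
    rewrite exp_Ropp. unfold Rdiv; rewrite Rmult_1_l. apply Rinv_le_contravar; [lra|]. apply exp_ineq1_le.
Qed.

(** Integrate the tangent inequality for [t^s] at the mean value [t = x] of the
    measure [t^(x-1) exp(-t) dt]. *)
Lemma Gamma_int_Wendel x s : 0 < x -> 0 <= s <= 1 -> Gamma_int (x + s) <= Rpower x s * Gamma_int x.
Proof.
  intros Hx Hs. assert (Hx1 : 0 < x + 1) by lra. assert (Hxs : 0 < x + s) by lra.
  assert (H2 := is_RInt_gen_plus (V:=RN) _ _ _ _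
    (is_RInt_gen_scal (V:=RN) _ (Rpower x s * (1 - s)) _ (Gamma_int_correct x Hx))
    (is_RInt_gen_scal (V:=RN) _ (Rpower x s * s / x) _ (Gamma_int_correct (x + 1) Hx1))).
  assert (Hl' : Gamma_int (x + s) <= Rpower x s * (1 - s) * Gamma_int x + Rpower x s * s / x * Gamma_int (x + 1)).
  { refine (halfline_le_int _ _ _ _ _ (Gamma_int_correct (x + s) Hxs) H2).
    intros t Ht; split; [apply gam_pos|]. unfold plus, scal; cbn; unfold mult; cbn.
    assert (T := Rpower_tangent_at t x s Ht Hx Hs).
    replace (x + s - 1) with (s + (x - 1)) by ring. replace (x + 1 - 1) with (1 + (x - 1)) by ring.
    rewrite !Rpower_plus, Rpower_1 by trivial.
    assert (0 < Rpower t (x - 1) * exp (- t)) by (apply Rmult_lt_0_compat; [apply Rpower_pos|apply exp_pos]).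
    nra. }
  rewrite Gamma_int_succ in Hl' by trivial.
  eapply Rle_trans; [exact Hl'|]. right; field; lra.
Qed.

(** * Duplication formula and Beta integrals *)

Lemma Gamma_pos_eq x : 0 < x -> Gamma x = Gamma_int x.
Proof.
  intros Hx. unfold Gamma. destruct (archimed (- x)) as [_ H].
  assert (Hu : (up (- x) < 1)%Z) by (apply lt_IZR; lra).
  replace (Z.to_nat (up (- x))) with O by lia. reflexivity.
Qed.

Lemma Gamma_succ x : x <> 0 -> Gamma (x + 1) = x * Gamma x.
Proof.
  intros Hx. destruct (Rlt_dec 0 x) as [h|h].
  - rewrite !Gamma_pos_eq by lra. apply Gamma_int_succ, h.
  - unfold Gamma.
    assert (E : up (- x) = (up (- (x + 1)) + 1)%Z).
    { symmetry. apply tech_up; rewrite plus_IZR; destruct (archimed (- (x + 1))); lra. }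
    destruct (archimed (- x)) as [H1 H2].
    assert (Hu : (0 < up (- x))%Z) by (apply lt_IZR; lra).
    rewrite E at 1. replace (Z.to_nat (up (- (x + 1)) + 1)) with (S (Z.to_nat (up (- (x + 1))))) by lia.
    cbn. field; exact Hx.
Qed.

Lemma Gamma_1 : Gamma 1 = 1.
Proof. rewrite Gamma_pos_eq by lra. apply Gamma_int_1. Qed.

Lemma Gamma_ge0 x : 0 < x -> 0 <= Gamma x.
Proof.
  intros Hx. rewrite Gamma_pos_eq by trivial.
  apply (halfline_int_ge0 _ _ (fun t _ => gam_pos x t) (Gamma_int_correct x Hx)).
Qed.

Lemma Gamma_Wendel x s : 0 < x -> 0 <= s <= 1 -> Gamma (x + s) <= Rpower x s * Gamma x.
Proof. intros; rewrite !Gamma_pos_eq by lra; apply Gamma_int_Wendel; trivial. Qed.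

Lemma Wendel_Gamma : Wendel Gamma.
Proof.
  repeat split.
  - exact Gamma_ge0.
  - intros; apply Gamma_succ; lra.
  - intros x s Hx Hs. eapply Rle_trans; [apply Gamma_Wendel; trivial|].
    apply Rmult_le_compat_r; [apply Gamma_ge0, Hx|]. apply Rle_Rpower_l; lra.
Qed.

Lemma Wendel_eq_Gamma f x : Wendel f -> 0 < x -> f x = f 1 * Gamma x.
Proof.
  intros Hf Hx. generalize (Wendel_unique f Gamma x Hf Wendel_Gamma Hx).
  rewrite Gamma_1. lra.
Qed.

(** The left-hand side satisfies the recursion and the inequality that characterize
    Gamma up to its value at 1. *)
Lemma Gamma_duplication x : 0 < x ->
  Rpower 2 x * (Gamma (x / 2) * Gamma ((x + 1) / 2)) = 2 * Gamma (1 / 2) * Gamma x.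
Proof.
  intros Hx.
  assert (W : Wendel (fun x => Rpower 2 x * (Gamma (x / 2) * Gamma ((x + 1) / 2)))).
  { repeat split.
    - intros y Hy. apply Rmult_le_pos; [left; apply Rpower_pos|].
      apply Rmult_le_pos; apply Gamma_ge0; lra.
    - intros y Hy. replace ((y + 1 + 1) / 2) with (y / 2 + 1) by field.
      rewrite Gamma_succ, Rpower_plus, Rpower_1 by lra. field.
    - intros y s Hy Hs.
      replace ((y + s) / 2) with (y / 2 + s / 2) by field.
      replace ((y + s + 1) / 2) with ((y + 1) / 2 + s / 2) by field.
      assert (G1 := Gamma_Wendel (y / 2) (s / 2) ltac:(lra) ltac:(lra)).
      assert (G2 := Gamma_Wendel ((y + 1) / 2) (s / 2) ltac:(lra) ltac:(lra)).
      assert (P1 := Gamma_ge0 (y / 2) ltac:(lra)).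
      assert (P2 := Gamma_ge0 ((y + 1) / 2) ltac:(lra)).
      assert (P3 := Gamma_ge0 (y / 2 + s / 2) ltac:(lra)).
      assert (P4 := Gamma_ge0 ((y + 1) / 2 + s / 2) ltac:(lra)).
      rewrite Rpower_plus.
      assert (G1' : Gamma (y / 2 + s / 2) <= Rpower ((y + 1) / 2) (s / 2) * Gamma (y / 2)).
      { eapply Rle_trans; [exact G1|]. apply Rmult_le_compat_r; trivial.
        apply Rle_Rpower_l; lra. }
      assert (E : Rpower (y + 1) s = Rpower 2 s * (Rpower ((y + 1) / 2) (s / 2) * Rpower ((y + 1) / 2) (s / 2))).
      { rewrite <- Rpower_plus. replace (s / 2 + s / 2) with s by field.
        rewrite Rpower_mult_distr by lra. f_equal; field. }
      rewrite E.
      assert (Q1 := Rpower_pos 2 y). assert (Q2 := Rpower_pos 2 s). assert (Q3 := Rpower_pos ((y + 1) / 2) (s / 2)).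
      set (a := Rpower ((y + 1) / 2) (s / 2)) in *.
      replace (Rpower 2 s * (a * a) * (Rpower 2 y * (Gamma (y / 2) * Gamma ((y + 1) / 2))))
        with (Rpower 2 y * Rpower 2 s * ((a * Gamma (y / 2)) * (a * Gamma ((y + 1) / 2)))) by ring.
      apply Rmult_le_compat_l; [nra|]. apply Rmult_le_compat; trivial. }
  rewrite (Wendel_eq_Gamma _ x W Hx). rewrite Rpower_1 by lra.
  replace ((1 + 1) / 2) with 1 by field. rewrite Gamma_1. ring.
Qed.

Definition bet (x y t : R) : R := Rpower t (x - 1) * Rpower (1 + t) (- (x + y)).

(** Substituting [u = t/(1+t)] gives the usual Beta integral; on the half-line it
    appears directly as a Stieltjes transform at 1. *)
Definition Beta_int (x y : R) : R := RInt_gen (bet x y) at0 at_oo.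

Lemma is_derive_Rpower_1p a t : 0 < t ->
  is_derive (fun t => Rpower (1 + t) a) t (a * Rpower (1 + t) (a - 1)).
Proof.
  intros Ht. eapply is_derive_eq; [|apply (is_derive_comp (fun u => Rpower u a) (fun t => 1 + t));
    [apply is_derive_Rpower; lra | auto_derive; [trivial|reflexivity]]].
  apply Rmult_1_l.
Qed.

Lemma continuous_Rpower_1p a t : 0 <= t -> continuous (fun t => Rpower (1 + t) a) t.
Proof.
  intros Ht. apply (continuous_comp (fun t => 1 + t) (fun u => Rpower u a)).
  - smooth; trivial.
  - apply continuous_Rpower; lra.
Qed.

Lemma bet_pos x y t : 0 <= bet x y t.
Proof. left; apply Rmult_lt_0_compat; apply Rpower_pos. Qed.

Lemma bet_frac x y t : 0 < t -> bet x y t = Rpower (t / (1 + t)) (x - 1) * Rpower (1 + t) (- (y + 1)).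
Proof.
  intros Ht. unfold bet. rewrite Rpower_frac by trivial. rewrite Rmult_assoc, <- Rpower_plus.
  do 2 f_equal; ring.
Qed.

Lemma bet_dom x y t : 1 <= y -> 0 < t -> bet x y t <= dom x t.
Proof.
  intros Hy Ht. rewrite bet_frac by trivial. unfold dom.
  rewrite <- Rpower_2 by lra. apply Rmult_le_compat_l; [left; apply Rpower_pos|].
  apply Rle_Rpower; lra.
Qed.

Lemma bet_continuous x y t : 0 < t -> continuous (bet x y) t.
Proof.
  intros Ht. apply (continuous_mult (K:=R_AbsRing)).
  - apply continuous_Rpower, Ht.
  - apply continuous_Rpower_1p; lra.
Qed.

Lemma Beta_int_correct x y : 0 < x -> 1 <= y ->
  is_RInt_gen (bet x y) at0 at_oo (Beta_int x y).
Proof.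
  intros Hx Hy. apply (RInt_gen_correct (V:=RNc)).
  destruct (ex_halfline_dom (V:=RNc) (bet x y) 1 x Hx) as [l [H _]].
  - intros; apply bet_continuous; trivial.
  - intros t Ht. unfold norm; cbn -[bet dom]; unfold abs; cbn -[bet dom]. rewrite Rabs_pos_eq by apply bet_pos.
    rewrite Rmult_1_l. apply bet_dom; trivial.
  - exists l; exact H.
Qed.

Lemma Beta_int_ge0 x y : 0 < x -> 1 <= y -> 0 <= Beta_int x y.
Proof.
  intros Hx Hy. apply (halfline_int_ge0 _ _ (fun t _ => bet_pos x y t) (Beta_int_correct x y Hx Hy)).
Qed.

Lemma Beta_int_succ x y : 0 < x -> 1 <= y -> x * Beta_int x y = (x + y) * Beta_int (x + 1) y.
Proof.
  intros Hx Hy. assert (Hx1 : 0 < x + 1) by lra.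
  assert (H2 := is_RInt_gen_minus (V:=RN) _ _ _ _
    (is_RInt_gen_scal (V:=RN) _ x _ (Beta_int_correct x y Hx Hy))
    (is_RInt_gen_scal (V:=RN) _ (x + y) _ (Beta_int_correct (x + 1) y Hx1 Hy))).
  assert (H : is_RInt_gen (fun t => x * bet x y t - (x + y) * bet (x + 1) y t)
     at0 at_oo (minus 0 0)).
  { apply (halfline_FTC (V:=RNc) (fun t => Rpower t x * Rpower (1 + t) (- (x + y)))).
    - intros t Ht. unfold bet.
      eapply is_derive_eq; [|apply is_rderive_mult; [apply is_derive_Rpower, Ht|apply is_derive_Rpower_1p, Ht]].
      cbn. replace (x + 1 - 1) with x by ring. replace (- (x + 1 + y)) with (- (x + y) - 1) by ring. ring.
    - intros t Ht. apply (continuous_minus (V:=RN));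
      apply (continuous_scal_r (V:=RN)); apply bet_continuous; trivial.
    - assert (L := Rpower_lim_0 x Hx).
      assert (C : filterlim (fun t => Rpower (1 + t) (- (x + y))) at0 (locally (Rpower (1 + 0) (- (x + y))))).
      { apply (continuous_at_right (fun t => Rpower (1 + t) (- (x + y)))), continuous_Rpower_1p; lra. }
      replace 0 with (0 * Rpower (1 + 0) (- (x + y))) at 2 by ring.
      exact (filterlim_comp_2 _ _ Rmult L C (filterlim_mult (K:=R_AbsRing) 0 (Rpower (1 + 0) (- (x + y))))).
    - apply (infty_lim_0 _ 1). intros t Ht.
      rewrite Rabs_pos_eq by (left; apply Rmult_lt_0_compat; apply Rpower_pos).
      assert (Rpower t x <= Rpower (1 + t) x) by (apply Rle_Rpower_l; lra).
      eapply Rle_trans; [apply Rmult_le_compat_r; [left; apply Rpower_pos|exact H]|].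
      rewrite <- Rpower_plus. replace (x + - (x + y)) with (- y) by ring.
      rewrite Rpower_Ropp. unfold Rdiv; rewrite Rmult_1_l. apply Rinv_le_contravar; [lra|].
      rewrite <- (Rpower_1 (1 + t)) at 1 by lra. apply Rle_Rpower; lra. }
  assert (E := halfline_unique (V:=RNc) _ _ _ H H2).
  change (0 - 0 = x * Beta_int x y - (x + y) * Beta_int (x + 1) y) in E. lra.
Qed.

(** The tangent inequality for [(t/(1+t))^s] at the mean value [x/(x+y)] of
    [t/(1+t)]. *)
Lemma Beta_int_Wendel x y s : 0 < x -> 1 <= y -> 0 <= s <= 1 ->
  Beta_int (x + s) y <= Rpower (x / (x + y)) s * Beta_int x y.
Proof.
  intros Hx Hy Hs. assert (Hx1 : 0 < x + 1) by lra. assert (Hxs : 0 < x + s) by lra.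
  set (c := x / (x + y)). assert (Hc : 0 < c) by (apply Rdiv_lt_0_compat; lra).
  assert (H2 := is_RInt_gen_plus (V:=RN) _ _ _ _
    (is_RInt_gen_scal (V:=RN) _ (Rpower c s * (1 - s)) _ (Beta_int_correct x y Hx Hy))
    (is_RInt_gen_scal (V:=RN) _ (Rpower c s * s / c) _ (Beta_int_correct (x + 1) y Hx1 Hy))).
  assert (Hl' : Beta_int (x + s) y <= Rpower c s * (1 - s) * Beta_int x y + Rpower c s * s / c * Beta_int (x + 1) y).
  { refine (halfline_le_int _ _ _ _ _ (Beta_int_correct (x + s) y Hxs Hy) H2).
    intros t Ht; split; [apply bet_pos|].
    change (bet (x + s) y t <= Rpower c s * (1 - s) * bet x y t + Rpower c s * s / c * bet (x + 1) y t).
    rewrite !bet_frac by trivial. assert (Hf := frac_pos t Ht).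
    assert (T := Rpower_tangent_at (t / (1 + t)) c s Hf Hc Hs).
    replace (x + s - 1) with (s + (x - 1)) by ring. replace (x + 1 - 1) with (1 + (x - 1)) by ring.
    rewrite !Rpower_plus, Rpower_1 by trivial.
    assert (P1 := Rpower_pos (t / (1 + t)) (x - 1)). assert (P2 := Rpower_pos (1 + t) (- (y + 1))).
    apply (Rmult_le_compat_r (Rpower (t / (1 + t)) (x - 1) * Rpower (1 + t) (- (y + 1)))) in T; [|nra].
    lra. }
  eapply Rle_trans; [exact Hl'|]. right.
  assert (E := Beta_int_succ x y Hx Hy).
  assert (E' : Beta_int (x + 1) y = c * Beta_int x y).
  { apply (Rmult_eq_reg_l (x + y)); [|lra]. rewrite <- E. unfold c; field; lra. }
  rewrite E'. field; lra.
Qed.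

Lemma Beta_int_1 y : 1 <= y -> Beta_int 1 y = / y.
Proof.
  intros Hy.
  assert (H : is_RInt_gen (bet 1 y) at0 at_oo (minus (0 * (- / y)) (Rpower (1 + 0) (- y) * (- / y)))).
  { apply (halfline_FTC (V:=RNc) (fun t => Rpower (1 + t) (- y) * (- / y))).
    - intros t Ht. unfold bet.
      eapply is_derive_eq; [|apply is_rderive_mult; [apply is_derive_Rpower_1p, Ht|apply (is_derive_const (K:=R_AbsRing)(V:=RN))]].
      cbn. replace (1 - 1) with 0 by ring. rewrite Rpower_O by trivial.
      replace (- (1 + y)) with (- y - 1) by ring. change zero with 0. field; lra.
    - intros t Ht. apply bet_continuous; trivial.
    - apply (continuous_at_right (fun t => Rpower (1 + t) (- y) * (- / y))).
      apply (continuous_mult (K:=R_AbsRing)); [|apply continuous_const].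
      apply continuous_Rpower_1p; lra.
    - rewrite Rmult_0_l. apply (infty_lim_0 _ (1 / y)). intros t Ht.
      assert (Hy' : 0 < / y) by (apply Rinv_0_lt_compat; lra).
      rewrite Rabs_mult, Rabs_Ropp, !Rabs_pos_eq by (try (left; apply Rpower_pos); lra).
      replace (1 / y / (1 + t)) with (/ (1 + t) * / y) by (field; lra).
      apply Rmult_le_compat_r; [lra|]. rewrite Rpower_Ropp. apply Rinv_le_contravar; [lra|].
      rewrite <- (Rpower_1 (1 + t)) at 1 by lra. apply Rle_Rpower; lra. }
  rewrite (halfline_unique (V:=RNc) _ _ _ (Beta_int_correct 1 y Rlt_0_1 Hy) H).
  rewrite Rplus_0_r. unfold Rpower. rewrite ln_1, Rmult_0_r, exp_0.
  change (0 * - / y - 1 * - / y = / y). ring.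
Qed.

(** For fixed [y], the function B(x,y) Gamma(x+y) of [x] satisfies the
    characterization of Gamma. *)
Lemma Beta_Gamma x y : 0 < x -> 1 <= y -> Beta_int x y * Gamma (x + y) = Gamma x * Gamma y.
Proof.
  intros Hx Hy.
  assert (W : Wendel (fun x => Beta_int x y * Gamma (x + y))).
  { repeat split.
    - intros z Hz. apply Rmult_le_pos; [apply Beta_int_ge0|apply Gamma_ge0]; lra.
    - intros z Hz. replace (z + 1 + y) with (z + y + 1) by ring. rewrite Gamma_succ by lra.
      assert (E := Beta_int_succ z y Hz Hy).
      replace (Beta_int (z + 1) y * ((z + y) * Gamma (z + y))) with ((z + y) * Beta_int (z + 1) y * Gamma (z + y)) by ring.
      rewrite <- E; ring.
    - intros z s Hz Hs. replace (z + s + y) with (z + y + s) by ring.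
      assert (G1 := Beta_int_Wendel z y s Hz Hy Hs).
      assert (G2 := Gamma_Wendel (z + y) s ltac:(lra) Hs).
      assert (P1 := Beta_int_ge0 (z + s) y ltac:(lra) Hy).
      assert (P2 := Gamma_ge0 (z + y + s) ltac:(lra)).
      assert (P3 := Beta_int_ge0 z y ltac:(lra) Hy).
      assert (P4 := Gamma_ge0 (z + y) ltac:(lra)).
      eapply Rle_trans; [apply Rmult_le_compat; eassumption|].
      assert (E : Rpower (z / (z + y)) s * Rpower (z + y) s = Rpower z s).
      { rewrite Rpower_mult_distr by (try apply Rdiv_lt_0_compat; lra). f_equal; field; lra. }
      replace (Rpower (z / (z + y)) s * Beta_int z y * (Rpower (z + y) s * Gamma (z + y)))
        with (Rpower (z / (z + y)) s * Rpower (z + y) s * (Beta_int z y * Gamma (z + y))) by ring.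
      rewrite E. apply Rmult_le_compat_r; [nra|]. apply Rle_Rpower_l; lra. }
  rewrite (Wendel_eq_Gamma _ x W Hx). rewrite Beta_int_1 by trivial.
  rewrite (Rplus_comm 1 y), Gamma_succ by lra. field; lra.
Qed.

(** * The generalized Stieltjes transform of a power *)

Lemma is_cderive_Cpow (u : R -> C) (x : R) (a : C) (n : nat) :
  is_cderive u x a ->
  is_cderive (fun t => Cpow (u t) n) x (INR n * a * Cpow (u x) (pred n))%C.
Proof.
  intros Ha. induction n.
  - apply (is_cderive_ext (fun _ => 1%C)); [reflexivity|].
    eapply is_cderive_val; [apply is_cderive_const|]. cbn. ring.
  - apply (is_cderive_ext (fun t => u t * Cpow (u t) n)%C); [reflexivity|].
    eapply is_cderive_val; [apply is_cderive_mult; [exact Ha|exact IHn]|].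
    rewrite S_INR, RtoC_plus. destruct n.
    + cbn. ring.
    + cbn [pred]. rewrite !Cpow_S. ring.
Qed.

Lemma is_cderive_ipow (u : R -> C) (x : R) (a : C) (n : nat) :
  u x <> (RtoC 0) -> is_cderive u x a ->
  is_cderive (fun t => Cpow (/ u t) n) x (- (INR n * a * Cpow (/ u x) (S n)))%C.
Proof.
  intros Hx Ha. eapply is_cderive_val.
  - apply is_cderive_Cpow, is_cderive_inv; eassumption.
  - destruct n; cbn [pred]; [cbn; ring|]. rewrite !Cpow_S. field. exact Hx.
Qed.

Lemma is_cderive_shift (z : C) (x : R) : is_cderive (fun t => RtoC t + z)%C x 1%C.
Proof.
  eapply is_cderive_val.
  - apply is_cderive_plus; [|apply is_cderive_const].
    apply is_cderive_RtoC. apply (is_derive_id (K:=R_AbsRing)).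
  - change one with 1. ring.
Qed.

(** The plane cut along the negative half-axis, in the form in which it bounds the
    integrands. *)
Definition slit (z : C) : Prop :=
  exists c : R, 0 < c /\ forall t, 0 <= t -> c * (1 + t) <= Cmod (t + z).

Lemma slit_neq0 z t : slit z -> 0 <= t -> (t + z)%C <> (RtoC 0).
Proof.
  intros [c [Hc H]] Ht E. specialize (H t Ht). rewrite E, Cmod_0 in H. nra.
Qed.

Definition kern (b : R) (n : nat) (z : C) (t : R) : C :=
  (Cpow (/ (t + z)) n / Rpower t b)%C.

Definition stieltjes (b : R) (n : nat) (z : C) : C :=
  RInt_gen (V := CRc) (kern b n z) at0 at_oo.

Lemma RtoC_neq0 (r : R) : r <> 0 -> RtoC r <> (RtoC 0).
Proof. intros H E; apply H. injection E; auto. Qed.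

Lemma RtoC_Rpower_neq0 t b : RtoC (Rpower t b) <> (RtoC 0).
Proof. apply RtoC_neq0, Rgt_not_eq, Rpower_pos. Qed.

Lemma Cmod_Rpower t b : Cmod (Rpower t b) = Rpower t b.
Proof. rewrite Cmod_R. apply Rabs_pos_eq. left; apply Rpower_pos. Qed.

Lemma is_cderive_Rpower_inv b t : 0 < t ->
  is_cderive (fun t => / RtoC (Rpower t b))%C t (- (b / (t * Rpower t b)))%C.
Proof.
  intros Ht. eapply is_cderive_val.
  - apply is_cderive_inv; [apply RtoC_Rpower_neq0|].
    apply is_cderive_RtoC, is_derive_Rpower, Ht.
  - cbv beta. assert (E : Rpower t (b - 1) = Rpower t b / t).
    { unfold Rminus; rewrite Rpower_plus, Rpower_Ropp, Rpower_1 by trivial. reflexivity. }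
    rewrite E. rewrite RtoC_mult, RtoC_div by lra.
    field. split; [apply RtoC_Rpower_neq0|apply RtoC_neq0; lra].
Qed.

Lemma continuous_Cmult_l (c : C) (f : R -> C) (t : R) :
  continuous (U:=CR) f t -> continuous (U:=CR) (fun t => c * f t)%C t.
Proof.
  intros H. apply (continuous_comp (V:=CR) f (fun z => c * z)%C); [exact H|apply continuous_cmult].
Qed.

Lemma kern_continuous b n z t : slit z -> 0 < t ->
  continuous (U:=CRc) (kern b n z) t.
Proof.
  intros Hz Ht. eapply is_cderive_continuous. unfold kern, Cdiv. apply is_cderive_mult.
  - apply (is_cderive_ipow (fun t => RtoC t + z)%C).
    + apply slit_neq0; trivial; lra.
    + apply is_cderive_shift.
  - apply is_cderive_Rpower_inv, Ht.
Qed.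

Lemma Rpower_ge1 x a : 1 <= x -> 0 <= a -> 1 <= Rpower x a.
Proof.
  intros Hx Ha. apply Rle_trans with (Rpower x 0); [right; symmetry; apply Rpower_O; lra|].
  apply Rle_Rpower; lra.
Qed.

Lemma ex_cint (b M : R) (f : R -> C) : 0 < b < 1 -> 0 <= M ->
  (forall t, 0 < t -> continuous (U:=CRc) f t) ->
  (forall t, 0 < t -> Cmod (f t) <= M * (/ Rpower t b * / (1 + t) ^ 2)) ->
  exists l, is_cRInt_gen f at0 at_oo l /\ Cmod l <= M / (1 - b).
Proof.
  intros Hb HM Cf Hf.
  destruct (ex_halfline_dom (V:=CRc) f M (1 - b)) as [l [H1 H2]]; trivial; [lra| |].
  - intros t Ht. eapply Rle_trans; [right; symmetry; apply Cmod_norm|].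
    eapply Rle_trans; [apply Hf, Ht|].
    apply Rmult_le_compat_l; trivial. unfold dom. rewrite Rpower_frac by trivial.
    replace (1 - b - 1) with (- b) by ring. rewrite Ropp_involutive, Rpower_Ropp.
    assert (0 < / (1 + t) ^ 2) by (apply Rinv_0_lt_compat; nra).
    assert (0 < / Rpower t b) by (apply Rinv_0_lt_compat, Rpower_pos).
    assert (1 <= Rpower (1 + t) b) by (apply Rpower_ge1; lra).
    apply Rmult_le_compat_r; [lra|]. nra.
  - exists l; split; trivial. eapply Rle_trans; [right; apply Cmod_norm|exact H2].
Qed.

Lemma Cmod_kern b n z t : slit z -> 0 < t ->
  Cmod (kern b n z t) = (/ Cmod (t + z)) ^ n * / Rpower t b.
Proof.
  intros Hz Ht. unfold kern, Cdiv. rewrite Cmod_mult, Cmod_pow, !Cmod_inv, Cmod_Rpower; trivial.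
  - apply RtoC_Rpower_neq0.
  - apply slit_neq0; trivial; lra.
Qed.

Lemma inv_pow_bound c A t n : 0 < c -> 0 <= t -> c * (1 + t) <= A ->
  0 <= (/ A) ^ n <= (/ c) ^ n * (/ (1 + t)) ^ n.
Proof.
  intros Hc Ht HA. rewrite <- Rpow_mult_distr, <- Rinv_mult.
  assert (0 < c * (1 + t)) by nra.
  assert (0 < / A) by (apply Rinv_0_lt_compat; lra).
  split; [apply pow_le; lra|]. apply pow_incr; split; [lra|]. apply Rinv_le_contravar; lra.
Qed.

Lemma pow_le1 x n : 0 <= x <= 1 -> x ^ n <= 1.
Proof. intros Hx. apply Rle_trans with (1 ^ n); [apply pow_incr, Hx|right; apply pow1]. Qed.

Lemma inv_pow_ge2 t n : 0 <= t -> (2 <= n)%nat -> (/ (1 + t)) ^ n <= / (1 + t) ^ 2.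
Proof.
  intros Ht Hn. rewrite <- pow_inv.
  replace n with (2 + (n - 2))%nat by lia. rewrite pow_add.
  assert (0 < / (1 + t) <= 1).
  { split; [apply Rinv_0_lt_compat; lra|]. rewrite <- Rinv_1. apply Rinv_le_contravar; lra. }
  rewrite <- (Rmult_1_r ((/ (1 + t)) ^ 2)) at 2. apply Rmult_le_compat_l; [apply pow_le; lra|].
  apply pow_le1; lra.
Qed.

Lemma kern_bound b n z : (2 <= n)%nat -> slit z ->
  exists M, 0 <= M /\ forall t, 0 < t -> Cmod (kern b n z t) <= M * (/ Rpower t b * / (1 + t) ^ 2).
Proof.
  intros Hn Hz. destruct Hz as [c [Hc H]]; assert (Hz : slit z) by (exists c; auto).
  assert (Hcn : 0 <= (/ c) ^ n) by (apply pow_le; left; apply Rinv_0_lt_compat, Hc).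
  exists ((/ c) ^ n). split; [exact Hcn|]. intros t Ht. rewrite Cmod_kern by trivial.
  rewrite (Rmult_comm (/ Rpower t b)), <- Rmult_assoc.
  apply Rmult_le_compat_r; [left; apply Rinv_0_lt_compat, Rpower_pos|].
  eapply Rle_trans; [exact (proj2 (inv_pow_bound c _ t n Hc (Rlt_le _ _ Ht) (H t (Rlt_le _ _ Ht))))|].
  apply Rmult_le_compat_l; [exact Hcn|]. apply inv_pow_ge2; trivial; lra.
Qed.

Lemma stieltjes_correct b n z : 0 < b < 1 -> (2 <= n)%nat -> slit z ->
  is_cRInt_gen (kern b n z) at0 at_oo (stieltjes b n z).
Proof.
  intros Hb Hn Hz. apply (RInt_gen_correct (V:=CRc)).
  destruct (kern_bound b n z Hn Hz) as [M [HM HB]].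
  destruct (ex_cint b M (kern b n z) Hb HM) as [l [Hl _]]; [|exact HB|exists l; exact Hl].
  intros t Ht. apply kern_continuous; trivial.
Qed.

Lemma clim_0 (f : R -> C) (g : R -> R) (F : (R -> Prop) -> Prop) (FF : Filter F) :
  F (fun t => Cmod (f t) <= g t) -> filterlim g F (locally 0) ->
  filterlim f F (locally (T:=CRc) (RtoC 0)).
Proof.
  intros Hfg Hg. apply filterlim_locally. intros eps.
  assert (H2 : F (fun t => g t < eps)).
  { apply (Hg (fun y => y < eps)). exists eps. intros y Hy.
    unfold ball in Hy; cbn in Hy; unfold AbsRing_ball, abs, minus, plus, opp in Hy; cbn in Hy.
    apply Rabs_def2 in Hy; lra. }
  generalize (filter_and _ _ Hfg H2). apply filter_imp. intros t [H3 H4].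
  apply (norm_compat1 (V:=CR)).
  apply Rle_lt_trans with (Cmod (f t)); [right|lra].
  rewrite Cmod_norm. f_equal. unfold minus.
  destruct (f t); C_parts; unfold plus, opp; cbn; ring.
Qed.

Lemma cint_unique (f : R -> C) l1 l2 :
  is_cRInt_gen f at0 at_oo l1 ->
  is_cRInt_gen f at0 at_oo l2 -> l1 = l2.
Proof. apply (halfline_unique (V:=CRc)). Qed.

Lemma is_cRInt_gen_plus (f g : R -> C) Fa Fb (FFa : Filter Fa) (FFb : Filter Fb) (lf lg : C) :
  is_cRInt_gen f Fa Fb lf -> is_cRInt_gen g Fa Fb lg ->
  is_cRInt_gen (fun t => f t + g t)%C Fa Fb (lf + lg)%C.
Proof. intros; apply (is_RInt_gen_plus (V:=CR)); assumption. Qed.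

Lemma is_cRInt_gen_minus (f g : R -> C) Fa Fb (FFa : Filter Fa) (FFb : Filter Fb) (lf lg : C) :
  is_cRInt_gen f Fa Fb lf -> is_cRInt_gen g Fa Fb lg ->
  is_cRInt_gen (fun t => f t - g t)%C Fa Fb (lf - lg)%C.
Proof. intros; apply (is_RInt_gen_minus (V:=CR)); assumption. Qed.

Notation is_cint f l := (is_cRInt_gen f at0 at_oo l).

Lemma cint_cmult (c : C) (f : R -> C) (l : C) :
  is_cint f l -> is_cint (fun t => c * f t)%C (c * l)%C.
Proof. apply is_cRInt_gen_cmult; typeclasses eauto. Qed.

Lemma cint_plus (f g : R -> C) (lf lg : C) :
  is_cint f lf -> is_cint g lg -> is_cint (fun t => f t + g t)%C (lf + lg)%C.
Proof. apply is_cRInt_gen_plus; typeclasses eauto. Qed.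

Lemma cint_minus (f g : R -> C) (lf lg : C) :
  is_cint f lf -> is_cint g lg -> is_cint (fun t => f t - g t)%C (lf - lg)%C.
Proof. apply is_cRInt_gen_minus; typeclasses eauto. Qed.

Lemma cint_ext (f g : R -> C) (l : C) :
  (forall x, 0 < x -> f x = g x) ->
  is_cRInt_gen f at0 at_oo l ->
  is_cRInt_gen g at0 at_oo l.
Proof. apply (halfline_ext (V:=CR)). Qed.

(** Integrate the derivative of [t^(1-b) (t+z)^(-n)], writing [t = (t+z) - z]. *)
Lemma stieltjes_succ b n z : 0 < b < 1 -> (2 <= n)%nat -> slit z ->
  (INR n * z * stieltjes b (S n) z = (INR n - 1 + b)%R * stieltjes b n z)%C.
Proof.
  intros Hb Hn Hz.
  assert (H2 := cint_minus _ _ _ _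
    (cint_cmult (INR n * z)%C _ _ (stieltjes_correct b (S n) z Hb ltac:(lia) Hz))
    (cint_cmult (INR n - 1 + b)%R _ _ (stieltjes_correct b n z Hb Hn Hz))).
  assert (H : is_cRInt_gen (fun t => INR n * z * kern b (S n) z t - (INR n - 1 + b)%R * kern b n z t)%C
     at0 at_oo (minus (RtoC 0 : CRc) (RtoC 0))).
  { destruct (kern_bound b n z Hn Hz) as [M [HM HB0]].
    assert (HB : forall t, 0 < t -> Cmod (t * (Cpow (/ (t + z)) n * / Rpower t b)) <= M * (Rpower t (1 - b) * / (1 + t) ^ 2)).
    { intros t Ht. rewrite Cmod_mult, Cmod_R, Rabs_pos_eq by lra.
      unfold Rminus. rewrite Rpower_plus, Rpower_1, Rpower_Ropp by trivial.
      replace (M * (t * / Rpower t b * / (1 + t) ^ 2)) with (t * (M * (/ Rpower t b * / (1 + t) ^ 2))) by ring.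
      apply Rmult_le_compat_l; [lra|]. apply HB0, Ht. }
    apply (halfline_FTC (V:=CRc)
      (fun t => RtoC t * (Cpow (/ (t + z)) n * / Rpower t b))%C).
    - intros t Ht. eapply is_cderive_val.
      + apply is_cderive_mult; [apply is_cderive_RtoC, (is_derive_id (K:=R_AbsRing))|].
        apply is_cderive_mult; [|apply is_cderive_Rpower_inv, Ht].
        apply (is_cderive_ipow (fun t => RtoC t + z)%C); [|apply is_cderive_shift].
        apply slit_neq0; trivial; lra.
      + unfold kern. change one with 1. rewrite !Cpow_S, RtoC_plus, RtoC_minus. field.
        repeat split; first [apply RtoC_Rpower_neq0 | apply slit_neq0; trivial; lra | apply RtoC_neq0; lra].
    - intros t Ht.
      apply (continuous_minus (V:=CR) (fun t => INR n * z * kern b (S n) z t)%C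
        (fun t => (INR n - 1 + b)%R * kern b n z t)%C);
      apply continuous_Cmult_l, kern_continuous; trivial.
    - apply (clim_0 _ (fun t => M * Rpower t (1 - b))); try typeclasses eauto.
      + generalize (at_right_gt 0). apply filter_imp. intros t Ht. eapply Rle_trans; [apply HB, Ht|].
        apply Rmult_le_compat_l; [exact HM|]. rewrite <- (Rmult_1_r (Rpower t (1 - b))) at 2.
        apply Rmult_le_compat_l; [left; apply Rpower_pos|].
        rewrite <- Rinv_1 at 2. apply Rinv_le_contravar; nra.
      + replace 0 with (M * 0) at 2 by ring.
        apply (filterlim_comp _ _ _ (fun t => Rpower t (1 - b)) (fun y => M * y) _ (locally 0)).
        * apply Rpower_lim_0; lra.
        * apply (filterlim_scal_r (V:=RN) M 0).
    - apply (clim_0 _ (fun t => M * / (1 + t))); try typeclasses eauto.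
      + generalize (p_infty_gt 0). apply filter_imp. intros t Ht. eapply Rle_trans; [apply HB, Ht|].
        apply Rmult_le_compat_l; [exact HM|].
        assert (HR : Rpower t (1 - b) <= 1 + t).
        { apply Rle_trans with (Rpower (1 + t) (1 - b)); [apply Rle_Rpower_l; lra|].
          rewrite <- (Rpower_1 (1 + t)) at 2 by lra. apply Rle_Rpower; lra. }
        apply Rle_trans with ((1 + t) * / (1 + t) ^ 2); [|right; field; lra].
        apply Rmult_le_compat_r; [left; apply Rinv_0_lt_compat; nra|exact HR].
      + apply (infty_lim_0 _ M). intros t Ht. right. apply Rabs_pos_eq.
        apply Rmult_le_pos; [exact HM|left; apply Rinv_0_lt_compat; lra]. }
  assert (E := cint_unique _ _ _ H H2).
  apply Ceq_minus. etransitivity; [symmetry; exact E|].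
  C_parts; unfold plus, opp; cbn; ring.
Qed.

(** * Analyticity and polar form of the Stieltjes transform *)

(** Differentiation under the integral sign, without any theorem: [1/B^2 - 1/A^2 +
    2d/A^3 = d^2 (1/(A^2 B^2) + 2/(A^3 B))] when [B = A + d], with [A = t+z] and [B
    = t+z']. *)
Lemma stieltjes2_quadratic b z c : 0 < b < 1 -> 0 < c ->
  (forall t, 0 <= t -> c * (1 + t) <= Cmod (t + z)) ->
  exists M, forall z', Cmod (z' - z) <= c / 2 ->
    Cmod (stieltjes b 2 z' - stieltjes b 2 z + 2 * (z' - z) * stieltjes b 3 z) <= M * (Cmod (z' - z)) ^ 2.
Proof.
  intros Hb Hc Hz. exists (8 * (/ c) ^ 4 / (1 - b)). intros z' Hd.
  assert (Sz : slit z) by (exists c; auto).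
  set (d := (z' - z)%C) in *.
  assert (Hz' : forall t, 0 <= t -> c / 2 * (1 + t) <= Cmod (t + z')).
  { intros t Ht. specialize (Hz t Ht).
    assert (T := Cmod_triangle (t + z') (- d)). rewrite Cmod_opp in T.
    replace (t + z' + - d)%C with (t + z)%C in T by (unfold d; ring). nra. }
  assert (Sz' : slit z') by (exists (c / 2); split; [lra|auto]).
  assert (H : is_cint (fun t => kern b 2 z' t - kern b 2 z t + 2 * d * kern b 3 z t)%C
    (stieltjes b 2 z' - stieltjes b 2 z + 2 * d * stieltjes b 3 z)%C).
  { apply cint_plus; [apply cint_minus|apply cint_cmult]; apply stieltjes_correct; auto. }
  set (f := (fun t => kern b 2 z' t - kern b 2 z t + 2 * d * kern b 3 z t)%C) in *.
  destruct (ex_cint b (8 * (/ c) ^ 4 * Cmod d ^ 2) f Hb) as [l [Hl Bl]].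
  - repeat apply Rmult_le_pos; try lra; try apply Cmod_ge_0; try (left; apply Rinv_0_lt_compat; lra).
  - intros t Ht. unfold f.
    assert (D : forall m w, slit w -> continuous (U:=CR) (kern b m w) t) by (intros; apply kern_continuous; trivial).
    apply (continuous_plus (V:=CR) (fun t => minus (kern b 2 z' t : CR) (kern b 2 z t)) (fun t => 2 * d * kern b 3 z t)%C).
    + apply (continuous_minus (V:=CR)); apply D; trivial.
    + apply continuous_Cmult_l, D; trivial.
  - intros t Ht.
    assert (NA : (t + z)%C <> 0%C) by (apply slit_neq0; trivial; lra).
    assert (NB : (t + z')%C <> 0%C) by (apply slit_neq0; trivial; lra).
    set (A := / Cmod (t + z)). set (B := / Cmod (t + z')).
    assert (E : f t = ((d * d * (Cpow (/ (t + z)) 2 * Cpow (/ (t + z')) 2 + 2 * Cpow (/ (t + z)) 3 * / (t + z'))) * / Rpower t b)%C).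
    { unfold f, kern, d. rewrite !Cpow_S. field. repeat split; trivial. apply RtoC_Rpower_neq0. }
    rewrite E, Cmod_mult, Cmod_inv, Cmod_Rpower by apply RtoC_Rpower_neq0.
    rewrite (Rmult_comm (/ Rpower t b)), <- Rmult_assoc.
    apply Rmult_le_compat_r; [left; apply Rinv_0_lt_compat, Rpower_pos|].
    rewrite Cmod_mult. rewrite Cmod_mult.
    replace (8 * (/ c) ^ 4 * Cmod d ^ 2 * / (1 + t) ^ 2) with (Cmod d * Cmod d * (8 * (/ c) ^ 4 * / (1 + t) ^ 2)) by ring.
    apply Rmult_le_compat_l; [apply Rmult_le_pos; apply Cmod_ge_0|].
    eapply Rle_trans; [apply Cmod_triangle|].
    rewrite !Cmod_mult, !Cmod_pow, !Cmod_inv, Cmod_R, Rabs_pos_eq by (trivial; lra).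
    fold A B.
    set (p := / (1 + t)).
    assert (Hp : 0 < p <= 1).
    { unfold p; split; [apply Rinv_0_lt_compat; lra|]. rewrite <- Rinv_1. apply Rinv_le_contravar; lra. }
    assert (Hic : 0 < / c) by (apply Rinv_0_lt_compat; trivial).
    assert (HA : 0 <= A <= / c * p).
    { destruct (inv_pow_bound c _ t 1 Hc ltac:(lra) (Hz t ltac:(lra))) as [I1 I2]. rewrite !pow_1 in *. split; assumption. }
    assert (HB : 0 <= B <= 2 * / c * p).
    { destruct (inv_pow_bound (c / 2) _ t 1 ltac:(lra) ltac:(lra) (Hz' t ltac:(lra))) as [I1 I2]. rewrite !pow_1 in *. split; trivial.
      replace (2 * / c) with (/ (c / 2)) by (field; lra). exact I2. }
    replace (/ (1 + t) ^ 2) with (p ^ 2) by (unfold p; field; lra).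
    assert (U1 : A ^ 2 * B ^ 2 <= (/ c * p) ^ 2 * (2 * / c * p) ^ 2).
    { apply Rmult_le_compat; try (apply pow_le; lra); apply pow_incr; lra. }
    assert (U2 : 2 * A ^ 3 * B <= 2 * (/ c * p) ^ 3 * (2 * / c * p)).
    { apply Rmult_le_compat; try lra; [apply Rmult_le_pos; [lra|apply pow_le; lra]|].
      apply Rmult_le_compat_l; [lra|]. apply pow_incr; lra. }
    assert (U3 : (/ c) ^ 4 * (p ^ 2 * p ^ 2) <= (/ c) ^ 4 * (p ^ 2 * 1)).
    { apply Rmult_le_compat_l; [apply pow_le; lra|]. apply Rmult_le_compat_l; [apply pow_le; lra|]. apply pow_le1; lra. }
    nra.
  - rewrite (cint_unique _ _ _ H Hl). eapply Rle_trans; [exact Bl|]. right; field; lra.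
Qed.

Lemma is_cderive_squeeze (h g : R -> C) (x M : R) :
  locally x (fun t => Cmod (h t) <= M * Cmod (g t)) -> g x = 0%C -> 0 <= M ->
  is_cderive g x 0%C -> is_cderive h x 0%C.
Proof.
  intros Hh Hg HM [_ D]. split.
  { apply (is_linear_scal_l (K:=R_AbsRing) (V:=CR)). }
  intros y Hy.
  assert (Ey : x = y) by (apply (is_filter_lim_locally_unique (V:=RN)); exact Hy).
  rewrite <- Ey in *. clear y Ey.
  specialize (D x Hy).
  assert (hx : h x = 0%C).
  { apply locally_singleton in Hh. rewrite Hg, Cmod_0, Rmult_0_r in Hh.
    apply Cmod_eq_0. generalize (Cmod_ge_0 (h x)); lra. }
  intros eps.
  assert (He : 0 < eps / (M + 1)) by (apply Rdiv_lt_0_compat; [apply cond_pos|lra]).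
  specialize (D (mkposreal _ He)). cbn [pos] in D.
  generalize (filter_and _ _ D Hh). apply filter_imp. intros t [D1 D2].
  assert (E : forall k : R -> C, k x = 0%C -> minus (minus (k t) (k x) : CR) (scal (minus t x) (RtoC 0)) = k t).
  { intros k Hk. rewrite Hk. unfold minus. rewrite scal_R_Cmult, Cmult_0_r.
    destruct (k t); C_parts; unfold plus, opp; cbn; ring. }
  assert (D3 : Cmod (g t) <= eps / (M + 1) * norm (minus t x)).
  { eapply Rle_trans; [|exact D1]. right. rewrite Cmod_norm. f_equal. symmetry. apply (E g Hg). }
  apply Rle_trans with (Cmod (h t)).
  { right. rewrite Cmod_norm. f_equal. apply (E h hx). }
  change (Cmod (h t) <= eps * norm (minus t x)).
  assert (N := norm_ge_0 (minus t x)).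
  eapply Rle_trans; [exact D2|].
  apply Rle_trans with ((M + 1) * (eps / (M + 1) * norm (minus t x))); [|right; field; lra].
  generalize (Cmod_ge_0 (g t)). intros.
  apply Rle_trans with ((M + 1) * Cmod (g t)); [nra|]. apply Rmult_le_compat_l; [lra|exact D3].
Qed.

Lemma is_cderive_stieltjes2 b (u : R -> C) (x : R) (a : C) : 0 < b < 1 -> slit (u x) ->
  is_cderive u x a -> is_cderive (fun t => stieltjes b 2 (u t)) x (- (2) * a * stieltjes b 3 (u x))%C.
Proof.
  intros Hb Hs Hu. destruct Hs as [c [Hc Hs]].
  destruct (stieltjes2_quadratic b (u x) c Hb Hc Hs) as [M HM].
  assert (L : locally x (fun t => Cmod (u t - u x) <= c / 2)).
  { assert (C := is_cderive_continuous _ _ _ Hu).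
    assert (Nf := norm_factor_gt_0 (V:=CR)).
    assert (Hc2 : 0 < c / 2 / norm_factor (V:=CR)) by (apply Rdiv_lt_0_compat; lra).
    specialize (C _ (locally_ball (u x) (mkposreal _ Hc2))). unfold filtermap in C.
    revert C. apply filter_imp. intros t Ht.
    apply Rlt_le. apply (norm_compat2 (V:=CR)) in Ht. cbn [pos] in Ht.
    assert (E : norm_factor (V:=CR) * (c / 2 / norm_factor (V:=CR)) <= c / 2) by (right; field; lra).
    eapply Rle_lt_trans; [right; apply Cmod_norm|]. eapply Rlt_le_trans; [|exact E].
    exact Ht. }
  assert (D0 : is_cderive (fun t => stieltjes b 2 (u t) - stieltjes b 2 (u x) + 2 * (u t - u x) * stieltjes b 3 (u x))%C x 0%C).
  { apply (is_cderive_squeeze _ (fun t => (u t - u x) * (u t - u x))%C x (Rmax M 0)).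
    - revert L. apply filter_imp. intros t Ht. eapply Rle_trans; [apply HM, Ht|].
      rewrite Cmod_mult. cbn [pow]. rewrite Rmult_1_r. apply Rmult_le_compat_r; [|apply Rmax_l].
      apply Rmult_le_pos; apply Cmod_ge_0.
    - ring.
    - apply Rmax_r.
    - eapply is_cderive_val; [apply is_cderive_mult; apply is_cderive_minus; [exact Hu|apply is_cderive_const|exact Hu|apply is_cderive_const]|]. cbv beta. ring. }
  apply (is_cderive_ext (fun t => (stieltjes b 2 (u t) - stieltjes b 2 (u x) + 2 * (u t - u x) * stieltjes b 3 (u x)) + (stieltjes b 2 (u x) + - (2) * stieltjes b 3 (u x) * (u t - u x)))%C).
  { intros t. ring. }
  eapply is_cderive_val.
  - apply is_cderive_plus; [exact D0|]. apply is_cderive_plus; [apply is_cderive_const|].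
    apply is_cderive_scal. apply is_cderive_minus; [exact Hu|apply is_cderive_const].
  - ring.
Qed.

Lemma is_cderive_stieltjes b n (u : R -> C) (x : R) (a : C) : 0 < b < 1 -> (2 <= n)%nat ->
  (forall t, slit (u t)) ->
  is_cderive u x a -> is_cderive (fun t => stieltjes b n (u t)) x (- INR n * a * stieltjes b (S n) (u x))%C.
Proof.
  intros Hb Hn Hs Hu. induction Hn as [|n Hn IH].
  - eapply is_cderive_val; [apply is_cderive_stieltjes2; eauto|]. cbn [INR]. rewrite RtoC_plus. ring.
  - assert (Nu : forall t, u t <> 0%C).
    { intros t. generalize (slit_neq0 (u t) 0 (Hs t) (Rle_refl 0)). rewrite Cplus_0_l; trivial. }
    assert (Nn : RtoC (INR n) <> 0%C) by (apply RtoC_neq0, not_0_INR; lia).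
    assert (NSn : RtoC (INR (S n)) <> 0%C) by (apply RtoC_neq0, not_0_INR; lia).
    assert (E : forall t, stieltjes b (S n) (u t) = ((INR n - 1 + b)%R / INR n * (stieltjes b n (u t) * / u t))%C).
    { intros t. generalize (stieltjes_succ b n (u t) Hb Hn (Hs t)). intros E.
      replace ((INR n - 1 + b)%R / INR n * (stieltjes b n (u t) * / u t))%C with ((INR n - 1 + b)%R * stieltjes b n (u t) / INR n / u t)%C by (field; auto).
      rewrite <- E. field; auto. }
    apply (is_cderive_ext (fun t => (INR n - 1 + b)%R / INR n * (stieltjes b n (u t) * / u t))%C).
    { intros t; symmetry; apply E. }
    eapply is_cderive_val.
    + apply is_cderive_scal, is_cderive_mult; [exact IH|]. apply is_cderive_inv; [apply Nu|exact Hu].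
    + generalize (stieltjes_succ b (S n) (u x) Hb ltac:(lia) (Hs x)). intros E2.
      replace (- INR (S n) * a * stieltjes b (S (S n)) (u x))%C with (- a / u x * (INR (S n) * u x * stieltjes b (S (S n)) (u x)))%C by (field; auto).
      rewrite E2. rewrite (E x).
      rewrite S_INR. rewrite !RtoC_plus, !RtoC_minus, !RtoC_plus. field; auto.
Qed.

(** [|t + r e^(i th)|^2 - cos(th/2)^2 (t+r)^2 = sin(th/2)^2 (t-r)^2]. *)
Lemma slit_cis r th : 0 < r -> - PI < th < PI -> slit (r * cis th)%C.
Proof.
  intros Hr Hth.
  assert (Hc : 0 < cos (th / 2)) by (apply cos_gt_0; lra).
  set (m := Rmin 1 r). assert (Hm : 0 < m) by (apply Rmin_glb_lt; lra).
  assert (Hm1 : m <= 1) by apply Rmin_l. assert (Hm2 : m <= r) by apply Rmin_r.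
  exists (cos (th / 2) * m). split; [nra|]. intros t Ht.
  apply Rle_trans with (cos (th / 2) * (t + r)).
  { rewrite Rmult_assoc. apply Rmult_le_compat_l; nra. }
  unfold Cmod, cis. cbn. rewrite <- (sqrt_pow2 (cos (th / 2) * (t + r))) by nra.
  apply sqrt_le_1_alt.
  assert (E : cos th = 2 * cos (th / 2) * cos (th / 2) - 1).
  { rewrite <- cos_2a_cos. f_equal; field. }
  assert (E2 := sin2_cos2 th). unfold Rsqr in E2.
  assert (E3 : sin th * sin th = 1 - cos th * cos th) by lra.
  replace ((t + (r * cos th - 0 * sin th)) * ((t + (r * cos th - 0 * sin th)) * 1) + (0 + (r * sin th + 0 * cos th)) * ((0 + (r * sin th + 0 * cos th)) * 1))
   with (t * t + 2 * t * r * cos th + r * r * (cos th * cos th + sin th * sin th)) by ring.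
  replace (cos th * cos th + sin th * sin th) with 1 by lra. rewrite E.
  assert (B : cos (th / 2) * cos (th / 2) <= 1).
  { generalize (sin2_cos2 (th / 2)); unfold Rsqr; nra. }
  set (k := cos (th / 2)) in *. cbn.
  assert (0 <= (1 - k * k) * ((t - r) * (t - r))) by (apply Rmult_le_pos; [lra|apply Rle_0_sqr]). nra.
Qed.

(** Along the path [exp(t (ln r + i th))] from 1 to [r e^(i th)], the transform
    times the power [exp((1+b) t (ln r + i th))] has zero derivative by
    [stieltjes_succ]. *)
Lemma stieltjes2_polar b r th : 0 < b < 1 -> 0 < r -> - PI < th < PI ->
  stieltjes b 2 (r * cis th) = (stieltjes b 2 1 * Rpower r (- (1 + b)) * cis (- (1 + b) * th))%C.
Proof.
  intros Hb Hr Hth.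
  set (rho := ln r).
  set (u := fun t : R => (RtoC (exp (t * rho)) * cis (th * t))%C).
  set (v := fun t : R => (RtoC (exp (t * ((1 + b) * rho))) * cis ((1 + b) * th * t))%C).
  assert (Su : forall t, 0 <= t <= 1 -> slit (u t)).
  { intros t Ht. apply slit_cis; [apply exp_pos|]. split; [|nra].
    destruct (Rle_dec 0 th); nra. }
  assert (De : forall k t, is_cderive (fun t => RtoC (exp (t * k))) t (k * exp (t * k))%C).
  { intros k t. eapply is_cderive_val; [apply is_cderive_RtoC; auto_derive; [trivial|reflexivity]|].
    rewrite !RtoC_mult. ring. }
  assert (Du : forall t, is_cderive u t ((rho + Ci * th) * u t)%C).
  { intros t. eapply is_cderive_val; [apply is_cderive_mult; [apply De|apply is_cderive_cis]|].
    unfold u. ring. }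
  assert (Dv : forall t, is_cderive v t ((1 + b) * (rho + Ci * th) * v t)%C).
  { intros t. eapply is_cderive_val; [apply is_cderive_mult; [apply De|apply is_cderive_cis]|].
    unfold v. rewrite !RtoC_mult, RtoC_plus. ring. }
  assert (C : (stieltjes b 2 (u 0) * v 0)%C = (stieltjes b 2 (u 1) * v 1)%C).
  { apply (eq_is_derive (V:=CR) (fun t => stieltjes b 2 (u t) * v t)%C 0 1); [|lra].
    intros t Ht. change (is_cderive (fun t => stieltjes b 2 (u t) * v t)%C t 0%C).
    eapply is_cderive_val; [apply is_cderive_mult; [apply is_cderive_stieltjes2; [exact Hb|apply Su, Ht|apply Du]|apply Dv]|].
    cbv beta.
    generalize (stieltjes_succ b 2 (u t) Hb (le_n 2) (Su t Ht)). cbn [INR]. rewrite !RtoC_plus, RtoC_minus, !RtoC_plus. intros E.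
    replace (- (2) * ((rho + Ci * th) * u t) * stieltjes b 3 (u t) * v t)%C
      with (- (rho + Ci * th) * ((1 + 1) * u t * stieltjes b 3 (u t)) * v t)%C by ring.
    rewrite E. ring. }
  assert (u0 : u 0 = 1%C) by (unfold u; rewrite Rmult_0_l, Rmult_0_r, exp_0, cis_0; ring).
  assert (v0 : v 0 = 1%C) by (unfold v; rewrite Rmult_0_l, Rmult_0_r, exp_0, cis_0; ring).
  assert (u1 : u 1 = (r * cis th)%C) by (unfold u; rewrite Rmult_1_l, Rmult_1_r; unfold rho; rewrite exp_ln; trivial).
  rewrite u0, v0, u1 in C. rewrite Cmult_1_r in C. rewrite C. rewrite <- !Cmult_assoc.
  rewrite <- (Cmult_1_r (stieltjes b 2 (r * cis th))) at 1. f_equal.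
  unfold v, Rpower. rewrite Rmult_1_l, Rmult_1_r. fold rho.
  replace (- (1 + b) * rho) with (- ((1 + b) * rho)) by ring.
  replace (- (1 + b) * th) with (- ((1 + b) * th)) by ring.
  transitivity ((exp ((1 + b) * rho) * exp (- ((1 + b) * rho))) * (cis ((1 + b) * th) * cis (- ((1 + b) * th))))%C; [|ring].
  rewrite <- RtoC_mult, <- exp_plus, <- cis_add, !Rplus_opp_r, exp_0, cis_0. ring.
Qed.

(** * Reflection formula and the constant of the fractional Laplacian *)

Lemma sqr_at_right_0 : filterlim (fun t => t ^ 2) at0 at0.
Proof.
  intros P [eps HP].
  assert (He : 0 < Rmin 1 eps) by (apply Rmin_glb_lt; [lra|apply cond_pos]).
  exists (mkposreal _ He). intros t Ht Hpos. apply HP; [|nra].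
  unfold ball in *; cbn -[pow] in *; unfold AbsRing_ball, abs, minus, plus, opp in *; cbn -[pow] in *.
  rewrite Ropp_0, Rplus_0_r in *. rewrite Rabs_pos_eq in Ht |- * by nra.
  assert (M1 := Rmin_l 1 eps). assert (M2 := Rmin_r 1 eps). nra.
Qed.

Lemma sqr_p_infty : filterlim (fun t => t ^ 2) at_oo at_oo.
Proof. intros P [M HP]. exists (Rmax 1 M). intros t Ht. apply HP.
  assert (M1 := Rmax_l 1 M). assert (M2 := Rmax_r 1 M). nra. Qed.

(** The substitution [t -> t^2]. *)
Lemma halfline_sqr (f : R -> R) (l : R) :
  (forall x, 0 < x -> continuous f x) ->
  is_RInt_gen f at0 at_oo l ->
  is_RInt_gen (fun t => 2 * t * f (t ^ 2)) at0 at_oo l.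
Proof.
  intros Cf H P HP. specialize (H P HP). unfold filtermapi in *.
  destruct H as [Q1 Q2 HQ1 HQ2 H].
  apply (Filter_prod _ _ _ (fun a => Q1 (a ^ 2) /\ 0 < a) (fun b => Q2 (b ^ 2) /\ 0 < b)).
  - apply filter_and; [exact (sqr_at_right_0 _ HQ1)|apply at_right_gt].
  - apply filter_and; [exact (sqr_p_infty _ HQ2)|apply p_infty_gt].
  - intros a b [Ha Ha'] [Hb Hb']. destruct (H _ _ Ha Hb) as [y [Hy Py]].
    exists y; split; trivial. cbn [fst snd] in *.
    rewrite <- (is_RInt_unique (V:=RNc) _ _ _ _ Hy).
    assert (Hm : 0 < Rmin a b) by (apply Rmin_glb_lt; trivial).
    apply (is_RInt_comp (V:=RNc) f (fun t => t ^ 2) (fun t => 2 * t) a b).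
    + intros x Hx. apply Cf. nra.
    + intros x Hx. split; [auto_derive; [trivial|ring]|].
      smooth; trivial.
Qed.

(** The Stieltjes transform for exponent 2 at the point 1. *)
Definition betar (b : R) : R := Beta_int (1 - b) (1 + b).

Lemma stieltjes2_1 b : 0 < b < 1 -> stieltjes b 2 1 = RtoC (betar b).
Proof.
  intros Hb.
  assert (S1 : slit 1).
  { replace (RtoC 1) with (1 * cis 0)%C by (rewrite cis_0; ring). apply slit_cis; generalize PI_RGT_0; lra. }
  apply (cint_unique (kern b 2 1)); [apply stieltjes_correct; auto|].
  apply (cint_ext (fun t => RtoC (bet (1 - b) (1 + b) t))).
  - intros t Ht. unfold bet, kern. replace (1 - b - 1) with (- b) by ring.
    replace (- (1 - b + (1 + b))) with (-2) by ring.
    rewrite Rpower_2, Rpower_Ropp by lra.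
    assert (RtoC (1 + t) <> 0%C) by (apply RtoC_neq0; lra).
    rewrite RtoC_mult, !RtoC_inv by (try apply Rgt_not_eq, Rpower_pos; nra).
    rewrite RtoC_pow, RtoC_plus in *. rewrite Cpow_inv by (rewrite Cplus_comm; trivial).
    rewrite (Cplus_comm t 1). field. split; trivial. apply RtoC_Rpower_neq0.
  - apply is_cRInt_gen_RtoC; try typeclasses eauto. apply Beta_int_correct; lra.
Qed.

(** The imaginary part of [(t+i)^(-2)] is [-2t/(1+t^2)^2]; the substitution [t ->
    t^2] turns its integral into the one for exponent [b/2]. The polar form gives
    the same imaginary part as [-cos(pi b/2)] times the value for [b]. *)
Lemma betar_half b : 0 < b < 1 -> betar (b / 2) = cos (PI * b / 2) * betar b.
Proof.
  intros Hb. assert (HPI := PI_RGT_0).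
  assert (Ei : (RtoC 1 * cis (PI / 2))%C = Ci).
  { unfold cis; rewrite cos_PI2, sin_PI2. unfold Ci. C_parts; ring. }
  assert (Si : slit Ci) by (rewrite <- Ei; apply slit_cis; lra).
  assert (E := stieltjes2_polar b 1 (PI / 2) Hb Rlt_0_1 ltac:(lra)).
  rewrite Ei, stieltjes2_1 in E by trivial.
  assert (H1 : is_RInt_gen (fun t => Im (kern b 2 Ci t)) at0 at_oo (Im (stieltjes b 2 Ci))).
  { apply is_cRInt_gen_Im; try typeclasses eauto. apply stieltjes_correct; auto. }
  assert (HB : is_RInt_gen (bet (1 - b / 2) (1 + b / 2)) at0 at_oo (betar (b / 2)))
    by (apply Beta_int_correct; lra).
  apply halfline_sqr in HB; [|intros x Hx; apply bet_continuous; trivial].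
  assert (H2 := is_RInt_gen_opp (V:=RN) _ _ HB).
  apply (halfline_ext (V:=RN) _ (fun t => Im (kern b 2 Ci t))) in H2.
  2:{ intros t Ht. change (- (2 * t * bet (1 - b / 2) (1 + b / 2) (t ^ 2)) = Im (kern b 2 Ci t)).
      unfold bet, kern. replace (1 - b / 2 - 1) with (- (b / 2)) by field.
      replace (- (1 - b / 2 + (1 + b / 2))) with (-2) by field.
      rewrite Rpower_2 by nra.
      assert (Ep : Rpower (t ^ 2) (- (b / 2)) = / Rpower t b).
      { rewrite <- Rpower_pow, Rpower_mult by trivial. rewrite <- Rpower_Ropp. f_equal. cbn; field. }
      rewrite Ep. assert (P := Rpower_pos t b).
      unfold Cdiv. rewrite <- RtoC_inv, im_scal_r by lra.
      assert (Ez : (/ (t + Ci))%C = (t / (1 + t ^ 2), - 1 / (1 + t ^ 2))).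
      { unfold Ci. C_parts; field; nra. }
      rewrite Ez. unfold Im; cbn. field. split; [lra|nra]. }
  assert (E2 := halfline_unique (V:=RNc) _ _ _ H1 H2).
  rewrite E in E2.
  replace (- (1 + b) * (PI / 2)) with (- (PI / 2 + PI * b / 2)) in E2 by field.
  replace (Rpower 1 (- (1 + b))) with 1 in E2 by (unfold Rpower; rewrite ln_1, Rmult_0_r, exp_0; trivial).
  rewrite Cmult_1_r, im_scal_l in E2. unfold cis in E2. cbn [Im snd] in E2.
  change (betar b * sin (- (PI / 2 + PI * b / 2)) = - betar (b / 2)) in E2.
  rewrite sin_neg, <- cos_sin in E2. lra.
Qed.

Lemma betar_Gamma b : 0 < b < 1 -> betar b = Gamma (1 - b) * Gamma (1 + b).
Proof.
  intros Hb. unfold betar. rewrite <- Beta_Gamma by lra.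
  replace (1 - b + (1 + b)) with (1 + 1) by ring. rewrite Gamma_succ, Gamma_1 by lra. ring.
Qed.

Lemma betar_bounds b : 0 < b < 1 -> / (1 + b) <= betar b <= / (1 - b).
Proof.
  intros Hb. rewrite betar_Gamma by trivial.
  assert (R1 : forall s, Rpower 1 s = 1) by (intros; unfold Rpower; rewrite ln_1, Rmult_0_r, exp_0; trivial).
  assert (G1 := Gamma_Wendel 1 b ltac:(lra) ltac:(lra)).
  assert (G2 := Gamma_Wendel 1 (1 - b) ltac:(lra) ltac:(lra)).
  assert (G3 := Gamma_Wendel (1 + b) (1 - b) ltac:(lra) ltac:(lra)).
  assert (G4 := Gamma_Wendel (1 - b) b ltac:(lra) ltac:(lra)).
  rewrite R1, Gamma_1 in *.
  replace (1 + b + (1 - b)) with (1 + 1) in G3 by ring. rewrite Gamma_succ, Gamma_1 in G3 by lra.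
  replace (1 - b + b) with 1 in G4 by ring. rewrite Gamma_1 in G4.
  replace (1 + (1 - b)) with (1 - b + 1) in G2 by ring. rewrite Gamma_succ in G2 by lra.
  assert (P1 := Gamma_ge0 (1 - b) ltac:(lra)). assert (P2 := Gamma_ge0 (1 + b) ltac:(lra)).
  assert (Q3 : Rpower (1 + b) (1 - b) <= 1 + b).
  { rewrite <- (Rpower_1 (1 + b)) at 2 by lra. apply Rle_Rpower; lra. }
  assert (Q4 : Rpower (1 - b) b <= 1).
  { apply Rle_trans with (Rpower 1 b); [apply Rle_Rpower_l; lra|rewrite R1; lra]. }
  assert (1 <= Gamma (1 - b)) by nra.
  assert (1 <= (1 + b) * Gamma (1 + b)) by nra.
  split.
  - apply (Rmult_le_reg_l (1 + b)); [lra|]. rewrite Rinv_r by lra. nra.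
  - apply (Rmult_le_reg_l (1 - b)); [lra|]. rewrite Rinv_r by lra. nra.
Qed.

(** By [betar_half] the quantity [betar b sin(pi b)/(pi b)] is unchanged when [b] is
    halved, and the bounds force it to 1 as [b -> 0]. *)
Lemma betar_eq b : 0 < b < 1 -> betar b = PI * b / sin (PI * b).
Proof.
  intros Hb. assert (HPI := PI_RGT_0).
  assert (Hs : forall x, 0 < x < 1 -> 0 < sin (PI * x)) by (intros x Hx; apply sin_gt_0; nra).
  set (x := fun n : nat => b * (1 / 2) ^ n).
  assert (Hx : forall n, 0 < x n <= b).
  { intros n. assert (0 < (1 / 2) ^ n) by (apply pow_lt; lra).
    assert ((1 / 2) ^ n <= 1) by (apply pow_le1; lra). unfold x; nra. }
  assert (Ih : forall n, betar (x n) * (sin (PI * x n) / (PI * x n)) = betar b * (sin (PI * b) / (PI * b))).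
  { induction n.
    - unfold x; cbn. rewrite Rmult_1_r. reflexivity.
    - rewrite <- IHn. replace (x (S n)) with (x n / 2) by (unfold x; cbn; field).
      rewrite betar_half by (specialize (Hx n); lra).
      replace (PI * x n) with (2 * (PI * x n / 2)) at 2 by field. rewrite sin_2a.
      replace (PI * (x n / 2)) with (PI * x n / 2) by field.
      field. specialize (Hx n); split; lra. }
  assert (Lx : is_lim_seq x 0).
  { replace (Finite 0) with (Rbar_mult b 0) by (cbn; f_equal; ring).
    apply is_lim_seq_scal_l. apply is_lim_seq_geom. rewrite Rabs_pos_eq; lra. }
  assert (L1 : is_lim_seq (fun n => betar (x n)) 1).
  { apply (is_lim_seq_le_le (fun n => / (1 + x n)) _ (fun n => / (1 - x n))).
    - intros n. apply betar_bounds. specialize (Hx n); lra.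
    - apply (is_lim_seq_continuous (fun y => / (1 + y)) x 0) in Lx.
      + replace (/ (1 + 0)) with 1 in Lx by field. exact Lx.
      + apply derivable_continuous_pt. apply ex_derive_Reals_0. auto_derive; lra.
    - apply (is_lim_seq_continuous (fun y => / (1 - y)) x 0) in Lx.
      + replace (/ (1 - 0)) with 1 in Lx by field. exact Lx.
      + apply derivable_continuous_pt. apply ex_derive_Reals_0. auto_derive; lra. }
  assert (L2 : is_lim_seq (fun n => sin (PI * x n) / (PI * x n)) 1).
  { apply (is_lim_comp_seq (fun y => sin y / y) (fun n => PI * x n) 0 1).
    - exact is_lim_sinc_0.
    - exists 0%nat. intros n _ E. injection E; intros E'. specialize (Hx n). nra.
    - replace (Finite 0) with (Rbar_mult PI 0) by (cbn; f_equal; ring).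
      apply is_lim_seq_scal_l, Lx. }
  assert (L := is_lim_seq_mult' _ _ _ _ L1 L2).
  apply (is_lim_seq_ext _ (fun _ => betar b * (sin (PI * b) / (PI * b))) _ Ih) in L.
  apply is_lim_seq_unique in L. rewrite Lim_seq_const in L. injection L; intros E.
  specialize (Hs b Hb).
  apply (Rmult_eq_reg_r (sin (PI * b) / (PI * b))).
  - rewrite E. field. lra.
  - apply Rgt_not_eq, Rdiv_lt_0_compat; nra.
Qed.

Lemma Gamma_reflection b : 0 < b < 1 -> Gamma (1 - b) * Gamma (1 + b) * sin (PI * b) = PI * b.
Proof.
  intros Hb. rewrite <- betar_Gamma, betar_eq by trivial. field.
  apply Rgt_not_eq, sin_gt_0; generalize PI_RGT_0; nra.
Qed.

Lemma Gamma_half : Gamma (1 / 2) = sqrt PI.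
Proof.
  assert (H := Gamma_reflection (1 / 2) ltac:(lra)).
  replace (1 - 1 / 2) with (1 / 2) in H by field. replace (1 + 1 / 2) with (1 / 2 + 1) in H by ring.
  rewrite Gamma_succ in H by lra.
  replace (PI * (1 / 2)) with (PI / 2) in H by field. rewrite sin_PI2 in H.
  symmetry. rewrite <- (sqrt_square (Gamma (1 / 2))) by (apply Gamma_ge0; lra). f_equal. lra.
Qed.

Lemma frac_lap_const_eq a : 0 < a < 2 ->
  frac_lap_const a = Gamma (1 + a) * sin (a * (PI / 2)) / PI.
Proof.
  intros Ha. unfold frac_lap_const. assert (HPI := PI_RGT_0).
  assert (R1 := Gamma_reflection (a / 2) ltac:(lra)).
  assert (D := Gamma_duplication a ltac:(lra)). rewrite Gamma_half in D.
  replace ((a + 1) / 2) with (1 / 2 + a / 2) in D by field.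
  rewrite (Rplus_comm 1 (a / 2)), Gamma_succ in R1 by lra.
  rewrite (Rplus_comm 1 a), Gamma_succ by lra.
  replace (PI * (a / 2)) with (a * (PI / 2)) in R1 by field.
  assert (Hs : 0 < sqrt PI) by (apply sqrt_lt_R0; lra).
  assert (Hq : 0 < Rpower 2 a) by apply Rpower_pos.
  replace (Rpower 2 (a - 1)) with (Rpower 2 a / 2).
  2:{ unfold Rminus. rewrite Rpower_plus, Rpower_Ropp, Rpower_1 by lra. reflexivity. }
  assert (NG : Gamma (1 - a / 2) <> 0).
  { intros E. rewrite E in R1. nra. }
  set (x := Gamma (1 - a / 2)) in *. set (y := Gamma (a / 2)) in *. set (z := Gamma (1 / 2 + a / 2)) in *.
  assert (R2 : x * y * sin (a * (PI / 2)) = PI) by nra.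
  assert (NY : y <> 0) by (intros E; rewrite E in R2; nra).
  apply (Rmult_eq_reg_l y); [|exact NY].
  transitivity (a * (Rpower 2 a * (y * z)) / (2 * sqrt PI * x)); [field; split; lra|].
  rewrite D. transitivity (a * Gamma a / x); [field; split; lra|].
  replace (y * (a * Gamma a * sin (a * (PI / 2)) / PI)) with (a * Gamma a * (x * y * sin (a * (PI / 2))) / (x * PI)) by (field; split; lra).
  rewrite R2. field; split; lra.
Qed.

(** * Multiset coefficients and a Pascal recursion *)

Definition csum (f : nat -> C) (n : nat) : C := sum_n (G := C_AbelianGroup) f n.

Lemma csum_O f : csum f 0 = f 0%nat.
Proof. exact (sum_O (G:=C_AbelianGroup) f). Qed.

Lemma csum_S f n : csum f (S n) = (csum f n + f (S n))%C.
Proof. exact (sum_Sn (G:=C_AbelianGroup) f n). Qed.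

Lemma csum_ext f g n : (forall m, (m <= n)%nat -> f m = g m) -> csum f n = csum g n.
Proof. apply sum_n_ext_loc. Qed.

Lemma csum_plus f g n : csum (fun m => f m + g m)%C n = (csum f n + csum g n)%C.
Proof. apply (sum_n_plus (G:=C_AbelianGroup)). Qed.

Lemma csum_mult c f n : csum (fun m => c * f m)%C n = (c * csum f n)%C.
Proof. apply (sum_n_mult_l (K:=C_Ring)). Qed.

Lemma csum_shift f n : csum f (S n) = (f 0%nat + csum (fun m => f (S m)) n)%C.
Proof.
  induction n.
  - rewrite csum_S, !csum_O. reflexivity.
  - rewrite csum_S, IHn, csum_S. ring.
Qed.

(** The coefficient of [t^m] in [(1-t)^(-a)], that is, rising factorial over
    factorial. *)
Fixpoint mchoose (a : R) (m : nat) : R :=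
  match m with O => 1 | S p => mchoose a p * (a + INR p) / INR (S p) end.

Lemma mchoose_S a m : INR (S m) * mchoose a (S m) = (a + INR m) * mchoose a m.
Proof. cbn [mchoose]. field. apply not_0_INR; lia. Qed.

Lemma mchoose_up a m : a * mchoose (a + 1) m = (a + INR m) * mchoose a m.
Proof.
  induction m; [cbn; ring|].
  apply (Rmult_eq_reg_l (INR (S m))); [|apply not_0_INR; lia].
  replace (INR (S m) * (a * mchoose (a + 1) (S m))) with (a * (INR (S m) * mchoose (a + 1) (S m))) by ring.
  rewrite mchoose_S.
  replace (INR (S m) * ((a + INR (S m)) * mchoose a (S m))) with ((a + INR (S m)) * (INR (S m) * mchoose a (S m))) by ring.
  rewrite mchoose_S, <- IHm. rewrite S_INR. ring.
Qed.

(** The coefficient of [t^n] in [(1 - q t)^(-a) (1-t)^(-c)]. *)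
Definition conv (a c : R) (q : C) (n : nat) : C :=
  csum (fun m => RtoC (mchoose a m * mchoose c (n - m)) * Cpow q m)%C n.

(** The differential equation in [t] of the generating function, read
    coefficientwise. *)
Lemma conv_succ a c q n :
  (INR (S n) * conv a c q (S n) =
   (a + c + INR n)%R * conv a c q n - (1 - q) * a * conv (a + 1) c q n)%C.
Proof.
  unfold conv.
  transitivity (csum (fun m => RtoC (INR m * mchoose a m * mchoose c (S n - m)) * Cpow q m)%C (S n) +
    csum (fun m => RtoC (INR (S n - m) * mchoose a m * mchoose c (S n - m)) * Cpow q m)%C (S n))%C.
  { rewrite <- csum_plus, <- csum_mult. apply csum_ext. intros m Hm.
    rewrite minus_INR by lia. rewrite !RtoC_mult, RtoC_minus. ring. }
  rewrite (csum_shift (fun m => RtoC (INR m * mchoose a m * mchoose c (S n - m)) * Cpow q m)%C).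
  rewrite (csum_S (fun m => RtoC (INR (S n - m) * mchoose a m * mchoose c (S n - m)) * Cpow q m)%C).
  rewrite Nat.sub_diag. change (INR 0) with 0. rewrite !Rmult_0_l, !Cmult_0_l, Cplus_0_l, Cplus_0_r.
  transitivity (csum (fun m => (a + c + INR n)%R * (RtoC (mchoose a m * mchoose c (n - m)) * Cpow q m)
     + (- (1 - q) * a) * (RtoC (mchoose (a + 1) m * mchoose c (n - m)) * Cpow q m))%C n).
  - rewrite <- csum_plus. apply csum_ext. intros m Hm.
    replace (S n - S m)%nat with (n - m)%nat by lia.
    replace (S n - m)%nat with (S (n - m)) by lia.
    rewrite mchoose_S.
    replace (INR (S (n - m)) * mchoose a m * mchoose c (S (n - m))) with (mchoose a m * (INR (S (n - m)) * mchoose c (S (n - m)))) by ring.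
    rewrite mchoose_S, <- mchoose_up, minus_INR by lia. rewrite Cpow_S.
    transitivity ((RtoC (mchoose a m * (c + (INR n - INR m)) * mchoose c (n - m)) + q * RtoC (a * mchoose (a + 1) m * mchoose c (n - m))) * Cpow q m)%C.
    { rewrite !RtoC_mult. ring. }
    replace (mchoose a m * (c + (INR n - INR m)) * mchoose c (n - m)) with ((a + c + INR n) * (mchoose a m * mchoose c (n - m)) - (a + INR m) * mchoose a m * mchoose c (n - m)) by ring.
    rewrite <- mchoose_up. rewrite RtoC_minus, !RtoC_mult. ring.
  - rewrite csum_plus, !csum_mult. ring.
Qed.

Fixpoint pascal (a : nat -> C) (k j : nat) : C :=
  match k with
  | O => a j
  | S p => (pascal a p j - 2 * pascal a p (S j))%C
  end.

(** Dividing by [mchoose j k] turns [conv_succ] into the recursion of [pascal]; the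
    sum of the two parameters of [conv] grows by one with [j] and the second
    parameter does not move. *)
Lemma pascal_solution (a : nat -> C) (a0 : R) (iw : C) (k j : nat) :
  (forall j, (2 <= j)%nat -> (INR j * a (S j) = (INR j + a0)%R * iw * a j)%C) ->
  (2 <= j)%nat ->
  (mchoose (INR j) k * pascal a k j = a j * conv (INR j + a0) (- a0) (1 - 2 * iw) k)%C.
Proof.
  intros Ha. revert j. induction k; intros j Hj.
  - unfold conv. rewrite csum_O. cbn. rewrite !Rmult_1_r. ring.
  - assert (Hj0 : 0 < INR j) by (apply lt_0_INR; lia).
    assert (Hk0 : 0 <= INR k) by apply pos_INR.
    assert (Cj : RtoC (INR j) <> 0%C) by (apply RtoC_neq0; lra).
    assert (Ck : RtoC (INR (S k)) <> 0%C) by (apply RtoC_neq0, not_0_INR; lia).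
    assert (I1 := IHk j Hj). assert (I2 := IHk (S j) ltac:(lia)).
    rewrite S_INR in I2.
    replace (INR j + 1 + a0) with (INR j + a0 + 1) in I2 by ring.
    assert (R1 := mchoose_S (INR j) k). assert (R2 := mchoose_up (INR j) k).
    apply (f_equal RtoC) in R1, R2. rewrite !RtoC_mult in R1, R2.
    assert (C1 := conv_succ (INR j + a0) (- a0) (1 - 2 * iw) k).
    replace (INR j + a0 + - a0 + INR k) with (INR j + INR k) in C1 by ring.
    set (g1 := conv (INR j + a0) (- a0) (1 - 2 * iw) k) in *.
    set (g2 := conv (INR j + a0 + 1) (- a0) (1 - 2 * iw) k) in *.
    set (g3 := conv (INR j + a0) (- a0) (1 - 2 * iw) (S k)) in *.
    cbn [pascal]. set (p1 := pascal a k j) in *. set (p2 := pascal a k (S j)) in *.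
    assert (A := Ha j Hj).
    transitivity ((INR (S k) * mchoose (INR j) (S k)) * (p1 - 2 * p2) / INR (S k))%C; [field; trivial|].
    rewrite R1.
    transitivity (a j * (INR (S k) * g3) / INR (S k))%C; [|field; trivial].
    rewrite C1. f_equal.
    transitivity ((INR j + INR k)%R * (mchoose (INR j) k * p1) - 2 * ((INR j + INR k)%R * mchoose (INR j) k) * p2)%C; [ring|].
    rewrite I1, <- R2.
    transitivity ((INR j + INR k)%R * (a j * g1) - 2 * INR j * (mchoose (INR j + 1) k * p2))%C; [ring|].
    rewrite I2.
    transitivity ((INR j + INR k)%R * (a j * g1) - 2 * (INR j * a (S j)) * g2)%C; [ring|].
    rewrite A. ring.
Qed.

Lemma mchoose_2 k : mchoose 2 k = INR (S k).
Proof.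
  induction k; [cbn; ring|]. cbn [mchoose]. rewrite IHk. rewrite !S_INR. field. generalize (pos_INR k); lra.
Qed.

(** * The operator on Higgins functions for non-integer order *)

Definition wx (x : R) : C := (1 + Ci * x)%C.

Lemma wx_neq0 x : wx x <> 0%C.
Proof. intros E. apply (f_equal fst) in E. cbn in E. lra. Qed.

Lemma is_cderive_wx x : is_cderive wx x Ci.
Proof.
  eapply is_cderive_val.
  - apply is_cderive_plus; [apply is_cderive_const|]. apply is_cderive_scal.
    apply is_cderive_RtoC, (is_derive_id (K:=R_AbsRing)).
  - change one with 1. ring.
Qed.

(** The family closed under the recursion; the Higgins functions are the column [j =
    0] and their derivatives the column [j = 2]. *)
Definition hig (k j : nat) (x : R) : C := (Cpow (1 - 2 * / wx x) k * Cpow (/ wx x) j)%C.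

Lemma hig_pascal k j x : hig (S k) j x = (hig k j x - 2 * hig k (S j) x)%C.
Proof. unfold hig. rewrite !Cpow_S. ring. Qed.

Lemma Cpow_Z_of_nat z k : Cpow_Z z (Z.of_nat k) = Cpow z k.
Proof. destruct k; cbn [Z.of_nat Cpow_Z]; [reflexivity|]. rewrite SuccNat2Pos.id_succ. reflexivity. Qed.

Lemma higgins_hig k x : higgins (Z.of_nat k) x = hig k 0 x.
Proof.
  unfold higgins, hig. rewrite Cpow_Z_of_nat.
  replace ((Ci * x - 1) / (Ci * x + 1))%C with (1 - 2 * / wx x)%C; [cbn; ring|].
  assert (H := wx_neq0 x). unfold wx in *. field.
  intros E; apply H. rewrite <- E. ring.
Qed.

Lemma is_cderive_hig k x : is_cderive (hig (S k) 0) x (2 * Ci * INR (S k) * hig k 2 x)%C.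
Proof.
  assert (H := wx_neq0 x).
  apply (is_cderive_ext (fun t => Cpow (1 - 2 * / wx t) (S k))%C); [intros; unfold hig; cbn [Cpow]; ring|].
  unfold hig. eapply is_cderive_val.
  - apply (is_cderive_Cpow (fun t => 1 - 2 * / wx t)%C). apply is_cderive_minus; [apply is_cderive_const|].
    apply is_cderive_scal, is_cderive_inv; [exact H|apply is_cderive_wx].
  - cbn [pred]. rewrite !(Cpow_S (/ wx x)). cbn [Cpow]. field. exact H.
Qed.

(** The integrand [(1 + i (x - sg z))^(-j)] is [(sg i)^j (z + zeta)^(-j)] when [sg^2
    = 1]. *)
Definition zeta (sg x : R) : C := (sg * Ci * wx x)%C.

Lemma slit_Im (z : C) : Im z <> 0 -> slit z.
Proof.
  intros Hq. set (p := Re z). set (q := Im z) in *.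
  assert (Hq' : 0 < Rabs q) by (apply Rabs_pos_lt; trivial).
  assert (Hp := Rabs_pos (1 - p)).
  set (c := Rabs (1 - p) / Rabs q + 1).
  assert (Hc : 0 < c).
  { unfold c. assert (0 <= Rabs (1 - p) / Rabs q) by (apply Rdiv_le_0_compat; lra). lra. }
  exists (/ c). split; [apply Rinv_0_lt_compat; trivial|].
  intros t Ht.
  assert (H1 : Rabs (t + p) <= Cmod (t + z)).
  { eapply Rle_trans; [|apply re_le_Cmod]. right. f_equal. }
  assert (H2 : Rabs q <= Cmod (t + z)).
  { eapply Rle_trans; [|apply Rmax_Cmod]. eapply Rle_trans; [|apply Rmax_r]. right. f_equal. cbn. unfold q, Im. ring. }
  assert (H3 : 1 + t <= Rabs (1 - p) + Rabs (t + p)).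
  { eapply Rle_trans; [|apply Rabs_triang]. eapply Rle_trans; [|apply Rle_abs]. lra. }
  assert (H4 : Rabs (1 - p) <= Rabs (1 - p) / Rabs q * Cmod (t + z)).
  { replace (Rabs (1 - p)) with (Rabs (1 - p) / Rabs q * Rabs q) at 1 by (field; lra).
    apply Rmult_le_compat_l; [apply Rdiv_le_0_compat; lra|exact H2]. }
  apply (Rmult_le_reg_l c); [trivial|]. rewrite <- Rmult_assoc, Rinv_r by lra. unfold c. lra.
Qed.

Lemma slit_zeta sg x : sg <> 0 -> slit (zeta sg x).
Proof. intros H. apply slit_Im. unfold zeta, wx. cbn. intros E; apply H. lra. Qed.

(** The integral of [z^(-b) (1 + i (x - sg z))^(-j)] over the half-line; the sign
    [sg] selects the left (1) or right (-1) derivative. *)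
Definition rayint (sg b x : R) (j : nat) : C := (Cpow (sg * Ci) j * stieltjes b j (zeta sg x))%C.

Lemma sg_sqr sg : sg = 1 \/ sg = -1 -> sg * sg = 1.
Proof. intros [-> | ->]; ring. Qed.

Lemma Csg_sqr sg : sg = 1 \/ sg = -1 -> (sg * sg)%C = 1%C.
Proof. intros H; rewrite <- RtoC_mult, (sg_sqr sg H); trivial. Qed.

Lemma Ci_sqr : (Ci * Ci = - (1))%C.
Proof. unfold Ci; C_parts; ring. Qed.

Lemma rayint_succ sg b x j : sg = 1 \/ sg = -1 -> 0 < b < 1 -> (2 <= j)%nat ->
  (INR j * rayint sg b x (S j) = (INR j + (b - 1))%R * / wx x * rayint sg b x j)%C.
Proof.
  intros Hs Hb Hj. unfold rayint. rewrite Cpow_S. assert (H := wx_neq0 x).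
  assert (Sz : slit (zeta sg x)) by (apply slit_zeta; destruct Hs; lra).
  assert (E := stieltjes_succ b j _ Hb Hj Sz).
  transitivity (/ wx x * Cpow (sg * Ci) j * (INR j * zeta sg x * stieltjes b (S j) (zeta sg x)))%C.
  - unfold zeta. field. exact H.
  - rewrite E. replace (INR j - 1 + b) with (INR j + (b - 1)) by ring. ring.
Qed.

Lemma is_cderive_rayint sg b x j : sg = 1 \/ sg = -1 -> 0 < b < 1 -> (2 <= j)%nat ->
  is_cderive (fun x => rayint sg b x j) x (- Ci * INR j * rayint sg b x (S j))%C.
Proof.
  intros Hs Hb Hj. unfold rayint. eapply is_cderive_val.
  - apply is_cderive_scal. apply is_cderive_stieltjes; trivial.
    + intros t. apply slit_zeta; destruct Hs; lra.
    + apply is_cderive_scal, is_cderive_wx.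
  - rewrite Cpow_S. ring.
Qed.

Lemma cint_hig_base sg b x j : sg = 1 \/ sg = -1 -> 0 < b < 1 -> (2 <= j)%nat ->
  is_cint (fun z => hig 0 j (x - sg * z)%R / Rpower z b)%C (rayint sg b x j).
Proof.
  intros Hs Hb Hj. assert (Sz : slit (zeta sg x)) by (apply slit_zeta; destruct Hs; lra).
  apply (cint_ext (fun z => Cpow (sg * Ci) j * kern b j (zeta sg x) z)%C).
  2:{ apply cint_cmult, stieltjes_correct; trivial. }
  intros t Ht. unfold hig, kern.
  assert (NZ := slit_neq0 _ t Sz (Rlt_le _ _ Ht)).
  assert (E : (/ wx (x - sg * t) = sg * Ci * / (t + zeta sg x))%C).
  { assert (H := wx_neq0 (x - sg * t)).
    assert (E : (wx (x - sg * t) = - (sg * Ci) * (t + zeta sg x))%C).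
    { unfold zeta, wx. rewrite RtoC_minus, RtoC_mult.
      transitivity (1 + Ci * x - sg * Ci * t - ((sg * sg) * (Ci * Ci) + 1) * (1 + Ci * x))%C; [rewrite Csg_sqr, Ci_sqr by trivial; ring|ring]. }
    transitivity (- ((sg * sg) * (Ci * Ci)) * / wx (x - sg * t))%C; [rewrite Csg_sqr, Ci_sqr by trivial; ring|].
    rewrite E. field. split; trivial. split; [apply Ci_nz|]. apply RtoC_neq0; destruct Hs; lra. }
  rewrite E, (Cpow_mult_l (sg * Ci)). cbn [Cpow]. unfold Cdiv. ring.
Qed.

Lemma cint_hig sg b x k j : sg = 1 \/ sg = -1 -> 0 < b < 1 -> (2 <= j)%nat ->
  is_cint (fun z => hig k j (x - sg * z)%R / Rpower z b)%C (pascal (rayint sg b x) k j).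
Proof.
  intros Hs Hb. revert j. induction k; intros j Hj.
  - apply cint_hig_base; trivial.
  - cbn [pascal].
    apply (cint_ext (fun z => hig k j (x - sg * z)%R / Rpower z b - 2 * (hig k (S j) (x - sg * z)%R / Rpower z b))%C).
    { intros t Ht. rewrite hig_pascal. unfold Cdiv. ring. }
    apply cint_minus; [apply IHk; lia|]. apply cint_cmult, IHk; lia.
Qed.

Lemma is_cderive_pascal sg b x k j : sg = 1 \/ sg = -1 -> 0 < b < 1 -> (2 <= j)%nat ->
  is_cderive (fun x => pascal (rayint sg b x) k j) x
    (pascal (fun j => - Ci * INR j * rayint sg b x (S j))%C k j).
Proof.
  intros Hs Hb. revert j. induction k; intros j Hj; cbn [pascal].
  - apply is_cderive_rayint; trivial.
  - apply is_cderive_minus; [apply IHk; lia|]. apply is_cderive_scal, IHk; lia.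
Qed.

Definition caputo_val (sg b : R) (k : nat) (x : R) : C :=
  (/ Gamma (1 - b) * (2 * Ci * INR (S k) * pascal (rayint sg b x) k 2))%C.

Lemma caputo_cint sg b k x : sg = 1 \/ sg = -1 -> 0 < b < 1 ->
  is_cint (fun z => (2 * Ci * INR (S k) * hig k 2 (x - sg * z)) / Rpower z b)%C
    (2 * Ci * INR (S k) * pascal (rayint sg b x) k 2)%C.
Proof.
  intros Hs Hb. apply (cint_ext (fun z => (2 * Ci * INR (S k)) * (hig k 2 (x - sg * z) / Rpower z b))%C).
  { intros; unfold Cdiv; ring. }
  apply cint_cmult, cint_hig; auto.
Qed.

Lemma is_cderive_higgins k x :
  is_cderive (higgins (Z.of_nat (S k))) x (2 * Ci * INR (S k) * hig k 2 x)%C.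
Proof.
  apply (is_cderive_ext (hig (S k) 0)); [intros; symmetry; apply higgins_hig|]. apply is_cderive_hig.
Qed.

Lemma caputo_left_higgins b k x : 0 < b < 1 ->
  is_caputo_left b (higgins (Z.of_nat (S k))) x (caputo_val 1 b k x).
Proof.
  intros Hb. exists (fun x => 2 * Ci * INR (S k) * hig k 2 x)%C.
  exists (2 * Ci * INR (S k) * pascal (rayint 1 b x) k 2)%C. split; [|split; [|reflexivity]].
  - intros y. apply is_cderive_higgins.
  - eapply cint_ext; [|apply (caputo_cint 1); auto]. intros t Ht. cbv beta. rewrite Rmult_1_l. reflexivity.
Qed.

Lemma caputo_right_higgins b k x : 0 < b < 1 ->
  is_caputo_right b (higgins (Z.of_nat (S k))) x (caputo_val (-1) b k x).
Proof.
  intros Hb. exists (fun x => 2 * Ci * INR (S k) * hig k 2 x)%C.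
  exists (2 * Ci * INR (S k) * pascal (rayint (-1) b x) k 2)%C. split; [|split; [|reflexivity]].
  - intros y. apply is_cderive_higgins.
  - eapply cint_ext; [|apply (caputo_cint (-1)); auto]. intros t Ht. cbv beta.
    replace (x - -1 * t) with (x + t) by ring. reflexivity.
Qed.

Lemma is_cderive_caputo_val sg b k x : sg = 1 \/ sg = -1 -> 0 < b < 1 ->
  is_cderive (caputo_val sg b k) x
   (/ Gamma (1 - b) * (2 * Ci * INR (S k) * pascal (fun j => - Ci * INR j * rayint sg b x (S j)) k 2))%C.
Proof.
  intros Hs Hb. unfold caputo_val. do 2 apply is_cderive_scal. apply is_cderive_pascal; auto.
Qed.

Lemma wx_cot s : 0 < sin s -> (/ wx (cot s) = - Ci * sin s * cis s)%C.
Proof.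
  intros Hs. assert (H := wx_neq0 (cot s)).
  assert (E : (wx (cot s) * (- Ci * sin s * cis s))%C = 1%C).
  { assert (S2 := sin2_cos2 s). unfold Rsqr in S2. unfold wx, cot, cis, Ci.
    C_parts.
    - transitivity (sin s * sin s + cos s * cos s); [field; lra|lra].
    - field; lra. }
  rewrite <- (Cmult_1_r (/ wx (cot s))). rewrite <- E. field. exact H.
Qed.

Lemma q_cot s : 0 < sin s -> (1 - 2 * / wx (cot s) = cis (2 * s))%C.
Proof.
  intros Hs. rewrite wx_cot by trivial. assert (S2 := sin2_cos2 s). unfold Rsqr in S2.
  unfold cis, Ci. rewrite sin_2a, cos_2a. C_parts; nra.
Qed.

Lemma Rpower_inv_opp r a : 0 < r -> Rpower (/ r) (- a) = Rpower r a.
Proof. intros Hr. unfold Rpower. rewrite ln_Rinv by trivial. f_equal; ring. Qed.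

Lemma rayint2_left b s : 0 < b < 1 -> 0 < s < PI ->
  rayint 1 b (cot s) 2 = (- betar b * Rpower (sin s) (1 + b) * cis (- (1 + b) * (PI - s)))%C.
Proof.
  intros Hb Hs. assert (Hp : 0 < sin s) by (apply sin_gt_0; lra).
  unfold rayint.
  assert (E : zeta 1 (cot s) = (/ sin s * cis (PI - s))%C).
  { rewrite <- RtoC_inv by lra. unfold zeta, wx, cot, cis, Ci. rewrite sin_PI_x, Rtrigo_facts.cos_pi_minus.
    C_parts; field; lra. }
  rewrite E, <- RtoC_inv, stieltjes2_polar, Rpower_inv_opp, stieltjes2_1 by (try apply Rinv_0_lt_compat; lra).
  cbn [Cpow]. transitivity ((Ci * Ci) * (betar b * Rpower (sin s) (1 + b) * cis (- (1 + b) * (PI - s))))%C; [ring|].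
  rewrite Ci_sqr. ring.
Qed.

Lemma rayint2_right b s : 0 < b < 1 -> 0 < s < PI ->
  rayint (-1) b (cot s) 2 = (- betar b * Rpower (sin s) (1 + b) * cis ((1 + b) * s))%C.
Proof.
  intros Hb Hs. assert (Hp : 0 < sin s) by (apply sin_gt_0; lra).
  unfold rayint.
  assert (E : zeta (-1) (cot s) = (/ sin s * cis (- s))%C).
  { rewrite <- RtoC_inv by lra. unfold zeta, wx, cot, cis, Ci. rewrite sin_neg, cos_neg.
    C_parts; field; lra. }
  rewrite E, <- RtoC_inv, stieltjes2_polar, Rpower_inv_opp, stieltjes2_1 by (try apply Rinv_0_lt_compat; lra).
  replace (- (1 + b) * - s) with ((1 + b) * s) by ring.
  cbn [Cpow]. transitivity ((Ci * Ci) * (betar b * Rpower (sin s) (1 + b) * cis ((1 + b) * s)))%C; [ring|].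
  rewrite Ci_sqr. ring.
Qed.

Lemma pascal_rayint sg b x k : sg = 1 \/ sg = -1 -> 0 < b < 1 ->
  (INR (S k) * pascal (rayint sg b x) k 2 = rayint sg b x 2 * conv (1 + b) (1 - b) (1 - 2 * / wx x) k)%C.
Proof.
  intros Hs Hb.
  assert (P := pascal_solution (rayint sg b x) (b - 1) (/ wx x) k 2 (fun j Hj => rayint_succ sg b x j Hs Hb Hj) (le_n 2)).
  replace (INR 2) with 2 in P by (cbn; ring). rewrite mchoose_2 in P.
  replace (2 + (b - 1)) with (1 + b) in P by ring. replace (- (b - 1)) with (1 - b) in P by ring. exact P.
Qed.

Lemma pascal_drayint sg b x k : sg = 1 \/ sg = -1 -> 0 < b < 1 ->
  (INR (S k) * pascal (fun j => - Ci * INR j * rayint sg b x (S j)) k 2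
   = (- Ci * (1 + b)%R * / wx x * rayint sg b x 2) * conv (2 + b) (- b) (1 - 2 * / wx x) k)%C.
Proof.
  intros Hs Hb.
  assert (P := pascal_solution (fun j => - Ci * INR j * rayint sg b x (S j))%C b (/ wx x) k 2).
  cbv beta in P. replace (INR 2) with 2 in P by (cbn; ring). rewrite mchoose_2 in P.
  rewrite P.
  - f_equal. assert (E := rayint_succ sg b x 2 Hs Hb (le_n 2)). replace (INR 2) with 2 in E by (cbn; ring).
    rewrite <- Cmult_assoc, E. replace (2 + (b - 1)) with (1 + b) by ring. ring.
  - intros j Hj. assert (E := rayint_succ sg b x (S j) Hs Hb ltac:(lia)).
    transitivity (- Ci * INR j * (INR (S j) * rayint sg b x (S (S j))))%C; [ring|]. rewrite E.
    rewrite S_INR. replace (INR j + 1 + (b - 1)) with (INR j + b) by ring. ring.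
  - lia.
Qed.

(** The two coefficients of the Riesz-Feller operator combine the phases of the two
    one-sided derivatives into a single phase. *)
Lemma skew_trig a g : (sin (a - g) * cis (- (2 * a)) + sin (a + g) = sin (2 * a) * cis g * cis (- a))%C.
Proof.
  assert (E : (sin (a - g) * cis (- a) + sin (a + g) * cis a = sin (2 * a) * cis g)%C).
  { unfold cis. rewrite sin_2a, sin_plus, sin_minus, sin_neg, cos_neg.
    C_parts; ring. }
  rewrite <- E. replace (- (2 * a)) with (- a + - a) by ring. rewrite cis_add.
  transitivity (sin (a - g) * (cis (- a) * cis (- a)) + sin (a + g) * (cis a * cis (- a)))%C; [|ring].
  rewrite <- (cis_add a (- a)), Rplus_opp_r, cis_0. ring.
Qed.

(** The value of the operator before the expansion into a series. *)
Definition rf_val (alpha gamma : R) (k : nat) (s : R) : C :=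
  (- (2) * Ci * Gamma (1 + alpha) * cis (gamma * (PI / 2)) * cis (- (alpha * (PI / 2)))
   * Rpower (sin s) (1 + alpha) * cis ((1 + alpha) * s) * conv (1 + alpha) (1 - alpha) (cis (2 * s)) k)%C.

(** The two ranges of the order differ only in the constant [c]; the condition on
    [c] is met by the reflection formula in both. *)
Lemma riesz_feller_combine alpha gamma k s (c : R) (a b : C) :
  Gamma (- alpha) * c * sin (2 * (alpha * (PI / 2))) = - PI ->
  a = (c * (2 * Ci * Rpower (sin s) (1 + alpha) * cis ((1 + alpha) * s) * cis (- (2 * (alpha * (PI / 2))))
       * conv (1 + alpha) (1 - alpha) (cis (2 * s)) k))%C ->
  b = (c * (2 * Ci * Rpower (sin s) (1 + alpha) * cis ((1 + alpha) * s)
       * conv (1 + alpha) (1 - alpha) (cis (2 * s)) k))%C ->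
  rf_val alpha gamma k s = (Gamma (- alpha) * (rf_c1 gamma alpha * a + rf_c2 gamma alpha * b))%C.
Proof.
  intros Hc -> ->. assert (HPI := PI_RGT_0).
  assert (T := skew_trig (alpha * (PI / 2)) (gamma * (PI / 2))).
  rewrite <- Rmult_minus_distr_r, <- Rmult_plus_distr_r in T. unfold rf_val, rf_c1, rf_c2.
  set (cv := conv _ _ _ _). set (E := cis ((1 + alpha) * s)). set (sp := Rpower _ _).
  set (G := cis (gamma * (PI / 2))) in *. set (ca := cis (- (alpha * (PI / 2)))) in *.
  set (s2 := sin (2 * (alpha * (PI / 2)))) in *.
  transitivity (Gamma (- alpha) * (Gamma (1 + alpha) / PI)%R * c * (2 * Ci * sp * E * cv)
    * (sin ((alpha - gamma) * (PI / 2)) * cis (- (2 * (alpha * (PI / 2)))) + sin ((alpha + gamma) * (PI / 2))))%C.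
  2:{ rewrite !RtoC_mult. ring. }
  rewrite T.
  assert (EE : Gamma (- alpha) * (Gamma (1 + alpha) / PI) * c * s2 = - Gamma (1 + alpha)).
  { transitivity (Gamma (- alpha) * c * s2 * (Gamma (1 + alpha) / PI)); [ring|]. rewrite Hc. field. lra. }
  apply (f_equal RtoC) in EE. rewrite !RtoC_mult, RtoC_opp in EE.
  transitivity ((- Gamma (1 + alpha)) * (2 * Ci * G * ca * sp * E * cv))%C; [ring|].
  rewrite <- EE. ring.
Qed.

Lemma riesz_feller_higgins alpha gamma k s :
  (0 < alpha < 1 \/ 1 < alpha < 2) -> 0 < s < PI ->
  is_riesz_feller alpha gamma (higgins (Z.of_nat (S k))) (cot s) (rf_val alpha gamma k s).
Proof.
  intros Ha Hs. assert (Hp : 0 < sin s) by (apply sin_gt_0; lra). assert (HPI := PI_RGT_0).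
  destruct Ha as [Ha|Ha].
  (* The transforms are taken at points of arguments [PI - s] and [- s]; this is where
     the phase between the left and the right derivative comes from. *)
  - left. split; [exact Ha|]. exists (caputo_val 1 alpha k (cot s)), (caputo_val (-1) alpha k (cot s)).
    split; [apply caputo_left_higgins, Ha|]. split; [apply caputo_right_higgins, Ha|].
    assert (P1 := pascal_rayint 1 alpha (cot s) k (or_introl eq_refl) Ha).
    assert (P2 := pascal_rayint (-1) alpha (cot s) k (or_intror eq_refl) Ha).
    rewrite q_cot in P1, P2 by trivial. rewrite rayint2_left in P1 by trivial. rewrite rayint2_right in P2 by trivial.
    replace (- (1 + alpha) * (PI - s)) with ((1 + alpha) * s + (- (2 * (alpha * (PI / 2))) + - PI)) in P1 by field.
    rewrite !cis_add in P1.
    replace (cis (- PI)) with (RtoC (-1)) in P1 by (unfold cis; rewrite cos_neg, sin_neg, cos_PI, sin_PI, Ropp_0; reflexivity).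
    assert (Sp : 0 < sin (PI * alpha)) by (apply sin_gt_0; nra).
    assert (R1 := Gamma_reflection alpha Ha).
    assert (G1 := Gamma_succ (- alpha) ltac:(lra)). replace (- alpha + 1) with (1 - alpha) in G1 by ring.
    assert (NG : Gamma (- alpha) <> 0) by (intros E; rewrite G1, E in R1; nra).
    assert (NG1 : Gamma (1 - alpha) <> 0) by (rewrite G1; nra).
    rewrite (riesz_feller_combine alpha gamma k s (betar alpha / Gamma (1 - alpha))
      (caputo_val 1 alpha k (cot s)) (- caputo_val (-1) alpha k (cot s))%C); [ring| | |].
    + rewrite G1, betar_eq by trivial. replace (2 * (alpha * (PI / 2))) with (PI * alpha) by field.
      field. repeat split; lra.
    + unfold caputo_val. rewrite RtoC_div by trivial. unfold Cdiv.
      transitivity (/ Gamma (1 - alpha) * (2 * Ci) * (INR (S k) * pascal (rayint 1 alpha (cot s)) k 2))%C; [ring|].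
      rewrite P1. ring.
    + unfold caputo_val. rewrite RtoC_div by trivial. unfold Cdiv.
      transitivity (- / Gamma (1 - alpha) * (2 * Ci) * (INR (S k) * pascal (rayint (-1) alpha (cot s)) k 2))%C; [ring|].
      rewrite P2. ring.
  - right; left. split; [exact Ha|]. set (b := alpha - 1). assert (Hb : 0 < b < 1) by (unfold b; lra).
    do 2 eexists. split; [|split].
    + exists (caputo_val 1 b k). split; [intros y; apply caputo_left_higgins, Hb|].
      apply is_cderive_caputo_val; auto.
    + exists (caputo_val (-1) b k). split; [intros y; apply caputo_right_higgins, Hb|].
      apply is_cderive_caputo_val; auto.
    + assert (P1 := pascal_drayint 1 b (cot s) k (or_introl eq_refl) Hb).
      assert (P2 := pascal_drayint (-1) b (cot s) k (or_intror eq_refl) Hb).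
      rewrite q_cot in P1, P2 by trivial. rewrite rayint2_left, wx_cot in P1 by trivial. rewrite rayint2_right, wx_cot in P2 by trivial.
      assert (K2 := betar_eq b Hb). assert (Sp : 0 < sin (PI * b)) by (apply sin_gt_0; nra).
      assert (R1 := Gamma_reflection b Hb).
      assert (Es : sin (PI * b) = - sin (2 * (alpha * (PI / 2)))).
      { replace (PI * b) with (2 * (alpha * (PI / 2)) - PI) by (unfold b; field).
        rewrite sin_minus, cos_PI, sin_PI. ring. }
      replace (1 + b) with alpha in * by (unfold b; ring). replace (2 + b) with (1 + alpha) in * by (unfold b; ring).
      replace (- b) with (1 - alpha) in * by (unfold b; ring).
      replace (1 - b) with (2 - alpha) in * by (unfold b; ring).
      replace (- alpha * (PI - s)) with (alpha * s + - (2 * (alpha * (PI / 2)))) in P1 by field.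
      rewrite !cis_add in P1.
      assert (G1 := Gamma_succ (- alpha) ltac:(lra)). replace (- alpha + 1) with (1 - alpha) in G1 by ring.
      assert (G2 := Gamma_succ (1 - alpha) ltac:(lra)). replace (1 - alpha + 1) with (2 - alpha) in G2 by ring.
      assert (NG : Gamma (- alpha) <> 0) by (intros E; rewrite G2, G1, E in R1; nra).
      assert (NG2 : Gamma (2 - alpha) <> 0).
      { rewrite G2, G1. repeat apply Rmult_integral_contrapositive_currified; trivial; lra. }
      apply (riesz_feller_combine alpha gamma k s (alpha * betar b / Gamma (2 - alpha))).
      * rewrite G2, G1, K2, Es in *. replace (PI * b) with (PI * (alpha - 1)) by reflexivity.
        field. repeat split; lra.
      * rewrite (Rpower_plus 1 alpha), Rpower_1, Rmult_plus_distr_r, Rmult_1_l, (cis_add s) by trivial.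
        rewrite RtoC_div, !RtoC_mult by trivial. unfold Cdiv.
        transitivity (/ Gamma (2 - alpha) * (2 * Ci) * (INR (S k) * pascal (fun j => - Ci * INR j * rayint 1 b (cot s) (S j)) k 2))%C; [ring|].
        rewrite P1.
        transitivity (- (Ci * Ci) * (alpha * betar b * / Gamma (2 - alpha) * (2 * Ci * (sin s * Rpower (sin s) alpha) * (cis s * cis (alpha * s)) * cis (- (2 * (alpha * (PI / 2)))) * conv (1 + alpha) (1 - alpha) (cis (2 * s)) k)))%C; [ring|].
        rewrite Ci_sqr. ring.
      * rewrite (Rpower_plus 1 alpha), Rpower_1, Rmult_plus_distr_r, Rmult_1_l, (cis_add s) by trivial.
        rewrite RtoC_div, !RtoC_mult by trivial. unfold Cdiv.
        transitivity (/ Gamma (2 - alpha) * (2 * Ci) * (INR (S k) * pascal (fun j => - Ci * INR j * rayint (-1) b (cot s) (S j)) k 2))%C; [ring|].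
        rewrite P2.
        transitivity (- (Ci * Ci) * (alpha * betar b * / Gamma (2 - alpha) * (2 * Ci * (sin s * Rpower (sin s) alpha) * (cis s * cis (alpha * s)) * conv (1 + alpha) (1 - alpha) (cis (2 * s)) k)))%C; [ring|].
        rewrite Ci_sqr. ring.
Qed.

(** * A Fourier series with coefficients of order two *)

Lemma is_cseries_eps (a : nat -> C) (l : C) :
  is_series (V := C_NormedModule) a l <->
  forall eps, 0 < eps -> exists N, forall n, (N <= n)%nat -> Cmod (csum a n - l) < eps.
Proof.
  unfold is_series. rewrite (filterlim_locally_ball_norm (U := C_NormedModule)). split.
  - intros H eps He. destruct (H (mkposreal eps He)) as [N HN]. exists N. intros n Hn. exact (HN n Hn).
  - intros H eps. destruct (H eps (cond_pos eps)) as [N HN]. exists N. intros n Hn. exact (HN n Hn).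
Qed.

(** A telescoping majorant gives convergence together with an explicit bound for the
    tail. *)
Lemma csum_dominated (a : nat -> C) (g : nat -> R) (n0 : nat) (c : R) :
  (forall n, (n0 <= n)%nat -> Cmod (a n) <= g n - g (S n)) ->
  (forall n, (n0 <= n)%nat -> 0 <= g n) ->
  (forall n, (n0 <= n)%nat -> (1 <= n)%nat -> g n <= c / INR n) ->
  exists l, is_series (V := C_NormedModule) a l /\
    forall n, (n0 <= n)%nat -> Cmod (csum a n - l) <= g (S n).
Proof.
  intros Ha Hg0 Hg.
  assert (HC : forall n p, (n0 <= n)%nat -> Cmod (csum a (n + p) - csum a n) <= g (S n) - g (S (n + p))).
  { intros n p Hn. induction p.
    - rewrite Nat.add_0_r. replace (csum a n - csum a n)%C with (RtoC 0) by ring. rewrite Cmod_0. lra.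
    - rewrite Nat.add_succ_r, csum_S.
      replace (csum a (n + p) + a (S (n + p)) - csum a n)%C with ((csum a (n + p) - csum a n) + a (S (n + p)))%C by ring.
      eapply Rle_trans; [apply Cmod_triangle|]. specialize (Ha (S (n + p)) ltac:(lia)). lra. }
  assert (HC2 : forall n m, (n0 <= n)%nat -> (n <= m)%nat -> Cmod (csum a m - csum a n) <= g (S n)).
  { intros n m Hn Hm. replace m with (n + (m - n))%nat by lia.
    eapply Rle_trans; [apply HC, Hn|]. generalize (Hg0 (S (n + (m - n))) ltac:(lia)). lra. }
  assert (Hsmall : forall eps, 0 < eps -> exists N, (n0 <= N)%nat /\ forall n, (N <= n)%nat -> g (S n) < eps).
  { intros eps He. destruct (div_INR_small c eps He) as [N [_ HN]].
    exists (n0 + N)%nat. split; [lia|]. intros n Hn.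
    eapply Rle_lt_trans; [apply Hg|apply HN]; lia. }
  assert (EX : exists l : C, filterlim (csum a) eventually (locally (T:=C_CompleteNormedModule) l)).
  { apply (filterlim_locally_cauchy (U := C_CompleteNormedModule)). intros eps.
    destruct (Hsmall (eps / 2)) as [N [HN1 HN2]]; [generalize (cond_pos eps); lra|].
    exists (fun n => (N <= n)%nat). split; [exists N; trivial|].
    intros u v Hu Hv. apply (norm_compat1 (V:=C_CompleteNormedModule)).
    change (Cmod (csum a v - csum a u) < eps).
    replace (csum a v - csum a u)%C with ((csum a v - csum a N) + - (csum a u - csum a N))%C by ring.
    eapply Rle_lt_trans; [apply Cmod_triangle|]. rewrite Cmod_opp.
    generalize (HC2 N u HN1 Hu) (HC2 N v HN1 Hv) (HN2 N (le_n N)). lra. }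
  destruct EX as [l Hl]. exists l. split; [exact Hl|].
  assert (Hl2 := proj1 (is_cseries_eps a l) Hl). clear Hl; rename Hl2 into Hl.
  intros n Hn. apply le_epsilon. intros eps He.
  destruct (Hl eps He) as [N HN].
  specialize (HN (max n N) ltac:(lia)). specialize (HC2 n (max n N) Hn ltac:(lia)).
  replace (csum a n - l)%C with (- (csum a (max n N) - csum a n) + (csum a (max n N) - l))%C by ring.
  eapply Rle_trans; [apply Cmod_triangle|]. rewrite Cmod_opp. lra.
Qed.

(** The mean value inequality for the real and imaginary parts separately; hence the
    factor 2. *)
Lemma cderive_bound (h dh : R -> C) (a b D : R) : a <= b ->
  (forall t, a < t < b -> is_cderive h t (dh t)) ->
  (forall t, a <= t <= b -> continuous (U:=CR) h t) ->
  (forall t, a <= t <= b -> Cmod (dh t) <= D) ->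
  Cmod (h b - h a) <= 2 * D * (b - a).
Proof.
  intros Hab Hd Hc HD.
  assert (H1 : forall p : C -> R, (forall x y : C, p (x - y)%C = p x - p y) ->
     (forall t, a < t < b -> is_derive (fun t => p (h t)) t (p (dh t))) ->
     (forall t, a <= t <= b -> continuous (fun t => p (h t)) t) ->
     (forall x, Rabs (p x) <= Cmod x) -> Rabs (p (h b - h a)%C) <= D * (b - a)).
  { intros p Hp Dp Cp Bp.
    destruct (MVT_gen (fun t => p (h t)) a b (fun t => p (dh t))) as [c [Hc1 Hc2]].
    - intros x Hx. rewrite Rmin_left, Rmax_right in Hx by trivial. apply Dp, Hx.
    - intros x Hx. rewrite Rmin_left, Rmax_right in Hx by trivial.
      apply continuity_pt_filterlim. apply Cp, Hx.
    - rewrite Rmin_left, Rmax_right in Hc1 by trivial.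
      rewrite Hp, Hc2, Rabs_mult, (Rabs_pos_eq (b - a)) by lra.
      apply Rmult_le_compat_r; [lra|]. eapply Rle_trans; [apply Bp|apply HD, Hc1]. }
  assert (B1 : Rabs (Re (h b - h a)%C) <= D * (b - a)).
  { apply (H1 Re); [reflexivity| | |apply re_le_Cmod].
    - intros t Ht. apply is_cderive_comp, Hd, Ht.
    - intros t Ht. apply (continuous_comp (V := CR) h fst); [apply Hc, Ht|apply continuous_fst]. }
  assert (B2 : Rabs (Im (h b - h a)%C) <= D * (b - a)).
  { apply (H1 Im); [reflexivity| | |].
    - intros t Ht. apply is_cderive_comp, Hd, Ht.
    - intros t Ht. apply (continuous_comp (V := CR) h snd); [apply Hc, Ht|apply continuous_snd].
    - intros x. eapply Rle_trans; [|apply Rmax_Cmod]. apply Rmax_r. }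
  set (z := (h b - h a)%C) in *.
  replace z with (RtoC (Re z) + Ci * RtoC (Im z))%C.
  2:{ destruct z; C_parts; ring. }
  eapply Rle_trans; [apply Cmod_triangle|]. rewrite Cmod_mult, Cmod_Ci, !Cmod_R. lra.
Qed.

Definition fcoef (al : R) (l : Z) : R := / ((2 * IZR l - al) ^ 2 - 1).

Definition fterm (al s : R) (l : Z) : C := (cis ((2 * IZR l - al) * s) * fcoef al l)%C.

(** Partial sum over the integers from [-(n+1)] to [n], the ranges in which a sum
    over the integers splits. *)
Definition fpart (u : Z -> C) (n : nat) : C :=
  (csum (fun m => u (Z.of_nat m)) n + csum (fun m => u (- Z.of_nat (S m))%Z) n)%C.

Lemma fpart_S u n : fpart u (S n) = (fpart u n + u (Z.of_nat (S n)) + u (- Z.of_nat (S (S n)))%Z)%C.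
Proof. unfold fpart. rewrite !csum_S. ring. Qed.

Lemma fpart_ext u v n : (forall l, u l = v l) -> fpart u n = fpart v n.
Proof. intros H; unfold fpart; f_equal; apply csum_ext; intros; apply H. Qed.

Lemma fpart_cmult c u n : fpart (fun l => c * u l)%C n = (c * fpart u n)%C.
Proof. unfold fpart. rewrite !csum_mult. ring. Qed.

Lemma fpart_minus u v n : fpart (fun l => u l - v l)%C n = (fpart u n - fpart v n)%C.
Proof.
  induction n.
  - unfold fpart. rewrite !csum_O. ring.
  - rewrite !fpart_S, IHn. ring.
Qed.

Lemma is_cderive_csum (u du : R -> nat -> C) n s :
  (forall m, is_cderive (fun s => u s m) s (du s m)) ->
  is_cderive (fun s => csum (u s) n) s (csum (du s) n).
Proof.
  intros H. induction n.
  - apply (is_cderive_ext (fun s => u s 0%nat)); [intros; symmetry; apply csum_O|]. rewrite csum_O. apply H.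
  - apply (is_cderive_ext (fun s => csum (u s) n + u s (S n))%C); [intros; symmetry; apply csum_S|].
    rewrite csum_S. apply is_cderive_plus; auto.
Qed.

Lemma is_cderive_fpart (u du : R -> Z -> C) n s :
  (forall l, is_cderive (fun s => u s l) s (du s l)) ->
  is_cderive (fun s => fpart (u s) n) s (fpart (du s) n).
Proof.
  intros H. unfold fpart. apply is_cderive_plus.
  - apply (is_cderive_csum (fun s m => u s (Z.of_nat m)) (fun s m => du s (Z.of_nat m))). intros; apply H.
  - apply (is_cderive_csum (fun s m => u s (- Z.of_nat (S m))%Z) (fun s m => du s (- Z.of_nat (S m))%Z)). intros; apply H.
Qed.

Definition noninteger (al : R) : Prop := 0 < al < 1 \/ 1 < al < 2.

Lemma order_not_odd al (m : Z) : noninteger al -> IZR (2 * m + 1) <> al.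
Proof.
  intros Ha E.
  assert (H1 : (0 < 2 * m + 1)%Z) by (apply lt_IZR; destruct Ha; lra).
  assert (H2 : (2 * m + 1 < 2)%Z) by (apply lt_IZR; destruct Ha; lra).
  assert (m = 0)%Z by lia. subst m. cbn in E. destruct Ha; lra.
Qed.

Lemma freq_neq al l : noninteger al -> 2 * IZR l - al - 1 <> 0 /\ 2 * IZR l - al + 1 <> 0.
Proof.
  intros Ha. split; intros E.
  - apply (order_not_odd al (l - 1) Ha). rewrite plus_IZR, mult_IZR, minus_IZR. lra.
  - apply (order_not_odd al l Ha). rewrite plus_IZR, mult_IZR. lra.
Qed.

Lemma fcoef_eq al l : noninteger al ->
  fcoef al l = (/ (2 * IZR l - al - 1) - / (2 * IZR l - al + 1)) / 2.
Proof.
  intros Ha. destruct (freq_neq al l Ha). unfold fcoef. field. split; [|split]; trivial.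
  replace ((2 * IZR l - al) ^ 2 - 1) with ((2 * IZR l - al - 1) * (2 * IZR l - al + 1)) by ring.
  apply Rmult_integral_contrapositive_currified; trivial.
Qed.

(** The operator [sin d/ds - cos] shifts the frequency by one up and down, and the
    two denominators [m-1] and [m+1] of the coefficient separate; the terms for
    neighbouring [l] then cancel. *)
Lemma wronskian_term al s l : noninteger al ->
  (sin s * (Ci * (2 * IZR l - al)%R * fterm al s l) - cos s * fterm al s l
   = / 2 * (cis ((2 * IZR l - al + 1) * s) * / (2 * IZR l - al + 1)%R - cis ((2 * IZR l - al - 1) * s) * / (2 * IZR l - al - 1)%R))%C.
Proof.
  intros Ha. destruct (freq_neq al l Ha) as [N1 N2]. unfold fterm.
  rewrite fcoef_eq by trivial. set (m := 2 * IZR l - al) in *.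
  rewrite <- !RtoC_inv by trivial. replace (/ 2)%C with (RtoC (/ 2)) by (rewrite RtoC_inv; lra || reflexivity).
  rewrite !Rmult_plus_distr_r, Rmult_minus_distr_r, Rmult_1_l.
  unfold cis. rewrite cos_plus, sin_plus, cos_minus, sin_minus.
  unfold Ci. C_parts; field; split; trivial.
Qed.

Definition fdterm (al s : R) (l : Z) : C := (Ci * (2 * IZR l - al)%R * fterm al s l)%C.

Lemma is_cderive_fterm al s l : is_cderive (fun s => fterm al s l) s (fdterm al s l).
Proof.
  unfold fterm, fdterm. eapply is_cderive_val.
  - apply is_cderive_mult; [apply is_cderive_cis|apply is_cderive_const].
  - unfold fterm. ring.
Qed.

Lemma wronskian_sum al s n : noninteger al ->
  (sin s * fpart (fdterm al s) n - cos s * fpart (fterm al s) n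
   = / 2 * (cis ((2 * INR n - al + 1) * s) * / (2 * INR n - al + 1)%R
          - cis (- (2 * INR n + al + 3) * s) * / (- (2 * INR n + al + 3))%R))%C.
Proof.
  intros Ha. rewrite <- !fpart_cmult, <- fpart_minus.
  erewrite fpart_ext; [|intros l; exact (wronskian_term al s l Ha)]. cbv beta.
  induction n.
  - unfold fpart. rewrite !csum_O. cbn [Z.of_nat Z.opp Pos.of_succ_nat INR].
    replace (2 * 0 - al - 1) with (2 * -1 - al + 1) by ring.
    replace (2 * -1 - al - 1) with (- (2 * 0 + al + 3)) by ring. ring.
  - rewrite fpart_S, IHn. rewrite opp_IZR, <- !INR_IZR_INZ, !S_INR.
    replace (2 * (INR n + 1) - al - 1) with (2 * INR n - al + 1) by ring.
    replace (2 * - (INR n + 1 + 1) - al + 1) with (- (2 * INR n + al + 3)) by ring.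
    replace (2 * - (INR n + 1 + 1) - al - 1) with (- (2 * (INR n + 1) + al + 3)) by ring. ring.
Qed.

Lemma wronskian_bound al s n : noninteger al -> (2 <= n)%nat ->
  Cmod (sin s * fpart (fdterm al s) n - cos s * fpart (fterm al s) n)%C <= 1 / INR n.
Proof.
  intros Ha Hn. assert (Hn' : 2 <= INR n) by (change 2 with (INR 2); apply le_INR; trivial).
  assert (Hal : 0 < al < 2) by (destruct Ha; lra).
  rewrite wronskian_sum by trivial.
  rewrite Cmod_mult. replace (/ 2)%C with (RtoC (/ 2)) by (rewrite RtoC_inv; lra || reflexivity).
  rewrite Cmod_R, Rabs_pos_eq by lra.
  assert (B : forall c r, INR n <= r -> Cmod (cis c * / r)%C <= 1 / INR n).
  { intros c r Hr. rewrite Cmod_mult, Cmod_cis, <- RtoC_inv, Cmod_R by lra.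
    rewrite Rabs_pos_eq by (left; apply Rinv_0_lt_compat; lra).
    unfold Rdiv. rewrite !Rmult_1_l. apply Rinv_le_contravar; lra. }
  assert (B1 := B ((2 * INR n - al + 1) * s) (2 * INR n - al + 1) ltac:(lra)).
  assert (B2 := B (- (2 * INR n + al + 3) * s) (2 * INR n + al + 3) ltac:(lra)).
  set (x := (cis ((2 * INR n - al + 1) * s) * / (2 * INR n - al + 1)%R)%C) in *.
  replace (cis (- (2 * INR n + al + 3) * s) * / (- (2 * INR n + al + 3))%R)%C
    with (- (cis (- (2 * INR n + al + 3) * s) * / (2 * INR n + al + 3)%R))%C.
  2:{ rewrite (RtoC_opp (2 * INR n + al + 3)). field. apply RtoC_neq0; lra. }
  set (y := (cis (- (2 * INR n + al + 3) * s) * / (2 * INR n + al + 3)%R)%C) in *.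
  assert (T := Cmod_triangle x y). replace (x - - y)%C with (x + y)%C by ring. lra.
Qed.

Lemma fseries al s : noninteger al -> exists lp lm : C,
  is_series (V := C_NormedModule) (fun m => fterm al s (Z.of_nat m)) lp /\
  is_series (V := C_NormedModule) (fun m => fterm al s (- Z.of_nat (S m))%Z) lm /\
  forall n, (2 <= n)%nat -> Cmod (fpart (fterm al s) n - (lp + lm)) <= 1 / INR n.
Proof.
  intros Ha. assert (Hal : 0 < al < 2) by (destruct Ha; lra).
  destruct (csum_dominated (fun m => fterm al s (Z.of_nat m)) (fun m => / (2 * INR m - 1 - al) / 2) 2 1) as [lp [Hp Bp]].
  - intros n Hn. assert (Hn' : 2 <= INR n) by (change 2 with (INR 2); apply le_INR; trivial).
    unfold fterm. rewrite Cmod_mult, Cmod_cis, Cmod_R, Rmult_1_l. rewrite fcoef_eq, <- INR_IZR_INZ by trivial.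
    rewrite S_INR. replace (2 * INR n - al - 1) with (2 * INR n - 1 - al) by ring.
    replace (2 * (INR n + 1) - 1 - al) with (2 * INR n - al + 1) by ring.
    rewrite Rabs_pos_eq; [right; field; lra|].
    assert (/ (2 * INR n - al + 1) <= / (2 * INR n - 1 - al)) by (apply Rinv_le_contravar; lra). lra.
  - intros n Hn. assert (Hn' : 2 <= INR n) by (change 2 with (INR 2); apply le_INR; trivial).
    assert (0 < / (2 * INR n - 1 - al)) by (apply Rinv_0_lt_compat; lra). lra.
  - intros n Hn _. assert (Hn' : 2 <= INR n) by (change 2 with (INR 2); apply le_INR; trivial).
    assert (0 < / (2 * INR n - 1 - al)) by (apply Rinv_0_lt_compat; lra).
    replace (/ (2 * INR n - 1 - al) / 2) with (/ (2 * (2 * INR n - 1 - al))) by (field; lra).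
    unfold Rdiv; rewrite Rmult_1_l. apply Rinv_le_contravar; lra.
  - destruct (csum_dominated (fun m => fterm al s (- Z.of_nat (S m))%Z) (fun m => / (2 * INR m + 1 + al) / 2) 0 1) as [lm [Hm Bm]].
    + intros n _. assert (Hn' := pos_INR n).
      unfold fterm. rewrite Cmod_mult, Cmod_cis, Cmod_R, Rmult_1_l. rewrite fcoef_eq, opp_IZR, <- INR_IZR_INZ by trivial.
      rewrite S_INR.
      replace (2 * - (INR n + 1) - al - 1) with (- (2 * (INR n + 1) + 1 + al)) by ring.
      replace (2 * - (INR n + 1) - al + 1) with (- (2 * INR n + 1 + al)) by ring.
      rewrite !Rinv_opp.
      assert (/ (2 * (INR n + 1) + 1 + al) <= / (2 * INR n + 1 + al)) by (apply Rinv_le_contravar; lra).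
      rewrite Rabs_pos_eq; lra.
    + intros n _. assert (Hn' := pos_INR n).
      assert (0 < / (2 * INR n + 1 + al)) by (apply Rinv_0_lt_compat; lra). lra.
    + intros n _ Hn. assert (Hn' : 0 < INR n) by (apply lt_0_INR; lia).
      replace (/ (2 * INR n + 1 + al) / 2) with (/ (2 * (2 * INR n + 1 + al))) by (field; lra).
      unfold Rdiv; rewrite Rmult_1_l. apply Rinv_le_contravar; lra.
    + exists lp, lm. split; [exact Hp|]. split; [exact Hm|].
      intros n Hn. assert (Hn' : 2 <= INR n) by (change 2 with (INR 2); apply le_INR; trivial).
      unfold fpart. specialize (Bp n Hn). specialize (Bm n ltac:(lia)).
      match goal with |- Cmod (?a + ?b - (?c + ?d))%C <= _ => replace (a + b - (c + d))%C with ((a - c) + (b - d))%C by ring end.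
      eapply Rle_trans; [apply Cmod_triangle|].
      rewrite S_INR in Bp, Bm.
      assert (/ (2 * (INR n + 1) - 1 - al) <= / INR n) by (apply Rinv_le_contravar; lra).
      assert (/ (2 * (INR n + 1) + 1 + al) <= / INR n) by (apply Rinv_le_contravar; lra).
      lra.
Qed.

Lemma Cmod_small_eq (x y : C) c : (forall n, (2 <= n)%nat -> Cmod (x - y) <= c / INR n) -> x = y.
Proof.
  intros H. apply small_of_inv in H. apply Ceq_minus. apply Cmod_eq_0.
  generalize (Cmod_ge_0 (x - y)). lra.
Qed.

Lemma sin_between s t : 0 < s < PI -> Rmin s (PI / 2) <= t <= Rmax s (PI / 2) -> sin s <= sin t.
Proof.
  intros Hs. destruct (Rle_dec s (PI / 2)).
  - rewrite Rmin_left, Rmax_right by lra. intros Ht. apply sin_incr_1; lra.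
  - rewrite Rmin_right, Rmax_left by lra. intros Ht. apply sin_decr_1; lra.
Qed.

(** The derivative of [W_n / sin] is the quantity of [wronskian_bound] over [sin^2],
    so it tends to zero uniformly between [s] and [pi/2]. *)
Lemma fsum_const al s W W2 : noninteger al -> 0 < s < PI ->
  (forall n, (2 <= n)%nat -> Cmod (fpart (fterm al s) n - W) <= 1 / INR n) ->
  (forall n, (2 <= n)%nat -> Cmod (fpart (fterm al (PI / 2)) n - W2) <= 1 / INR n) ->
  W = (W2 * sin s)%C.
Proof.
  intros Ha Hs HW HW2. assert (Hp : 0 < sin s) by (apply sin_gt_0; lra).
  assert (HPI := PI_RGT_0).
  apply (Cmod_small_eq _ _ (1 + sin s + 2 * (/ sin s ^ 2) * PI * sin s)). intros n Hn.
  assert (Hn0 : 0 < INR n) by (apply lt_0_INR; lia).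
  set (F := fun t => (fpart (fterm al t) n * / RtoC (sin t))%C).
  (* Between [s] and the maximum at [PI / 2] the sine is at least [sin s], so the
     division by [sin t] is harmless whichever side of [PI / 2] contains [s]. *)
  assert (Hsm : forall t, Rmin s (PI / 2) <= t <= Rmax s (PI / 2) -> sin s <= sin t) by (intros; apply sin_between; trivial).
  set (dF := fun t => ((sin t * fpart (fdterm al t) n - cos t * fpart (fterm al t) n) * / (sin t * sin t))%C).
  assert (HD : forall t, Rmin s (PI / 2) <= t <= Rmax s (PI / 2) -> is_cderive F t (dF t)).
  { intros t Ht. specialize (Hsm t Ht). assert (Hc : RtoC (sin t) <> 0%C) by (apply RtoC_neq0; lra).
    eapply is_cderive_val.
    - apply is_cderive_mult; [apply (is_cderive_fpart (fterm al) (fdterm al)); intros; apply is_cderive_fterm|].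
      apply is_cderive_inv; [exact Hc|]. apply is_cderive_RtoC. apply is_derive_sin.
    - cbv beta. unfold dF. field. exact Hc. }
  assert (HB : forall t, Rmin s (PI / 2) <= t <= Rmax s (PI / 2) -> Cmod (dF t) <= / sin s ^ 2 * (1 / INR n)).
  { intros t Ht. specialize (Hsm t Ht). unfold dF. rewrite Cmod_mult.
    rewrite <- RtoC_mult, <- RtoC_inv, Cmod_R by nra.
    rewrite Rabs_pos_eq by (left; apply Rinv_0_lt_compat; nra). rewrite Rmult_comm.
    apply Rmult_le_compat; [left; apply Rinv_0_lt_compat; nra|apply Cmod_ge_0| |apply wronskian_bound; trivial].
    apply Rinv_le_contravar; nra. }
  assert (HF : Cmod (F s - F (PI / 2)%R) <= 2 * (/ sin s ^ 2 * (1 / INR n)) * PI).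
  { assert (Q : 0 <= 2 * (/ sin s ^ 2 * (1 / INR n))).
    { apply Rmult_le_pos; [lra|]. apply Rmult_le_pos; left; [apply Rinv_0_lt_compat; nra|apply Rdiv_lt_0_compat; lra]. }
    destruct (Rle_dec s (PI / 2)).
    - rewrite Rmin_left, Rmax_right in HD, HB by lra.
      replace (F s - F (PI / 2)%R)%C with (- (F (PI / 2)%R - F s))%C by ring. rewrite Cmod_opp.
      eapply Rle_trans; [apply (cderive_bound F dF s (PI / 2) (/ sin s ^ 2 * (1 / INR n))); trivial|].
      + intros t Ht; apply HD; lra.
      + intros t Ht. eapply is_cderive_continuous, HD, Ht.
      + apply Rmult_le_compat_l; lra.
    - rewrite Rmin_right, Rmax_left in HD, HB by lra.
      eapply Rle_trans; [apply (cderive_bound F dF (PI / 2)%R s (/ sin s ^ 2 * (1 / INR n))); trivial; try lra|].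
      + intros t Ht; apply HD; lra.
      + intros t Ht. eapply is_cderive_continuous, HD, Ht.
      + apply Rmult_le_compat_l; lra. }
  specialize (HW n Hn). specialize (HW2 n Hn).
  set (P := fpart (fterm al s) n) in *. set (P2 := fpart (fterm al (PI / 2)) n) in *.
  assert (Hc : RtoC (sin s) <> 0%C) by (apply RtoC_neq0; lra).
  assert (E : (W - W2 * sin s = - (P - W) + (P2 - W2) * sin s + (F s - F (PI / 2)%R) * sin s)%C).
  { unfold F. fold P P2. rewrite sin_PI2. field. exact Hc. }
  rewrite E. eapply Rle_trans; [apply Cmod_triangle|].
  assert (C1 : Cmod ((F s - F (PI / 2)%R) * sin s) <= 2 * (/ sin s ^ 2 * (1 / INR n)) * PI * sin s).
  { rewrite Cmod_mult, Cmod_R, (Rabs_pos_eq (sin s)) by lra. apply Rmult_le_compat_r; lra. }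
  assert (C2 : Cmod (- (P - W) + (P2 - W2) * sin s) <= 1 / INR n + 1 / INR n * sin s).
  { eapply Rle_trans; [apply Cmod_triangle|]. rewrite Cmod_opp, Cmod_mult, Cmod_R, (Rabs_pos_eq (sin s)) by lra.
    apply Rplus_le_compat; trivial. apply Rmult_le_compat_r; lra. }
  eapply Rle_trans; [apply Rplus_le_compat; [exact C2|exact C1]|]. right. field. lra.
Qed.

(** Termwise primitive of the series multiplied back by [e^(i al s)]: every term
    with [l <> 0] has period [pi], and only the constant term contributes to the
    integral over a period. *)
Definition fprim (al s : R) (l : Z) : C :=
  if Z.eq_dec l 0 then (fcoef al 0 * s)%C
  else (fcoef al l * / (2 * Ci * IZR l) * cis (2 * IZR l * s))%C.

Lemma is_cderive_fprim al s l : is_cderive (fun s => fprim al s l) s (cis (al * s) * fterm al s l)%C.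
Proof.
  assert (E : (cis (al * s) * fterm al s l)%C = (cis (2 * IZR l * s) * fcoef al l)%C).
  { unfold fterm. rewrite Cmult_assoc, <- cis_add. do 2 f_equal. ring. }
  rewrite E. unfold fprim. destruct (Z.eq_dec l 0) as [->|Hl].
  - eapply is_cderive_val; [apply is_cderive_scal, is_cderive_RtoC, (is_derive_id (K:=R_AbsRing))|].
    replace (2 * 0 * s) with 0 by ring. rewrite cis_0. change one with 1. ring.
  - eapply is_cderive_val; [apply is_cderive_scal, is_cderive_cis|].
    rewrite RtoC_mult. field. split; [apply RtoC_neq0, not_0_IZR, Hl|apply Ci_nz].
Qed.

Lemma cis_2pi_Z l : cis (2 * IZR l * PI) = 1%C.
Proof.
  assert (H : sin (IZR l * PI) = 0) by (apply sin_eq_0_1; exists l; reflexivity).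
  unfold cis. rewrite Rmult_assoc, cos_2a_sin, sin_2a, H.
  C_parts; ring.
Qed.

Lemma fprim_increment al n :
  (fpart (fun l => fprim al PI l - fprim al 0 l) n = PI * fcoef al 0)%C.
Proof.
  assert (H0 : (fprim al PI 0 - fprim al 0 0 = PI * fcoef al 0)%C).
  { unfold fprim. cbn. ring. }
  assert (H : forall l, l <> 0%Z -> (fprim al PI l - fprim al 0 l = 0)%C).
  { intros l Hl. unfold fprim. destruct (Z.eq_dec l 0); [contradiction|].
    rewrite cis_2pi_Z, Rmult_0_r, cis_0. ring. }
  induction n.
  - unfold fpart. rewrite !csum_O. change (Z.of_nat 0) with 0%Z. rewrite H0, H by lia. ring.
  - rewrite fpart_S, IHn, !H by lia. ring.
Qed.

Definition qprim (al s : R) : C := (cis (al * s) * (Ci * al * sin s - cos s) * / (1 - al ^ 2)%R)%C.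

Lemma is_cderive_qprim al s : 1 - al ^ 2 <> 0 ->
  is_cderive (fun s => qprim al s) s (cis (al * s) * sin s)%C.
Proof.
  intros Ha. unfold qprim. assert (Hc := RtoC_neq0 _ Ha). eapply is_cderive_val.
  - apply is_cderive_mult; [|apply is_cderive_const]. apply is_cderive_mult; [apply is_cderive_cis|].
    apply is_cderive_minus; [apply is_cderive_scal, is_cderive_RtoC, is_derive_sin|].
    apply is_cderive_RtoC, is_derive_cos.
  - cbv beta. rewrite RtoC_opp.
    replace (RtoC (1 - al ^ 2)) with (1 - al * al)%C in * by (rewrite RtoC_minus, RtoC_pow; cbn; ring).
    transitivity (cis (al * s) * (sin s * (1 + Ci * Ci * (al * al))) * / (1 - al * al))%C; [field; exact Hc|].
    rewrite Ci_sqr. field. exact Hc.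
Qed.

(** Compare the integral over a period, termwise, with the integral of [e^(i al s)
    sin s], whose primitive is [qprim]. *)
Lemma fsum_constant al W2 : noninteger al ->
  (forall n, (2 <= n)%nat -> Cmod (fpart (fterm al (PI / 2)) n - W2) <= 1 / INR n) ->
  (W2 * (1 + cis (al * PI)) = - PI)%C.
Proof.
  intros Ha HW2. assert (HPI := PI_RGT_0).
  assert (N1 : 1 - al ^ 2 <> 0) by (destruct Ha; nra).
  assert (Hc := RtoC_neq0 _ N1).
  assert (B : forall n s, (2 <= n)%nat -> 0 <= s <= PI -> Cmod (fpart (fterm al s) n - W2 * sin s) <= 1 / INR n).
  { intros n s Hn Hs.
    assert (WB := wronskian_bound al s n Ha Hn).
    destruct (Req_dec s 0) as [->|H0]; [|destruct (Req_dec s PI) as [->|H1]].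
    - rewrite sin_0, cos_0 in *. eapply Rle_trans; [|exact WB].
      right. rewrite <- Cmod_opp. f_equal. ring.
    - rewrite sin_PI, cos_PI in *. eapply Rle_trans; [|exact WB].
      right. f_equal. ring.
    - destruct (fseries al s Ha) as [lp [lm [_ [_ HW]]]].
      rewrite <- (fsum_const al s (lp + lm) W2 Ha ltac:(lra) HW HW2). apply HW, Hn. }
  assert (E : (PI * fcoef al 0)%C = (W2 * (qprim al PI - qprim al 0))%C).
  { apply (Cmod_small_eq _ _ (2 * PI)). intros n Hn.
    assert (Hn0 : 0 < INR n) by (apply lt_0_INR; lia).
    set (h := fun s => (fpart (fprim al s) n - W2 * qprim al s)%C).
    set (dh := fun s => (cis (al * s) * (fpart (fterm al s) n - W2 * sin s))%C).
    assert (D : forall s, is_cderive h s (dh s)).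
    { intros s. eapply is_cderive_val.
      - apply is_cderive_minus.
        + apply (is_cderive_fpart (fprim al) (fun s l => cis (al * s) * fterm al s l)%C). intros; apply is_cderive_fprim.
        + apply is_cderive_scal, is_cderive_qprim, N1.
      - rewrite fpart_cmult. unfold dh. ring. }
    rewrite <- (fprim_increment al n), fpart_minus.
    match goal with |- Cmod ?z <= _ => replace z with (h PI - h 0)%C by (unfold h; ring) end.
    eapply Rle_trans; [apply (cderive_bound h dh 0 PI (1 / INR n)); try lra|].
    - intros; apply D.
    - intros; eapply is_cderive_continuous, D.
    - intros t Ht. unfold dh. rewrite Cmod_mult, Cmod_cis, Rmult_1_l. apply B; trivial; lra.
    - right. field. lra. }
  unfold qprim in E. rewrite sin_PI, cos_PI, sin_0, cos_0, Rmult_0_r, cis_0 in E.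
  unfold fcoef in E. replace (/ ((2 * 0 - al) ^ 2 - 1)) with (- / (1 - al ^ 2)) in E.
  2:{ replace ((2 * 0 - al) ^ 2 - 1) with (- (1 - al ^ 2)) by ring. rewrite Rinv_opp. reflexivity. }
  rewrite (RtoC_opp (/ _)), RtoC_inv in E by trivial.
  transitivity ((W2 * (cis (al * PI) * (Ci * al * 0 - RtoC (-1)) * / (1 - al ^ 2)%R - 1 * (Ci * al * 0 - 1) * / (1 - al ^ 2)%R)) * (1 - al ^ 2)%R)%C.
  - field. exact Hc.
  - rewrite <- E. field. exact Hc.
Qed.

Lemma zseries_cmult (c : C) (a : Z -> C) (l : C) : is_zseries a l -> is_zseries (fun m => c * a m)%C (c * l)%C.
Proof.
  intros [lp [lm [Hp [Hm ->]]]]. exists (c * lp)%C, (c * lm)%C. split; [|split; [|ring]].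
  - exact (is_series_scal (V:=C_NormedModule) c _ _ Hp).
  - exact (is_series_scal (V:=C_NormedModule) c _ _ Hm).
Qed.

Lemma zseries_plus (a b : Z -> C) (la lb : C) : is_zseries a la -> is_zseries b lb ->
  is_zseries (fun m => a m + b m)%C (la + lb)%C.
Proof.
  intros [lp [lm [Hp [Hm ->]]]] [kp [km [Kp [Km ->]]]]. exists (lp + kp)%C, (lm + km)%C. split; [|split; [|ring]].
  - exact (is_series_plus (V:=C_NormedModule) _ _ _ _ Hp Kp).
  - exact (is_series_plus (V:=C_NormedModule) _ _ _ _ Hm Km).
Qed.

Lemma zseries_ext (a b : Z -> C) (l : C) : (forall m, a m = b m) -> is_zseries a l -> is_zseries b l.
Proof.
  intros E [lp [lm [Hp [Hm ->]]]]. exists lp, lm. split; [|split; trivial].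
  - eapply (is_series_ext (V:=C_NormedModule)); [|exact Hp]. intros; apply E.
  - eapply (is_series_ext (V:=C_NormedModule)); [|exact Hm]. intros; apply E.
Qed.

Lemma zseries_shift (a : Z -> C) (l : C) : is_zseries a l -> is_zseries (fun m => a (m - 1)%Z) l.
Proof.
  intros [lp [lm [Hp [Hm ->]]]]. exists (lp + a (-1)%Z)%C, (lm - a (-1)%Z)%C. split; [|split; [|ring]].
  - apply (is_series_decr_1 (V:=C_NormedModule)).
    change (is_series (V := C_NormedModule) (fun k => a (Z.of_nat (S k) - 1)%Z) ((lp + a (-1)%Z) - a (-1)%Z)%C).
    replace ((lp + a (-1)%Z) - a (-1)%Z)%C with lp by ring.
    eapply (is_series_ext (V:=C_NormedModule)); [|exact Hp]. intros n. cbv beta. f_equal. lia.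
  - eapply (is_series_ext (V:=C_NormedModule)).
    2:{ apply (is_series_incr_1 (V:=C_NormedModule) (fun n => a (- Z.of_nat (S n))%Z)).
        change (is_series (V := C_NormedModule) (fun n => a (- Z.of_nat (S n))%Z) ((lm - a (-1)%Z) + a (-1)%Z)%C).
        replace ((lm - a (-1)%Z) + a (-1)%Z)%C with lm by ring. exact Hm. }
    intros n. cbv beta. f_equal. lia.
Qed.

Lemma base_series al s : noninteger al -> 0 < s < PI ->
  is_zseries (fun l => cis (2 * IZR l * s) * fcoef al l)%C
    (- (PI / (2 * cos (al * (PI / 2))))%R * cis (- (al * (PI / 2))) * cis (al * s) * sin s)%C.
Proof.
  intros Ha Hs.
  destruct (fseries al s Ha) as [lp [lm [Hp [Hm HW]]]].
  destruct (fseries al (PI / 2) Ha) as [lp2 [lm2 [_ [_ HW2]]]].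
  assert (E1 := fsum_const al s (lp + lm) (lp2 + lm2) Ha Hs HW HW2).
  assert (E2 := fsum_constant al (lp2 + lm2) Ha HW2).
  set (W2 := (lp2 + lm2)%C) in *. assert (HPI := PI_RGT_0).
  assert (Hcos : cos (al * (PI / 2)) <> 0).
  { destruct Ha as [Ha|Ha].
    - apply Rgt_not_eq, cos_gt_0; nra.
    - apply Rlt_not_eq, cos_lt_0; nra. }
  assert (E3 : (1 + cis (al * PI) = 2 * cos (al * (PI / 2)) * cis (al * (PI / 2)))%C).
  { replace (al * PI) with (2 * (al * (PI / 2))) by field. unfold cis. rewrite cos_2a_cos, sin_2a.
    C_parts; ring. }
  assert (E4 : (cis (al * (PI / 2)) * cis (- (al * (PI / 2))) = 1)%C) by (rewrite <- cis_add, Rplus_opp_r, cis_0; trivial).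
  assert (Cc := RtoC_neq0 _ Hcos).
  assert (E5 : W2 = (- (PI / (2 * cos (al * (PI / 2))))%R * cis (- (al * (PI / 2))))%C).
  { rewrite E3 in E2. rewrite RtoC_div, RtoC_mult by nra.
    transitivity (W2 * (2 * cos (al * (PI / 2)) * cis (al * (PI / 2))) * cis (- (al * (PI / 2))) / (2 * cos (al * (PI / 2))))%C.
    - transitivity (W2 * (cis (al * (PI / 2)) * cis (- (al * (PI / 2)))))%C; [rewrite E4; ring|field; exact Cc].
    - rewrite E2. field. exact Cc. }
  rewrite <- E5.
  apply (zseries_ext (fun l => cis (al * s) * fterm al s l)%C).
  { intros l. unfold fterm. rewrite Cmult_assoc, <- cis_add. do 2 f_equal. ring. }
  replace (W2 * cis (al * s) * sin s)%C with (cis (al * s) * (W2 * sin s))%C by ring.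
  rewrite <- E1. apply zseries_cmult. exists lp, lm. auto.
Qed.

(** * Partial fractions and the Gamma quotients of the series *)

Definition rsum (f : nat -> R) (n : nat) : R := sum_n (G := R_AbelianGroup) f n.

Lemma rsum_O f : rsum f 0 = f 0%nat.
Proof. exact (sum_O (G:=R_AbelianGroup) f). Qed.

Lemma rsum_S f n : rsum f (S n) = rsum f n + f (S n).
Proof. exact (sum_Sn (G:=R_AbelianGroup) f n). Qed.

Lemma rsum_ext f g n : (forall m, (m <= n)%nat -> f m = g m) -> rsum f n = rsum g n.
Proof. apply (sum_n_ext_loc (G:=R_AbelianGroup)). Qed.

Lemma rsum_plus f g n : rsum (fun m => f m + g m) n = rsum f n + rsum g n.
Proof. apply (sum_n_plus (G:=R_AbelianGroup)). Qed.

Lemma rsum_mult c f n : rsum (fun m => c * f m) n = c * rsum f n.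
Proof. apply (sum_n_mult_l (K:=R_Ring)). Qed.

Lemma csum_RtoC f n : csum (fun m => RtoC (f m)) n = RtoC (rsum f n).
Proof.
  induction n; [rewrite csum_O, rsum_O; trivial|]. rewrite csum_S, rsum_S, IHn, RtoC_plus. reflexivity.
Qed.

(** At [q = 1] the recursion [conv_succ] says that the value does not depend on [n].
    *)
Lemma Vandermonde a n : rsum (fun m => mchoose a m * mchoose (1 - a) (n - m)) n = 1.
Proof.
  assert (H : conv a (1 - a) 1 n = 1%C).
  { induction n.
    - unfold conv. rewrite csum_O. cbn. rewrite !Rmult_1_r. ring.
    - assert (E := conv_succ a (1 - a) 1 n). rewrite IHn in E.
      replace (a + (1 - a) + INR n) with (INR (S n)) in E by (rewrite S_INR; ring).
      assert (N : RtoC (INR (S n)) <> 0%C) by (apply RtoC_neq0, not_0_INR; lia).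
      transitivity (INR (S n) * conv a (1 - a) 1 (S n) / INR (S n))%C; [field; exact N|].
      rewrite E. field. exact N. }
  apply RtoC_inj. rewrite <- csum_RtoC, <- H. unfold conv. apply csum_ext. intros m _.
  rewrite Cpow_1_l. ring.
Qed.

Definition rho (a Y : R) (n : nat) : R :=
  rsum (fun m => mchoose (1 + a) m * mchoose (- a) (n - m) * / (Y - INR m)) n.

(** Write [Y - (n+1) = (Y-m) - (n+1-m)]: the first part sums to 1 by [Vandermonde],
    the second one absorbs the factor into the multiset coefficient. *)
Lemma rho_succ a Y n : (forall m, Y - INR m <> 0) ->
  (Y - INR (S n)) * rho a Y (S n) = (Y - INR n + a) * rho a Y n.
Proof.
  intros HY. unfold rho.
  set (T := rsum (fun m => INR (S n - m) * (mchoose (1 + a) m * mchoose (- a) (S n - m) * / (Y - INR m))) (S n)).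
  assert (V1 := Vandermonde (1 + a) (S n)). assert (V0 := Vandermonde (1 + a) n).
  replace (1 - (1 + a)) with (- a) in V1, V0 by ring.
  assert (E1 : (Y - INR (S n)) * rsum (fun m => mchoose (1 + a) m * mchoose (- a) (S n - m) * / (Y - INR m)) (S n) + T = 1).
  { unfold T. rewrite <- rsum_mult, <- rsum_plus. eapply eq_trans; [|exact V1]. apply rsum_ext. intros m Hm.
    rewrite (minus_INR (S n) m) by trivial. field. apply HY. }
  assert (E2 : T = (INR n - a - Y) * rsum (fun m => mchoose (1 + a) m * mchoose (- a) (n - m) * / (Y - INR m)) n + 1).
  { unfold T. rewrite rsum_S, Nat.sub_diag. change (INR 0) with 0. rewrite Rmult_0_l, Rplus_0_r.
    apply (eq_trans (y := (INR n - a - Y) * rsum (fun m => mchoose (1 + a) m * mchoose (- a) (n - m) * / (Y - INR m)) n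
      + rsum (fun m => mchoose (1 + a) m * mchoose (- a) (n - m)) n)); [|f_equal; exact V0].
    rewrite <- rsum_mult, <- rsum_plus. apply rsum_ext. intros m Hm.
    replace (S n - m)%nat with (S (n - m)) by lia.
    assert (E := mchoose_S (- a) (n - m)).
    replace (INR (S (n - m)) * (mchoose (1 + a) m * mchoose (- a) (S (n - m)) * / (Y - INR m)))
      with (INR (S (n - m)) * mchoose (- a) (S (n - m)) * (mchoose (1 + a) m * / (Y - INR m))) by ring.
    rewrite E, minus_INR by trivial. field. apply HY. }
  lra.
Qed.

(** Four times the difference of two consecutive Fourier coefficients is [-2 pfrac];
    also, [pfrac] is half the second difference of [1/(Y-m)]. *)
Definition pfrac (Y m : R) : R := / ((Y - m + 1) * (Y - m) * (Y - m - 1)).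

Definition psum (a Y : R) (n : nat) : R :=
  rsum (fun m => mchoose (1 + a) m * mchoose (1 - a) (n - m) * pfrac Y (INR m)) n.

Lemma mchoose_diff a j : mchoose (1 - a) (S j) - mchoose (1 - a) j = mchoose (- a) (S j).
Proof.
  assert (E1 := mchoose_S (1 - a) j). assert (E2 := mchoose_up (- a) j). assert (E3 := mchoose_S (- a) j).
  replace (- a + 1) with (1 - a) in E2 by ring. rewrite S_INR in *.
  assert (N := pos_INR j). apply (Rmult_eq_reg_l (INR j + 1)); [|lra]. rewrite E3, <- E2. lra.
Qed.

(** Consecutive coefficients [mchoose (1-a)] differ by [mchoose (-a)], which leaves
    a second difference of [rho] in [Y]. *)
Lemma psum_succ a Y n : (forall j : Z, Y - IZR j <> 0) ->
  psum a Y (S n) = psum a Y n + (rho a (Y + 1) (S n) - 2 * rho a Y (S n) + rho a (Y - 1) (S n)) / 2.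
Proof.
  intros HY.
  assert (E : psum a Y (S n) = psum a Y n + rsum (fun m => mchoose (1 + a) m * mchoose (- a) (S n - m) * pfrac Y (INR m)) (S n)).
  { unfold psum. rewrite !rsum_S, Nat.sub_diag. rewrite <- Rplus_assoc, <- rsum_plus. f_equal.
    apply rsum_ext. intros m Hm. replace (S n - m)%nat with (S (n - m)) by lia.
    rewrite <- mchoose_diff. ring. }
  rewrite E. f_equal. unfold rho.
  transitivity (rsum (fun m => / 2 * (mchoose (1 + a) m * mchoose (- a) (S n - m) * / (Y + 1 - INR m))
     + (-1 * (mchoose (1 + a) m * mchoose (- a) (S n - m) * / (Y - INR m))
     + / 2 * (mchoose (1 + a) m * mchoose (- a) (S n - m) * / (Y - 1 - INR m)))) (S n)).
  - apply rsum_ext. intros m _. unfold pfrac.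
    assert (N1 := HY (Z.of_nat m)). assert (N2 := HY (Z.of_nat m - 1)%Z). assert (N3 := HY (Z.of_nat m + 1)%Z).
    rewrite ?minus_IZR, ?plus_IZR, <- ?INR_IZR_INZ in *. field. repeat split; lra.
  - rewrite !rsum_plus, !rsum_mult. field.
Qed.

(** Induction with [psum_succ]; the values of [rho] at [Y-1], [Y], [Y+1] are
    multiples of the same sequence [r] because their recursions are shifts of the
    one of [r]. *)
Lemma psum_closed a Y (r : nat -> R) :
  (forall j : Z, Y - IZR j <> 0) -> Y + a <> 0 -> Y + a + 1 <> 0 ->
  r 0%nat * ((Y + a) * (Y + a + 1) * Y * (Y + 1)) = 1 ->
  (forall k, r (S k) * (Y - INR k - 1) = r k * (Y - INR k + 1 + a)) ->
  forall n, -2 * psum a Y n = INR (S n) * ((1 - a) * INR (S n) - 2 * Y - 1 - a) * r (S n).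
Proof.
  intros HY N1 N2 R0 RS.
  assert (HYm : forall m, Y - INR m <> 0) by (intros m; rewrite INR_IZR_INZ; apply HY).
  assert (HYm1 : forall m, Y + 1 - INR m <> 0).
  { intros m. generalize (HY (Z.of_nat m - 1)%Z). rewrite minus_IZR, <- INR_IZR_INZ. lra. }
  assert (HYm2 : forall m, Y - 1 - INR m <> 0).
  { intros m. generalize (HY (Z.of_nat m + 1)%Z). rewrite plus_IZR, <- INR_IZR_INZ. lra. }
  assert (N3 : Y <> 0) by (generalize (HYm 0%nat); cbn; lra).
  assert (N4 : Y + 1 <> 0) by (generalize (HYm1 0%nat); cbn; lra).
  assert (N5 : Y - 1 <> 0) by (generalize (HYm2 0%nat); cbn; lra).
  assert (r0 : r 0%nat = / ((Y + a) * (Y + a + 1) * Y * (Y + 1))).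
  { apply (Rmult_eq_reg_r ((Y + a) * (Y + a + 1) * Y * (Y + 1))).
    - rewrite R0. field. auto.
    - repeat apply Rmult_integral_contrapositive_currified; trivial. }
  assert (rS : forall k, r (S k) = r k * (Y - INR k + 1 + a) / (Y - INR k - 1)).
  { intros k. rewrite <- RS. field. generalize (HYm2 k); lra. }
  assert (C1 : forall n, rho a Y n = r n * ((Y + a) * (Y - INR n + 1 + a) * (Y + 1))).
  { induction n.
    - unfold rho. rewrite rsum_O, r0. cbn. field. repeat split; trivial; try lra.
    - apply (Rmult_eq_reg_l (Y - INR (S n))); [|apply HYm]. rewrite rho_succ, IHn, rS by trivial.
      rewrite S_INR. field. generalize (HYm2 n); lra. }
  assert (C2 : forall n, rho a (Y + 1) n = r n * ((Y + a + 1) * (Y + a) * (Y - INR n))).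
  { induction n.
    - unfold rho. rewrite rsum_O, r0. cbn. field. repeat split; trivial; try lra.
    - apply (Rmult_eq_reg_l (Y + 1 - INR (S n))); [|apply HYm1]. rewrite rho_succ, IHn, rS by trivial.
      rewrite S_INR. field. generalize (HYm2 n); lra. }
  assert (C3 : forall n, rho a (Y - 1) n = r n * ((Y - INR n + a) * (Y - INR n + a + 1) * (Y + 1) * Y / (Y - INR n - 1))).
  { induction n.
    - unfold rho. rewrite rsum_O, r0. cbn. field. repeat split; trivial; try lra.
    - apply (Rmult_eq_reg_l (Y - 1 - INR (S n))); [|apply HYm2]. rewrite rho_succ, IHn, rS by trivial.
      assert (H1 := HYm2 n). assert (H2 := HYm2 (S n)). rewrite S_INR in *. field. repeat split; lra. }
  induction n.
  - unfold psum, pfrac. rewrite rsum_O, rS, r0. cbn. field. repeat split; trivial; try lra.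
  - rewrite psum_succ by trivial. rewrite Rmult_plus_distr_l, IHn, C1, C2, C3.
    rewrite (rS (S n)). assert (H1 := HYm2 (S n)). rewrite !S_INR in *. field. lra.
Qed.

Lemma Gamma_gt0 x : 0 < x -> 0 < Gamma x.
Proof.
  intros Hx. destruct (nfloor_ex x) as [n [Hn1 Hn2]]; [lra|].
  destruct Wendel_Gamma as [_ [_ W]].
  assert (H := W x (INR n + 1 - x) Hx ltac:(lra)).
  replace (x + (INR n + 1 - x)) with (1 + INR n) in H by ring.
  rewrite (Wendel_rising Gamma 1 n Wendel_Gamma Rlt_0_1), Gamma_1, Rmult_1_r in H.
  assert (P := rising_pos 1 n Rlt_0_1). assert (Q := Rpower_pos (x + 1) (INR n + 1 - x)).
  destruct (Gamma_ge0 x Hx) as [h|h]; trivial. rewrite <- h in H. lra.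
Qed.

Lemma Gamma_neq0 x : -2 < x -> x <> 0 -> x <> -1 -> Gamma x <> 0.
Proof.
  intros H1 H2 H3 E. assert (G1 := Gamma_succ x H2). rewrite E in G1.
  destruct (Rlt_dec 0 x) as [h|h]; [generalize (Gamma_gt0 x h); lra|].
  assert (G2 := Gamma_succ (x + 1) ltac:(lra)).
  assert (G3 : Gamma (x + 1 + 1) = 0) by (rewrite G2, G1; ring).
  generalize (Gamma_gt0 (x + 1 + 1) ltac:(lra)). lra.
Qed.

Definition phi (a : R) (l : Z) : R :=
  Gamma ((-1 + a) / 2 + IZR (Z.abs l)) / Gamma ((3 - a) / 2 + IZR (Z.abs l)).

Definition odd_free (a : R) : Prop := forall j : Z, IZR (2 * j + 1) <> a.

Lemma phi_pos_succ a (l : Z) : odd_free a -> (0 <= l)%Z ->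
  phi a (l + 1) * (IZR l + (3 - a) / 2) = phi a l * (IZR l + (-1 + a) / 2).
Proof.
  intros Ha Hl. unfold phi. rewrite !Z.abs_eq by lia. rewrite plus_IZR.
  assert (N1 : IZR l + (-1 + a) / 2 <> 0).
  { generalize (Ha (- l)%Z). rewrite plus_IZR, mult_IZR, opp_IZR. intros; lra. }
  assert (N2 : IZR l + (3 - a) / 2 <> 0).
  { generalize (Ha (l + 1)%Z). rewrite plus_IZR, mult_IZR, plus_IZR. intros; lra. }
  replace ((-1 + a) / 2 + (IZR l + 1)) with ((IZR l + (-1 + a) / 2) + 1) by ring.
  replace ((3 - a) / 2 + (IZR l + 1)) with ((IZR l + (3 - a) / 2) + 1) by ring.
  rewrite !Gamma_succ by trivial.
  rewrite !(Rplus_comm (_ / 2) (IZR l)).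
  set (x := IZR l + (-1 + a) / 2) in *. set (y := IZR l + (3 - a) / 2) in *.
  unfold Rdiv. rewrite Rinv_mult.
  transitivity (Gamma x * / Gamma y * x * (/ y * y)); [ring|]. rewrite Rinv_l by trivial. ring.
Qed.

Lemma phi_opp a l : phi a (- l) = phi a l.
Proof. unfold phi. rewrite Z.abs_opp. reflexivity. Qed.

(** The quotient is even in [l], and so is the recursion: it may be read with [l] in
    place of its absolute value. *)
Lemma phi_succ a (l : Z) : odd_free a ->
  phi a (l + 1) * (IZR l + (3 - a) / 2) = phi a l * (IZR l + (-1 + a) / 2).
Proof.
  intros Ha. destruct (Z_le_dec 0 l) as [h|h]; [apply phi_pos_succ; trivial|].
  assert (E := phi_pos_succ a (- (l + 1)) Ha ltac:(lia)).
  replace (- (l + 1) + 1)%Z with (- l)%Z in E by lia. rewrite !phi_opp in E.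
  rewrite opp_IZR, plus_IZR in E.
  transitivity (- (phi a (l + 1) * (- (IZR l + 1) + (-1 + a) / 2))); [field|]. rewrite <- E. field.
Qed.

(** Each denominator is the numerator of the other factor shifted by two, so the
    product is rational. *)
Lemma phi_prod a l : noninteger a ->
  phi a l * phi (- a) l * ((IZR l + (-1 + a) / 2) * (IZR l + (1 + a) / 2) * (IZR l - (1 + a) / 2) * (IZR l + (1 - a) / 2)) = 1.
Proof.
  intros Ha.
  assert (G : forall n : Z, (0 <= n)%Z -> phi a n * phi (- a) n * ((IZR n + (-1 + a) / 2) * (IZR n + (1 + a) / 2) * (IZR n - (1 + a) / 2) * (IZR n + (1 - a) / 2)) = 1).
  { clear l. intros n Hn. unfold phi. rewrite !Z.abs_eq by trivial.
    assert (Hn' : 0 <= IZR n) by (apply (IZR_le 0); trivial).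
    assert (Q := order_not_odd a). unfold noninteger in Ha.
    assert (N1 : IZR n + (-1 + a) / 2 <> 0).
    { generalize (order_not_odd a (- n) Ha). rewrite plus_IZR, mult_IZR, opp_IZR. intros; lra. }
    assert (N2 : IZR n + (-1 - a) / 2 <> 0).
    { generalize (order_not_odd a (n - 1) Ha). rewrite plus_IZR, mult_IZR, minus_IZR. intros; lra. }
    assert (N3 : IZR n + (1 - a) / 2 <> 0).
    { generalize (order_not_odd a n Ha). rewrite plus_IZR, mult_IZR. intros; lra. }
    assert (N4 : IZR n + (1 + a) / 2 <> 0) by (destruct Ha; lra).
    replace ((3 - a) / 2 + IZR n) with (IZR n + (-1 - a) / 2 + 1 + 1) by field.
    replace ((3 - - a) / 2 + IZR n) with (IZR n + (-1 + a) / 2 + 1 + 1) by field.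
    replace ((-1 + - a) / 2 + IZR n) with (IZR n + (-1 - a) / 2) by field.
    replace ((-1 + a) / 2 + IZR n) with (IZR n + (-1 + a) / 2) by field.
    set (x := IZR n + (-1 + a) / 2) in *. set (y := IZR n + (-1 - a) / 2) in *.
    replace (IZR n + (1 + a) / 2) with (x + 1) in * by (unfold x; field).
    replace (IZR n + (1 - a) / 2) with (y + 1) in * by (unfold y; field).
    replace (IZR n - (1 + a) / 2) with y by (unfold y; field).
    rewrite !Gamma_succ by trivial.
    assert (GX : Gamma x <> 0) by (apply Gamma_neq0; unfold x in *; destruct Ha; lra).
    assert (GY : Gamma y <> 0) by (apply Gamma_neq0; unfold y in *; destruct Ha; lra).
    field. repeat split; trivial. }
  destruct (Z_le_dec 0 l) as [h|h]; [apply G; trivial|].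
  assert (E := G (- l)%Z ltac:(lia)). rewrite !phi_opp, opp_IZR in E. eapply eq_trans; [|exact E]. field.
Qed.

Lemma opp_odd_free a : noninteger a -> odd_free (- a).
Proof.
  intros Ha j E. apply (order_not_odd a (- j - 1) Ha). rewrite plus_IZR, mult_IZR, minus_IZR, opp_IZR.
  rewrite plus_IZR, mult_IZR in E. lra.
Qed.

(** As functions of [k], both sides satisfy the first-order recursion of
    [psum_closed]. *)
Lemma rf_coef a (n : nat) (l : Z) : noninteger a ->
  ((1 - a) * IZR (Z.of_nat (S n)) ^ 2 - 2 * IZR (Z.of_nat (S n)) * IZR l)
  * (Gamma ((-1 + a) / 2 + IZR (Z.abs l)) * Gamma ((-1 - a) / 2 + IZR (Z.abs (Z.of_nat (S n) - l)))
     / (Gamma ((3 - a) / 2 + IZR (Z.abs l)) * Gamma ((3 + a) / 2 + IZR (Z.abs (Z.of_nat (S n) - l)))))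
  = -2 * psum a (IZR l - (1 + a) / 2) n.
Proof.
  intros Ha. set (Y := IZR l - (1 + a) / 2).
  assert (HY : forall j : Z, Y - IZR j <> 0).
  { intros j. unfold Y. generalize (order_not_odd a (l - j - 1) Ha). rewrite plus_IZR, mult_IZR, !minus_IZR. intros; lra. }
  assert (N1 : Y + a <> 0).
  { unfold Y. generalize (order_not_odd a (- l) Ha). rewrite plus_IZR, mult_IZR, opp_IZR. intros; lra. }
  assert (N2 : Y + a + 1 <> 0).
  { unfold Y. generalize (order_not_odd a (- l - 1) Ha). rewrite plus_IZR, mult_IZR, minus_IZR, opp_IZR. intros; lra. }
  rewrite (psum_closed a Y (fun k => phi a l * phi (- a) (l - Z.of_nat k)) HY N1 N2).
  - rewrite <- INR_IZR_INZ. set (k := INR (S n)).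
    unfold phi. replace (Z.abs (l - Z.of_nat (S n))) with (Z.abs (Z.of_nat (S n) - l)) by lia.
    replace (3 - - a) with (3 + a) by ring. replace (-1 + - a) with (-1 - a) by ring.
    replace ((1 - a) * k - 2 * Y - 1 - a) with ((1 - a) * k - 2 * IZR l) by (unfold Y; field).
    unfold Rdiv. rewrite !Rinv_mult. ring.
  - cbv beta. change (Z.of_nat 0) with 0%Z. rewrite Z.sub_0_r. eapply eq_trans; [|exact (phi_prod a l Ha)]. f_equal. unfold Y. field.
  - intros k. assert (E := phi_succ (- a) (l - Z.of_nat (S k)) (opp_odd_free a Ha)).
    replace (l - Z.of_nat (S k) + 1)%Z with (l - Z.of_nat k)%Z in E by lia.
    rewrite minus_IZR, <- INR_IZR_INZ, S_INR in E. cbv beta.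
    rewrite !Rmult_assoc. f_equal. unfold Y.
    transitivity (phi (- a) (l - Z.of_nat (S k)) * (IZR l - (INR k + 1) + (-1 + - a) / 2)); [f_equal; field|].
    rewrite <- E. f_equal; field.
Qed.

Lemma fcoef_diff a l m : noninteger a ->
  4 * (fcoef a (l - m) - fcoef a (l - m - 1)) = -2 * pfrac (IZR l - (1 + a) / 2) (IZR m).
Proof.
  intros Ha. destruct (freq_neq a (l - m) Ha) as [N1 N2]. destruct (freq_neq a (l - m - 1) Ha) as [N3 N4].
  rewrite !fcoef_eq by trivial. unfold pfrac. rewrite !minus_IZR in *. field. repeat split; lra.
Qed.

(** Multiplication by [e^(2is)] shifts the coefficients. *)
Lemma zseries_qpow (b : Z -> C) (s : R) (L : C) (m : nat) :
  is_zseries (fun l => cis (2 * IZR l * s) * b l)%C L ->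
  is_zseries (fun l => cis (2 * IZR l * s) * b (l - Z.of_nat m)%Z)%C (Cpow (cis (2 * s)) m * L)%C.
Proof.
  intros H. induction m.
  - cbn [Cpow]. rewrite Cmult_1_l. eapply zseries_ext; [|exact H]. intros l. cbv beta. do 2 f_equal. cbn; lia.
  - apply zseries_shift in IHm. apply (zseries_cmult (cis (2 * s))) in IHm.
    rewrite Cpow_S, <- Cmult_assoc. eapply zseries_ext; [|exact IHm].
    intros l. cbv beta. rewrite Cmult_assoc, <- cis_add, minus_IZR. f_equal; [f_equal; ring|f_equal; lia].
Qed.

Lemma zseries_csum (u : nat -> Z -> C) (L : nat -> C) n :
  (forall m, is_zseries (u m) (L m)) -> is_zseries (fun l => csum (fun m => u m l) n) (csum L n).
Proof.
  intros H. induction n.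
  - rewrite csum_O. eapply zseries_ext; [|apply H]. intros; symmetry; apply csum_O.
  - rewrite csum_S. eapply zseries_ext; [|apply zseries_plus; [exact IHn|apply H]]. intros; symmetry; apply csum_S.
Qed.

(** The factor [1 - e^(2is)] replaces the coefficients of the base series by their
    first differences, and [conv] sums shifted copies of these; the result is the
    sum of partial fractions that [rf_coef] evaluates. *)
Lemma rf_zseries a n s : noninteger a -> 0 < s < PI ->
  is_zseries (rf_term a (Z.of_nat (S n)) s)
    (4 * (1 - cis (2 * s)) * conv (1 + a) (1 - a) (cis (2 * s)) n *
     (- (PI / (2 * cos (a * (PI / 2))))%R * cis (- (a * (PI / 2))) * cis (a * s) * sin s))%C.
Proof.
  intros Ha Hs. assert (B := base_series a s Ha Hs).
  set (L := (- (PI / (2 * cos (a * (PI / 2))))%R * cis (- (a * (PI / 2))) * cis (a * s) * sin s)%C) in *.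
  set (q := cis (2 * s)).
  assert (Z1 := zseries_csum
    (fun m l => (4 * (mchoose (1 + a) m * mchoose (1 - a) (n - m))%R) * (cis (2 * IZR l * s) * fcoef a (l - Z.of_nat m)%Z
       + - (1) * (cis (2 * IZR l * s) * fcoef a (l - Z.of_nat (S m))%Z)))%C
    (fun m => (4 * (mchoose (1 + a) m * mchoose (1 - a) (n - m))%R) * (Cpow q m * L + - (1) * (Cpow q (S m) * L)))%C n).
  assert (Z2 : is_zseries (fun l => csum (fun m => (4 * (mchoose (1 + a) m * mchoose (1 - a) (n - m))%R) * (cis (2 * IZR l * s) * fcoef a (l - Z.of_nat m)%Z
       + - (1) * (cis (2 * IZR l * s) * fcoef a (l - Z.of_nat (S m))%Z)))%C n)
     (csum (fun m => (4 * (mchoose (1 + a) m * mchoose (1 - a) (n - m))%R) * (Cpow q m * L + - (1) * (Cpow q (S m) * L)))%C n)).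
  { apply Z1. intros m. apply zseries_cmult, zseries_plus; [|apply zseries_cmult];
    apply (zseries_qpow (fun l => RtoC (fcoef a l))); exact B. }
  clear Z1.
  replace (4 * (1 - q) * conv (1 + a) (1 - a) q n * L)%C with
    (csum (fun m => (4 * (mchoose (1 + a) m * mchoose (1 - a) (n - m))%R) * (Cpow q m * L + - (1) * (Cpow q (S m) * L)))%C n).
  2:{ unfold conv. rewrite <- (Cmult_comm L), Cmult_assoc, <- csum_mult. apply csum_ext. intros m _.
      rewrite Cpow_S. ring. }
  eapply zseries_ext; [|exact Z2]. intros l. cbv beta.
  unfold rf_term. rewrite <- Cmult_assoc, <- RtoC_mult, rf_coef by trivial.
  unfold psum. rewrite <- rsum_mult, <- csum_RtoC, <- csum_mult. apply csum_ext. intros m _.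
  assert (E := fcoef_diff a l (Z.of_nat m) Ha).
  replace (l - Z.of_nat m - 1)%Z with (l - Z.of_nat (S m))%Z in E by lia. rewrite <- INR_IZR_INZ in E.
  replace (-2 * (mchoose (1 + a) m * mchoose (1 - a) (n - m) * pfrac (IZR l - (1 + a) / 2) (INR m)))
    with (mchoose (1 + a) m * mchoose (1 - a) (n - m) * (-2 * pfrac (IZR l - (1 + a) / 2) (INR m))) by ring.
  rewrite <- E. rewrite !RtoC_mult, RtoC_minus. ring.
Qed.

(** * Order one: principal values *)

(** The principal value at 0, in the form required by the fractional Laplacian. *)
Definition PV (f : R -> C) (v : C) : Prop :=
  exists Im Ip : R -> C,
    (forall eps, 0 < eps ->
       is_cRInt_gen f (Rbar_locally m_infty) (at_point (- eps)) (Im eps) /\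
       is_cRInt_gen f (at_point eps) at_oo (Ip eps)) /\
    filterlim (fun eps => (Im eps + Ip eps)%C) at0
      (locally (T := CR) v).

Lemma PV_cmult c f v : PV f v -> PV (fun y => c * f y)%C (c * v)%C.
Proof.
  intros [Im [Ip [H L]]]. exists (fun e => c * Im e)%C, (fun e => c * Ip e)%C. split.
  - intros e He. destruct (H e He) as [H1 H2].
    split; apply is_cRInt_gen_cmult; trivial; typeclasses eauto.
  - eapply filterlim_ext; [|exact (filterlim_comp _ _ _ _ _ _ _ _ L (continuous_cmult c v))].
    intros e. cbv beta. ring.
Qed.

Lemma PV_plus f g v w : PV f v -> PV g w -> PV (fun y => f y + g y)%C (v + w)%C.
Proof.
  intros [Im [Ip [H L]]] [Jm [Jp [H' L']]]. exists (fun e => Im e + Jm e)%C, (fun e => Ip e + Jp e)%C. split.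
  - intros e He. destruct (H e He) as [H1 H2]. destruct (H' e He) as [H3 H4].
    split; apply is_cRInt_gen_plus; trivial; typeclasses eauto.
  - eapply filterlim_ext; [|exact (filterlim_comp_2 _ _ _ L L' (filterlim_plus (V:=CR) v w))].
    intros e. cbv beta. change (plus ?a ?b) with (Cplus a b). ring.
Qed.

Lemma right_half_filter (P : R -> Prop) e : 0 < e -> (forall y, 0 < y -> P y) ->
  filter_prod (at_point e) at_oo
    (fun ab => forall x, Rmin (fst ab) (snd ab) <= x <= Rmax (fst ab) (snd ab) -> P x).
Proof.
  intros He H. apply (Filter_prod _ _ _ (fun t => t = e) (fun t => e < t)).
  - reflexivity.
  - apply p_infty_gt.
  - intros a b -> Hb x Hx; cbn in Hx, Hb. apply H. rewrite Rmin_left in Hx by lra. lra.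
Qed.

Lemma left_half_filter (P : R -> Prop) e : 0 < e -> (forall y, y < 0 -> P y) ->
  filter_prod (Rbar_locally m_infty) (at_point (- e))
    (fun ab => forall x, Rmin (fst ab) (snd ab) <= x <= Rmax (fst ab) (snd ab) -> P x).
Proof.
  intros He H. apply (Filter_prod _ _ _ (fun t => t < - e) (fun t => t = - e)).
  - exists (- e); trivial.
  - reflexivity.
  - intros a b Ha -> x Hx; cbn in Hx, Ha. apply H. rewrite Rmax_right in Hx by lra. lra.
Qed.

Lemma PV_ext f g v : (forall y, y <> 0 -> f y = g y) -> PV f v -> PV g v.
Proof.
  intros E [Im [Ip [H L]]]. exists Im, Ip. split; [|exact L].
  intros e He. destruct (H e He) as [H1 H2]. split.
  - eapply (is_RInt_gen_ext (V:=CR)); [|exact H1].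
    assert (Hf : forall y, y < 0 -> f y = g y) by (intros; apply E; lra).
    generalize (left_half_filter (fun y => f y = g y) e He Hf). apply filter_imp.
    intros [a b] Hab x Hx. apply Hab. split; apply Rlt_le, Hx.
  - eapply (is_RInt_gen_ext (V:=CR)); [|exact H2].
    assert (Hf : forall y, 0 < y -> f y = g y) by (intros; apply E; lra).
    generalize (right_half_filter (fun y => f y = g y) e He Hf). apply filter_imp.
    intros [a b] Hab x Hx. apply Hab. split; apply Rlt_le, Hx.
Qed.

(** The singular parts of the primitive cancel in [F(-e) - F(e)]. *)
Lemma PV_FTC (F f : R -> C) (Lm Lp d : C) :
  (forall y, y <> 0 -> is_cderive F y (f y) /\ continuous (U:=CR) f y) ->
  filterlim F (Rbar_locally m_infty) (locally (T:=CR) Lm) ->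
  filterlim F at_oo (locally (T:=CR) Lp) ->
  filterlim (fun e : R => F (- e)%R - F e)%C at0 (locally (T:=CR) d) ->
  PV f (d + (Lp - Lm))%C.
Proof.
  intros HF Hm Hp Hd.
  assert (PF : forall a : R, filterlim F (at_point a) (locally (T:=CR) (F a))).
  { intros a P HP. unfold filtermap, at_point. apply (locally_singleton (T:=CR) (F a)). exact HP. }
  exists (fun e => F (- e)%R - Lm)%C, (fun e => Lp - F e)%C. split.
  - intros e He. split.
    + apply (improper_FTC (V:=CRc) F f); try typeclasses eauto; trivial.
      apply (left_half_filter (fun y => is_cderive F y (f y) /\ continuous (U:=CR) f y)); trivial.
      intros; apply HF; lra.
    + apply (improper_FTC (V:=CRc) F f); try typeclasses eauto; trivial.
      apply (right_half_filter (fun y => is_cderive F y (f y) /\ continuous (U:=CR) f y)); trivial.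
      intros; apply HF; lra.
  - eapply filterlim_ext; [|exact (filterlim_comp_2 _ _ _ Hd (filterlim_const (T:=R) (F:=at_right 0) ((Lp - Lm)%C : CR)) (filterlim_plus (V:=CR) d (Lp - Lm)%C))].
    intros e. cbv beta. change (plus ?a ?b) with (Cplus a b). ring.
Qed.

Lemma inf_lim_0 (f : R -> C) (x c : R) :
  (forall y, 1 < Rabs (x + y) -> Cmod (f y) <= c / Rabs (x + y)) ->
  filterlim f (Rbar_locally m_infty) (locally (T:=CR) (RtoC 0)) /\
  filterlim f at_oo (locally (T:=CR) (RtoC 0)).
Proof.
  intros H.
  assert (G : filterlim (fun y => c / y) at_oo (locally 0)).
  { intros P [eps HP]. exists (Rmax 1 (Rabs c / eps)). intros t Ht. apply HP.
    assert (1 < t) by (eapply Rle_lt_trans; [apply Rmax_l|exact Ht]).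
    assert (Hc : Rabs c / eps < t) by (eapply Rle_lt_trans; [apply Rmax_r|exact Ht]).
    assert (He := cond_pos eps).
    unfold ball; cbn; unfold AbsRing_ball, abs, minus, plus, opp; cbn. rewrite Ropp_0, Rplus_0_r.
    unfold Rdiv. rewrite Rabs_mult, Rabs_inv, (Rabs_pos_eq t) by lra. apply Rlt_div_l; [lra|].
    apply Rlt_div_l in Hc; nra. }
  split.
  - apply (clim_0 _ (fun y => c / (- x - y))); try typeclasses eauto.
    + exists (- x - 1). intros y Hy.
      assert (E : Rabs (x + y) = - x - y) by (rewrite Rabs_left1; lra).
      rewrite <- E. apply H. rewrite E. lra.
    + apply (filterlim_comp _ _ _ (fun y => - x - y) (fun y => c / y) _ at_oo); [|exact G].
      intros P [M HP]. exists (- x - M). intros y Hy. apply HP. lra.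
  - apply (clim_0 _ (fun y => c / (x + y))); try typeclasses eauto.
    + exists (1 - x). intros y Hy.
      assert (E : Rabs (x + y) = x + y) by (rewrite Rabs_pos_eq; lra).
      rewrite <- E. apply H. rewrite E. lra.
    + apply (filterlim_comp _ _ _ (fun y => x + y) (fun y => c / y) _ at_oo); [|exact G].
      intros P [M HP]. exists (M - x). intros y Hy. apply HP. lra.
Qed.

Definition vp (x : R) (j : nat) (y : R) : C := Cpow (/ wx (x + y)) j.

Lemma is_cderive_vp x j y : is_cderive (vp x j) y (- (Ci * INR j * vp x (S j) y))%C.
Proof.
  unfold vp. eapply is_cderive_val.
  - apply (is_cderive_ipow (fun y => wx (x + y)) y Ci j); [apply wx_neq0|].
    apply (is_cderive_ext (fun y => wx x + Ci * y)%C).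
    { intros t. unfold wx. rewrite RtoC_plus. ring. }
    eapply is_cderive_val; [apply is_cderive_plus; [apply is_cderive_const|apply is_cderive_scal, is_cderive_RtoC, (is_derive_id (K:=R_AbsRing))]|].
    change one with 1. ring.
  - ring.
Qed.

Lemma vp_0 x j : vp x j 0 = Cpow (/ wx x) j.
Proof. unfold vp. rewrite Rplus_0_r. reflexivity. Qed.

Lemma vp_S x j y : vp x (S j) y = (/ wx (x + y) * vp x j y)%C.
Proof. reflexivity. Qed.

Lemma vp_continuous x j y : continuous (U:=CR) (vp x j) y.
Proof. eapply is_cderive_continuous, is_cderive_vp. Qed.

Lemma wx_Cmod_ge x : 1 <= Cmod (wx x) /\ Rabs x <= Cmod (wx x).
Proof.
  assert (B := Rmax_Cmod (wx x)).
  assert (E1 : fst (wx x) = 1) by (unfold wx; cbn; ring). assert (E2 : snd (wx x) = x) by (unfold wx; cbn; ring).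
  rewrite E1, E2, Rabs_R1 in B. split; eapply Rle_trans; [apply Rmax_l|exact B|apply Rmax_r|exact B].
Qed.

Lemma vp_lim x j : filterlim (vp x (S j)) (Rbar_locally m_infty) (locally (T:=CR) (RtoC 0)) /\
  filterlim (vp x (S j)) at_oo (locally (T:=CR) (RtoC 0)).
Proof.
  apply (inf_lim_0 _ x 1). intros y Hy. destruct (wx_Cmod_ge (x + y)) as [B1 B2].
  rewrite vp_S, Cmod_mult. unfold vp. rewrite Cmod_pow, Cmod_inv by apply wx_neq0.
  assert (H1 : 0 < / Cmod (wx (x + y)) <= 1).
  { split; [apply Rinv_0_lt_compat; lra|]. rewrite <- Rinv_1. apply Rinv_le_contravar; lra. }
  assert (H2 := pow_le1 (/ Cmod (wx (x + y))) j ltac:(lra)).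
  assert (H3 : / Cmod (wx (x + y)) <= / Rabs (x + y)) by (apply Rinv_le_contravar; lra).
  unfold Rdiv. rewrite Rmult_1_l. eapply Rle_trans; [|exact H3].
  apply Rle_trans with (/ Cmod (wx (x + y)) * 1); [apply Rmult_le_compat_l; lra|lra].
Qed.

Lemma opp_at_right (F : R -> C) : continuous (U:=CR) F 0 ->
  filterlim (fun e : R => F (- e)%R - F e)%C at0 (locally (T:=CR) (RtoC 0)).
Proof.
  intros H. replace (RtoC 0) with (F (- 0)%R - F 0)%C by (rewrite Ropp_0; ring).
  apply (continuous_at_right (V:=CR) (fun e : R => F (- e)%R - F e)%C).
  apply (continuous_minus (V:=CR) (fun e => F (- e)) F); [|exact H].
  apply (continuous_comp (W:=CR) Ropp F).
  - apply (continuous_opp (V:=RN)). apply continuous_id.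
  - rewrite Ropp_0. exact H.
Qed.

Lemma PV_vp x j : PV (vp x (S (S j))) 0.
Proof.
  assert (N : RtoC (INR (S j)) <> 0%C) by (apply RtoC_neq0, not_0_INR; lia).
  destruct (vp_lim x j) as [L1 L2].
  assert (H : PV (fun y => - (Ci * INR (S j) * vp x (S (S j)) y))%C (0 + (0 - 0))%C).
  { apply (PV_FTC (vp x (S j))); trivial.
    - intros y _. split; [apply is_cderive_vp|].
      eapply is_cderive_continuous. apply (is_cderive_ext (fun y => (- (Ci * INR (S j))) * vp x (S (S j)) y)%C); [intros; ring|].
      apply is_cderive_scal, is_cderive_vp.
    - apply opp_at_right, vp_continuous. }
  apply (PV_cmult (Ci / INR (S j))%C) in H.
  replace (Ci / INR (S j) * (0 + (0 - 0)))%C with (RtoC 0) in H by ring.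
  eapply PV_ext; [|exact H]. intros y _. cbv beta.
  transitivity (- (Ci * Ci) * vp x (S (S j)) y)%C; [field; exact N|]. rewrite Ci_sqr. ring.
Qed.

Lemma filterlim_RtoC_pair (L T : R -> R) (F : (R -> Prop) -> Prop) (FF : Filter F) (l t : R) :
  filterlim L F (locally l) -> filterlim T F (locally t) ->
  filterlim (fun y => RtoC (L y) - Ci * RtoC (T y))%C F (locally (T:=CR) (RtoC l - Ci * RtoC t)%C).
Proof.
  intros HL HT.
  replace (RtoC l - Ci * RtoC t)%C with ((l, - t) : C) by (C_parts; ring).
  apply (filterlim_locally (U:=CR)). intros eps.
  generalize (filter_and (fun y => ball l eps (L y)) (fun y => ball t eps (T y)) (HL _ (locally_ball l eps)) (HT _ (locally_ball t eps))).
  apply filter_imp. intros y [H1 H2].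
  replace (RtoC (L y) - Ci * RtoC (T y))%C with ((L y, - T y) : C) by (C_parts; ring).
  split; [exact H1|].
  unfold ball in *; cbn in *; unfold AbsRing_ball, abs, minus, plus, opp in *; cbn in *.
  rewrite <- Rabs_Ropp. replace (- (- T y + - - t)) with (T y + - t) by ring. exact H2.
Qed.

Lemma Rinv_inf : filterlim Rinv at_oo (locally 0) /\ filterlim Rinv (Rbar_locally m_infty) (locally 0).
Proof.
  split.
  - exact (is_lim_inv (fun y => y) p_infty p_infty (is_lim_id p_infty) ltac:(discriminate)).
  - exact (is_lim_inv (fun y => y) m_infty m_infty (is_lim_id m_infty) ltac:(discriminate)).
Qed.

Definition logpart (x y : R) : R := ln (Rabs y) - / 2 * ln (1 + (x + y) ^ 2).

Lemma logpart_inv x y : y <> 0 -> logpart x y = - / 2 * ln ((1 + x ^ 2) * (/ y) ^ 2 + 2 * x * / y + 1).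
Proof.
  intros Hy. unfold logpart.
  assert (Hy2 : 0 < y ^ 2) by (apply pow2_gt_0; trivial).
  replace ((1 + x ^ 2) * (/ y) ^ 2 + 2 * x * / y + 1) with ((1 + (x + y) ^ 2) * / y ^ 2) by (field; trivial).
  assert (H1 : 0 < 1 + (x + y) ^ 2) by (generalize (pow2_ge_0 (x + y)); lra).
  rewrite ln_mult, ln_Rinv by (trivial; apply Rinv_0_lt_compat; trivial).
  replace (y ^ 2) with (Rabs y * Rabs y) by (rewrite <- Rabs_mult, Rabs_pos_eq; cbn; nra).
  assert (0 < Rabs y) by (apply Rabs_pos_lt; trivial).
  rewrite ln_mult by trivial. field.
Qed.

Lemma logpart_lim x : filterlim (logpart x) at_oo (locally 0) /\
  filterlim (logpart x) (Rbar_locally m_infty) (locally 0).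
Proof.
  set (h := fun t => - / 2 * ln ((1 + x ^ 2) * t ^ 2 + 2 * x * t + 1)).
  assert (Ch : filterlim h (locally 0) (locally 0)).
  { assert (E : h 0 = 0) by (unfold h; replace ((1 + x ^ 2) * 0 ^ 2 + 2 * x * 0 + 1) with 1 by ring; rewrite ln_1; ring).
    rewrite <- E at 2. change (continuous h 0). unfold h.
    smooth. lra. }
  destruct Rinv_inf as [I1 I2]. split.
  - eapply filterlim_ext_loc; [|exact (filterlim_comp _ _ _ _ _ _ _ _ I1 Ch)].
    exists 0. intros y Hy. symmetry. apply logpart_inv. lra.
  - eapply filterlim_ext_loc; [|exact (filterlim_comp _ _ _ _ _ _ _ _ I2 Ch)].
    exists 0. intros y Hy. symmetry. apply logpart_inv. lra.
Qed.

Lemma atan_lim x : filterlim (fun y => atan (x + y)) at_oo (locally (PI / 2)) /\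
  filterlim (fun y => atan (x + y)) (Rbar_locally m_infty) (locally (- (PI / 2))).
Proof.
  assert (Ca : forall c, filterlim (fun t => c - atan t) (locally 0) (locally c)).
  { intros c. assert (E : c - atan 0 = c) by (rewrite atan_0; ring).
    cut (continuous (fun t => c - atan t) 0); [unfold continuous; rewrite E; trivial|].
    smooth. trivial. }
  destruct Rinv_inf as [I1 I2]. split.
  - assert (S1 : filterlim (fun y => x + y) at_oo at_oo).
    { intros P [M HP]. exists (M - x). intros y Hy. apply HP. lra. }
    eapply filterlim_ext_loc; [|exact (filterlim_comp _ _ _ _ _ _ _ _ (filterlim_comp _ _ _ _ _ _ _ _ S1 I1) (Ca (PI / 2)))].
    exists (- x). intros y Hy. rewrite atan_inv by lra. ring.
  - assert (S1 : filterlim (fun y => x + y) (Rbar_locally m_infty) (Rbar_locally m_infty)).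
    { intros P [M HP]. exists (M - x). intros y Hy. apply HP. lra. }
    eapply filterlim_ext_loc; [|exact (filterlim_comp _ _ _ _ _ _ _ _ (filterlim_comp _ _ _ _ _ _ _ _ S1 I2) (Ca (- (PI / 2))))].
    exists (- x). intros y Hy.
    assert (E := atan_inv (- (x + y)) ltac:(lra)). rewrite Rinv_opp, !atan_opp in E. lra.
Qed.

(** These quotients are what remains of the difference quotient after one factor
    [1/y] has been divided out; see [PV_f]. *)
Definition gq (x : R) (j : nat) (y : R) : C := (vp x j y / y)%C.

(** Partial fractions: the primitive is [(ln |y| - ln(1 + (x+y)^2)/2 - i atan(x+y))
    / wx x]. The logarithm of [|y|] is even, so only the arctangent contributes. *)
Lemma PV_g1 x : PV (gq x 1) (- (Ci * PI) * / wx x)%C.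
Proof.
  destruct (logpart_lim x) as [L1 L2]. destruct (atan_lim x) as [A1 A2].
  set (F := fun y => (RtoC (logpart x y) - Ci * RtoC (atan (x + y)))%C).
  assert (H : PV (fun y => wx x * gq x 1 y)%C (RtoC 0 + ((RtoC 0 - Ci * (PI / 2)%R) - (RtoC 0 - Ci * (- (PI / 2))%R)))%C).
  { apply (PV_FTC F).
    - intros y Hy.
      assert (Cy := RtoC_neq0 _ Hy). assert (Nw := wx_neq0 (x + y)).
      split.
      + assert (Dl : is_derive (logpart x) y (/ y - (x + y) / (1 + (x + y) ^ 2))).
        { assert (P2 : 0 < 1 + (x + y) ^ 2) by (generalize (pow2_ge_0 (x + y)); lra).
          apply (is_derive_ext_loc (fun y0 => / 2 * ln (y0 ^ 2) - / 2 * ln (1 + (x + y0) ^ 2))).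
          - assert (Hl : locally y (fun t => t <> 0)).
            { assert (Hp : 0 < Rabs y) by (apply Rabs_pos_lt; trivial).
              exists (mkposreal _ Hp). intros t Ht ->. unfold ball in Ht; cbn in Ht.
              unfold AbsRing_ball, abs, minus, plus, opp in Ht; cbn in Ht.
              rewrite Rplus_0_l, Rabs_Ropp in Ht. lra. }
            revert Hl. apply filter_imp. intros t Ht. unfold logpart. f_equal.
            replace (t ^ 2) with (Rabs t * Rabs t) by (rewrite <- Rabs_mult, Rabs_pos_eq; cbn; nra).
            assert (0 < Rabs t) by (apply Rabs_pos_lt; trivial).
            rewrite ln_mult by trivial. field.
          - auto_derive; [split; [|split; trivial]|].
            + generalize (pow2_gt_0 y Hy); cbn; lra.
            + field. split; [lra|trivial]. }
        assert (Da : is_derive (fun y => atan (x + y)) y (/ (1 + (x + y) ^ 2))).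
        { auto_derive; trivial. unfold Rsqr. field. generalize (pow2_ge_0 (x + y)); cbn; lra. }
        eapply is_cderive_val.
        * apply is_cderive_minus; [apply is_cderive_RtoC, Dl|apply is_cderive_scal, is_cderive_RtoC, Da].
        * unfold gq. rewrite vp_S. unfold vp. cbn [Cpow].
          assert (E : (/ wx (x + y) = (1 - Ci * (x + y)%R) * / (1 + (x + y) ^ 2)%R)%C).
          { assert (P2 : RtoC (1 + (x + y) ^ 2) <> 0%C) by (apply RtoC_neq0; generalize (pow2_ge_0 (x + y)); lra).
            assert (E : (wx (x + y) * (1 - Ci * (x + y)%R) = (1 + (x + y) ^ 2)%R)%C).
            { unfold wx, Ci. C_parts; ring. }
            rewrite <- E in P2 |- *. field. split; trivial.
            intros E2. apply P2. rewrite E2. ring. }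
          rewrite E.
          assert (P2 : 1 + (x + y) ^ 2 <> 0) by (generalize (pow2_ge_0 (x + y)); lra).
          rewrite <- RtoC_inv by trivial. unfold Cdiv. rewrite <- RtoC_inv by trivial.
          unfold wx, Ci. C_parts; field; cbn in P2; repeat split; trivial; intros E'; apply P2; lra.
      + eapply is_cderive_continuous. apply is_cderive_scal. unfold gq, Cdiv.
        apply is_cderive_mult; [apply is_cderive_vp|]. apply is_cderive_inv; [exact Cy|].
        apply is_cderive_RtoC, (is_derive_id (K:=R_AbsRing)).
    - apply filterlim_RtoC_pair; trivial; typeclasses eauto.
    - apply filterlim_RtoC_pair; trivial; typeclasses eauto.
    - set (G := fun y => (RtoC (- / 2 * ln (1 + (x + y) ^ 2)) - Ci * RtoC (atan (x + y)))%C).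
      apply (filterlim_ext (fun e : R => G (- e)%R - G e)%C).
      { intros e. unfold F, G, logpart. rewrite Rabs_Ropp. unfold Rminus. rewrite !RtoC_plus, !RtoC_opp.
        replace (- / 2 * ln (1 + (x + - e) ^ 2)) with (- (/ 2 * ln (1 + (x + - e) ^ 2))) by ring.
        replace (- / 2 * ln (1 + (x + e) ^ 2)) with (- (/ 2 * ln (1 + (x + e) ^ 2))) by ring.
        rewrite !RtoC_opp. ring. }
      apply opp_at_right. unfold G. eapply is_cderive_continuous.
      apply is_cderive_minus; [|apply is_cderive_scal]; apply is_cderive_RtoC.
      + apply Derive_correct. auto_derive. generalize (pow2_ge_0 (x + 0)); cbn; lra.
      + apply Derive_correct. auto_derive. trivial. }
  apply (PV_cmult (/ wx x)%C) in H.
  replace (- (Ci * PI) * / wx x)%C with (/ wx x * (0 + ((0 - Ci * (PI / 2)%R) - (0 - Ci * (- (PI / 2))%R))))%C.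
  2:{ rewrite RtoC_opp, RtoC_div by lra. field. apply wx_neq0. }
  eapply PV_ext; [|exact H]. intros y Hy. cbv beta. field. apply wx_neq0.
Qed.

Lemma wx_split x y : wx (x + y) = (wx x + Ci * y)%C.
Proof. unfold wx. rewrite RtoC_plus. ring. Qed.

(** [1/(y v) = (1/y - i/v) / w] for [v = w + i y], applied once per power of [1/v]. *)
Lemma PV_g x j : PV (gq x (S j)) (- (Ci * PI) * Cpow (/ wx x) (S j))%C.
Proof.
  induction j; [cbn [Cpow]; rewrite Cmult_1_r; apply PV_g1|].
  assert (H := PV_cmult (/ wx x)%C _ _ (PV_plus _ _ _ _ IHj (PV_cmult (- Ci)%C _ _ (PV_vp x j)))).
  replace (- (Ci * PI) * Cpow (/ wx x) (S (S j)))%C with (/ wx x * (- (Ci * PI) * Cpow (/ wx x) (S j) + - Ci * 0))%C.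
  2:{ rewrite (Cpow_S _ (S j)). ring. }
  eapply PV_ext; [|exact H]. intros y Hy. cbv beta.
  assert (Cy := RtoC_neq0 _ Hy). assert (Nw := wx_neq0 x). assert (Nv := wx_neq0 (x + y)).
  unfold gq. rewrite (vp_S x (S j)). rewrite wx_split in *. field. auto.
Qed.

Definition fq (x : R) (j : nat) (y : R) : C := ((vp x j 0 - vp x j y) / RtoC (y ^ 2))%C.

(** [w^(-j-1) - v^(-j-1) = (w^(-j) - v^(-j))/w + i y v^(-j-1)/w] for [v = w + i y]. *)
Lemma PV_f x j : PV (fq x j) (INR j * PI * Cpow (/ wx x) (S j))%C.
Proof.
  induction j.
  - assert (H := PV_cmult 0%C _ _ (PV_vp x 0)).
    replace (INR 0 * PI * Cpow (/ wx x) 1)%C with (0 * 0)%C by (cbn; ring).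
    eapply PV_ext; [|exact H]. intros y Hy. unfold fq, vp. cbn [Cpow]. unfold Cdiv. ring.
  - assert (H := PV_cmult (/ wx x)%C _ _ (PV_plus _ _ _ _ IHj (PV_cmult Ci _ _ (PV_g x j)))).
    replace (INR (S j) * PI * Cpow (/ wx x) (S (S j)))%C with (/ wx x * (INR j * PI * Cpow (/ wx x) (S j) + Ci * (- (Ci * PI) * Cpow (/ wx x) (S j))))%C.
    2:{ rewrite (Cpow_S _ (S j)), S_INR, RtoC_plus.
        transitivity (/ wx x * ((INR j - Ci * Ci) * PI * Cpow (/ wx x) (S j)))%C; [ring|]. rewrite Ci_sqr. ring. }
    eapply PV_ext; [|exact H]. intros y Hy. cbv beta.
    assert (Cy := RtoC_neq0 _ Hy). assert (Nw := wx_neq0 x). assert (Nv := wx_neq0 (x + y)).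
    unfold fq, gq. rewrite !vp_S, Rplus_0_r. rewrite wx_split in *. rewrite RtoC_pow. cbn [Cpow]. field. auto.
Qed.

Definition dhig (x : R) (k j : nat) : C := pascal (fun j => - (Ci * INR j * Cpow (/ wx x) (S j)))%C k j.

(** The fractional Laplacian of order one acts on this family as [i d/dx]. *)
Lemma PV_hig x k j : PV (fun y => (hig k j x - hig k j (x + y)%R) / RtoC (y ^ 2))%C (Ci * PI * dhig x k j)%C.
Proof.
  revert j. induction k; intros j.
  - unfold dhig. cbn [pascal].
    replace (Ci * PI * - (Ci * INR j * Cpow (/ wx x) (S j)))%C with (INR j * PI * Cpow (/ wx x) (S j))%C.
    2:{ transitivity (- (Ci * Ci) * (INR j * PI * Cpow (/ wx x) (S j)))%C; [rewrite Ci_sqr; ring|ring]. }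
    eapply PV_ext; [|apply PV_f]. intros y _. unfold fq. rewrite vp_0. unfold vp, hig. cbn [Cpow]. unfold Cdiv. ring.
  - assert (H := PV_plus _ _ _ _ (IHk j) (PV_cmult (- (2))%C _ _ (IHk (S j)))).
    replace (Ci * PI * dhig x (S k) j)%C with (Ci * PI * dhig x k j + - (2) * (Ci * PI * dhig x k (S j)))%C by (unfold dhig; cbn [pascal]; ring).
    eapply PV_ext; [|exact H]. intros y _. cbv beta. rewrite !hig_pascal. unfold Cdiv. ring.
Qed.

Lemma is_cderive_dhig x k j : is_cderive (hig k j) x (dhig x k j).
Proof.
  revert j. induction k; intros j.
  - unfold dhig. cbn [pascal]. apply (is_cderive_ext (fun t => Cpow (/ wx t) j)); [intros; unfold hig; cbn [Cpow]; ring|].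
    eapply is_cderive_val; [apply (is_cderive_ipow wx); [apply wx_neq0|apply is_cderive_wx]|]. ring.
  - apply (is_cderive_ext (fun t => hig k j t - 2 * hig k (S j) t)%C); [intros; symmetry; apply hig_pascal|].
    apply is_cderive_minus; [apply IHk|apply is_cderive_scal, IHk].
Qed.

Lemma is_cderive_unique u x a b : is_cderive u x a -> is_cderive u x b -> a = b.
Proof.
  rewrite !is_cderive_comp. intros [A1 A2] [B1 B2]. apply injective_projections.
  - change (Re a = Re b). rewrite <- (is_derive_unique _ _ _ A1). apply is_derive_unique, B1.
  - change (Im a = Im b). rewrite <- (is_derive_unique _ _ _ A2). apply is_derive_unique, B2.
Qed.

Lemma cis_pow t n : Cpow (cis t) n = cis (INR n * t).
Proof.
  induction n; [cbn; rewrite Rmult_0_l, cis_0; reflexivity|].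
  rewrite Cpow_S, IHn, S_INR, <- cis_add. f_equal. ring.
Qed.

Lemma dhig_cot k s : 0 < sin s ->
  dhig (cot s) k 0 = (- (2) * Ci * INR k * (sin s ^ 2)%R * cis (2 * INR k * s))%C.
Proof.
  intros Hs. assert (H := is_cderive_dhig (cot s) k 0). destruct k.
  - cbn. ring.
  - rewrite (is_cderive_unique _ _ _ _ H (is_cderive_hig k (cot s))).
    unfold hig. rewrite q_cot, wx_cot, cis_pow by trivial. rewrite RtoC_pow. cbn [Cpow].
    replace (2 * INR (S k) * s) with (INR k * (2 * s) + (s + s)) by (rewrite S_INR; ring). rewrite !cis_add.
    transitivity (2 * Ci * INR (S k) * (Ci * Ci) * (sin s * sin s) * (cis (INR k * (2 * s)) * (cis s * cis s)))%C; [ring|].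
    rewrite Ci_sqr. ring.
Qed.

Lemma riesz_feller_1_higgins gamma k s : 0 < s < PI ->
  is_riesz_feller 1 gamma (higgins (Z.of_nat k)) (cot s)
    (- (2) * cis (gamma * (PI / 2)) * (INR k * sin s ^ 2)%R * cis (2 * INR k * s))%C.
Proof.
  intros Hs. assert (Hp : 0 < sin s) by (apply sin_gt_0; lra). assert (HPI := PI_RGT_0).
  right; right. split; [reflexivity|].
  exists (Ci * dhig (cot s) k 0)%C, (dhig (cot s) k 0). split; [|split].
  - assert (P : PV (fun y => ((higgins (Z.of_nat k) (cot s) - higgins (Z.of_nat k) (cot s + y)%R) / Rpower (Rabs y) (1 + 1))%C)
      (Ci * PI * dhig (cot s) k 0)%C).
    { eapply PV_ext; [|apply PV_hig]. intros y Hy. cbv beta. rewrite !higgins_hig. do 2 f_equal.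
      assert (0 < Rabs y) by (apply Rabs_pos_lt; trivial).
      replace (1 + 1) with (INR 2) by (cbn; ring). rewrite Rpower_pow by trivial. symmetry. apply pow2_abs. }
    destruct P as [Im [Ip [H L]]].
    exists Im, Ip, (Ci * PI * dhig (cot s) k 0)%C. split; [exact H|]. split; [exact L|].
    rewrite frac_lap_const_eq by lra. rewrite Gamma_succ, Gamma_1, !Rmult_1_l, sin_PI2 by lra.
    rewrite RtoC_div by lra. field. apply RtoC_neq0; lra.
  - apply (is_cderive_ext (hig k 0)); [intros; symmetry; apply higgins_hig|]. apply is_cderive_dhig.
  - rewrite dhig_cot by trivial.
    assert (E : cis (gamma * (PI / 2)) = (cos (gamma * (PI / 2)) + Ci * sin (gamma * (PI / 2)))%C).
    { unfold cis, Ci. C_parts; ring. }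
    rewrite E, RtoC_mult.
    set (c := RtoC (cos (gamma * (PI / 2)))). set (sn := RtoC (sin (gamma * (PI / 2)))).
    transitivity ((2 * (Ci * Ci) * c - 2 * Ci * sn) * (INR k * (sin s ^ 2)%R * cis (2 * INR k * s)))%C.
    + rewrite Ci_sqr. ring.
    + ring.
Qed.

(** * Negative indices and the final statement *)

Lemma is_cderive_conj u x l : is_cderive u x l -> is_cderive (fun t => Cconj (u t)) x (Cconj l).
Proof.
  rewrite !is_cderive_comp. intros [H1 H2]. split; [exact H1|].
  apply (is_derive_opp (V:=RN)). exact H2.
Qed.

Lemma Cconj_R (r : R) : Cconj r = r.
Proof. C_parts; ring. Qed.

Lemma Cconj_inv_R (r : R) : Cconj (/ r) = (/ r)%C.
Proof. C_parts; unfold Rdiv; ring. Qed.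

Lemma Cconj_div_Rpower z t b : (Cconj z / Rpower t b = Cconj (z / Rpower t b))%C.
Proof. rewrite Cdiv_conj by apply RtoC_Rpower_neq0. rewrite Cconj_R. reflexivity. Qed.

Lemma caputo_left_conj b u x l : is_caputo_left b u x l ->
  is_caputo_left b (fun t => Cconj (u t)) x (Cconj l).
Proof.
  intros [u' [v [H1 [H2 ->]]]]. exists (fun t => Cconj (u' t)), (Cconj v). split; [|split].
  - intros y. apply is_cderive_conj, H1.
  - eapply is_cRInt_gen_conj; try typeclasses eauto; [|exact H2]. intros t; apply Cconj_div_Rpower.
  - rewrite Cmult_conj, Cconj_inv_R. reflexivity.
Qed.

Lemma caputo_right_conj b u x l : is_caputo_right b u x l ->
  is_caputo_right b (fun t => Cconj (u t)) x (Cconj l).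
Proof.
  intros [u' [v [H1 [H2 ->]]]]. exists (fun t => Cconj (u' t)), (Cconj v). split; [|split].
  - intros y. apply is_cderive_conj, H1.
  - eapply is_cRInt_gen_conj; try typeclasses eauto; [|exact H2]. intros t; apply Cconj_div_Rpower.
  - rewrite Cmult_conj, Cconj_inv_R. reflexivity.
Qed.

Lemma frac_laplacian_conj a u x l : is_frac_laplacian a u x l ->
  is_frac_laplacian a (fun t => Cconj (u t)) x (Cconj l).
Proof.
  intros [Im [Ip [v [H [L ->]]]]]. exists (fun e => Cconj (Im e)), (fun e => Cconj (Ip e)), (Cconj v).
  split; [|split].
  - intros e He. destruct (H e He) as [H1 H2].
    split; (eapply is_cRInt_gen_conj; try typeclasses eauto; [|eassumption]);
    intros t; cbv beta; rewrite <- Cminus_conj; apply Cconj_div_Rpower.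
  - eapply filterlim_ext; [|exact (filterlim_comp _ _ _ _ _ _ _ _ L (continuous_conj v))].
    intros e. apply Cplus_conj.
  - rewrite Cmult_conj, Cconj_R. reflexivity.
Qed.

Lemma riesz_feller_conj a g u x l : is_riesz_feller a g u x l ->
  is_riesz_feller a g (fun t => Cconj (u t)) x (Cconj l).
Proof.
  intros [[Ha [p [q [H1 [H2 ->]]]]]|[[Ha [p [q [[g1 [H1 H1']] [[g2 [H2 H2']] ->]]]]]|[Ha [p [q [H1 [H2 ->]]]]]]].
  - left. split; [exact Ha|]. exists (Cconj p), (Cconj q). split; [|split].
    + apply caputo_left_conj, H1.
    + apply caputo_right_conj, H2.
    + rewrite Cmult_conj, Cminus_conj, !Cmult_conj, !Cconj_R. reflexivity.
  - right; left. split; [exact Ha|]. exists (Cconj p), (Cconj q). split; [|split].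
    + exists (fun t => Cconj (g1 t)). split; [intros y; apply caputo_left_conj, H1|apply is_cderive_conj, H1'].
    + exists (fun t => Cconj (g2 t)). split; [intros y; apply caputo_right_conj, H2|apply is_cderive_conj, H2'].
    + rewrite Cmult_conj, Cplus_conj, !Cmult_conj, !Cconj_R. reflexivity.
  - right; right. split; [exact Ha|]. exists (Cconj p), (Cconj q). split; [|split].
    + apply frac_laplacian_conj, H1.
    + apply is_cderive_conj, H2.
    + rewrite Cplus_conj, !Cmult_conj, Copp_conj, !Cconj_R. reflexivity.
Qed.

(** Higgins functions have modulus one. *)
Lemma higgins_opp n : higgins (- Z.of_nat n) = fun x => Cconj (higgins (Z.of_nat n) x).
Proof.
  apply functional_extensionality. intros x. unfold higgins. rewrite Cpow_Z_of_nat.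
  assert (N1 : (Ci * x + 1)%C <> 0%C) by (intros E; apply (f_equal fst) in E; cbn in E; lra).
  assert (N2 : (Ci * x - 1)%C <> 0%C) by (intros E; apply (f_equal fst) in E; cbn in E; lra).
  set (z := ((Ci * x - 1) / (Ci * x + 1))%C).
  assert (Nz : z <> 0%C).
  { intros E. apply N2. transitivity (z * (Ci * x + 1))%C; [unfold z; field; exact N1|]. rewrite E; ring. }
  assert (Ez : Cconj z = (/ z)%C).
  { unfold z. rewrite Cdiv_conj by exact N1.
    replace (Cconj (Ci * x - 1)) with (- (Ci * x + 1))%C by (C_parts; ring).
    replace (Cconj (Ci * x + 1)) with (- (Ci * x - 1))%C by (C_parts; ring).
    field. auto. }
  rewrite Cpow_conj, Ez, Cpow_inv by exact Nz.
  destruct n; cbn [Z.of_nat Z.opp Cpow_Z]; [cbn; field|]. rewrite SuccNat2Pos.id_succ. reflexivity.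
Qed.

Lemma Cconj_cis t : Cconj (cis t) = cis (- t).
Proof. unfold cis. rewrite cos_neg, sin_neg. reflexivity. Qed.

Lemma csum_conj f n : csum (fun m => Cconj (f m)) n = Cconj (csum f n).
Proof. induction n; [rewrite !csum_O; trivial|]. rewrite !csum_S, IHn, Cplus_conj. reflexivity. Qed.

Lemma cseries_conj a l : is_series (V:=C_NormedModule) a l ->
  is_series (V:=C_NormedModule) (fun n => Cconj (a n)) (Cconj l).
Proof.
  rewrite !is_cseries_eps. intros H eps He. destruct (H eps He) as [N HN].
  exists N. intros n Hn. rewrite csum_conj, <- Cminus_conj, Cmod_conj. apply HN, Hn.
Qed.

(** The reflection moves the term of index 0 from one half of the series to the
    other. *)
Lemma zseries_conj_opp (a : Z -> C) (l : C) : is_zseries a l ->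
  is_zseries (fun m => Cconj (a (- m)%Z)) (Cconj l).
Proof.
  intros [lp [lm [Hp [Hm ->]]]].
  exists (Cconj (lm + a 0%Z)), (Cconj (lp - a 0%Z)). split; [|split].
  - apply (cseries_conj (fun n => a (- Z.of_nat n)%Z)).
    apply (is_series_decr_1 (V:=C_NormedModule)).
    change (is_series (V:=C_NormedModule) (fun n => a (- Z.of_nat (S n))%Z) ((lm + a 0%Z) - a 0%Z)%C).
    replace ((lm + a 0%Z) - a 0%Z)%C with lm by ring. exact Hm.
  - apply (cseries_conj (fun n => a (- - Z.of_nat (S n))%Z)).
    eapply (is_series_ext (V:=C_NormedModule)).
    2:{ apply (is_series_incr_1 (V:=C_NormedModule) (fun n => a (Z.of_nat n))).
        change (is_series (V := C_NormedModule) (fun n => a (Z.of_nat n)) ((lp - a 0%Z) + a 0%Z)%C).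
        replace ((lp - a 0%Z) + a 0%Z)%C with lp by ring. exact Hp. }
    intros n. cbv beta. rewrite Z.opp_involutive; reflexivity.
  - rewrite <- Cplus_conj. f_equal. ring.
Qed.

Lemma rf_term_opp a k s l : rf_term a (- k) s l = Cconj (rf_term a k s (- l)).
Proof.
  unfold rf_term. rewrite !Cmult_conj, !Cconj_R, Cconj_cis.
  replace (Z.abs (- k - l)) with (Z.abs (k - - l)) by lia. rewrite Z.abs_opp, !opp_IZR.
  f_equal. f_equal; f_equal; ring.
Qed.

Definition series_value (alpha gamma : R) (k : Z) (s : R) (S : C) : C :=
  (- (frac_lap_const alpha * cis (IZR (Z.sgn k) * gamma * (PI / 2))
             * Rpower (sin s) (alpha - 1) / (2 * tan (alpha * (PI / 2)))%R)
          * S)%C.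

Definition series_formula (alpha gamma : R) (k : Z) (s : R) : Prop :=
  exists S : C, is_zseries (rf_term alpha k s) S /\
    is_riesz_feller alpha gamma (higgins k) (cot s) (series_value alpha gamma k s S).

Lemma series_formula_pos alpha gamma n s : noninteger alpha -> 0 < s < PI ->
  series_formula alpha gamma (Z.of_nat (S n)) s.
Proof.
  intros Ha Hs. assert (Hp : 0 < sin s) by (apply sin_gt_0; lra). assert (HPI := PI_RGT_0).
  eexists. split; [apply rf_zseries; trivial|].
  assert (H := riesz_feller_higgins alpha gamma n s Ha Hs).
  match goal with |- is_riesz_feller _ _ _ _ ?v => replace v with (rf_val alpha gamma n s); [exact H|] end.
  unfold series_value, rf_val. rewrite frac_lap_const_eq by (destruct Ha; lra).
  replace (IZR (Z.sgn (Z.of_nat (S n))) * gamma * (PI / 2)) with (gamma * (PI / 2)) by (cbn; ring).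
  assert (Hsin : sin (alpha * (PI / 2)) <> 0) by (apply Rgt_not_eq, sin_gt_0; destruct Ha; nra).
  assert (Hcos : cos (alpha * (PI / 2)) <> 0).
  { destruct Ha as [Ha|Ha].
    - apply Rgt_not_eq, cos_gt_0; nra.
    - apply Rlt_not_eq, cos_lt_0; nra. }
  rewrite <- q_cot, wx_cot by trivial.
  replace ((1 + alpha) * s) with (s + alpha * s) by ring. rewrite cis_add.
  replace (Rpower (sin s) (1 + alpha)) with (sin s * sin s * Rpower (sin s) (alpha - 1)).
  2:{ replace (1 + alpha) with (1 + (1 + (alpha - 1))) by ring. rewrite !Rpower_plus, Rpower_1 by trivial. ring. }
  set (cv := conv _ _ _ _). set (cg := cis (gamma * (PI / 2))). set (ca := cis (- (alpha * (PI / 2)))).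
  set (r := Rpower (sin s) (alpha - 1)).
  assert (E : Gamma (1 + alpha) * sin (alpha * (PI / 2)) / PI / (2 * tan (alpha * (PI / 2))) * (PI / (2 * cos (alpha * (PI / 2)))) = Gamma (1 + alpha) / 4).
  { unfold tan. field. repeat split; trivial; lra. }
  assert (Ht : 2 * tan (alpha * (PI / 2)) <> 0).
  { unfold tan. apply Rmult_integral_contrapositive_currified; [lra|].
    apply Rmult_integral_contrapositive_currified; [trivial|]. apply Rinv_neq_0_compat; trivial. }
  assert (E' : (RtoC (Gamma (1 + alpha)) = 4 * (RtoC (Gamma (1 + alpha) * sin (alpha * (PI / 2)) / PI) * / (2 * tan (alpha * (PI / 2)))%R * (PI / (2 * cos (alpha * (PI / 2))))%R))%C).
  { rewrite <- RtoC_inv by exact Ht. rewrite <- !RtoC_mult.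
    change (Gamma (1 + alpha) * sin (alpha * (PI / 2)) / PI * / (2 * tan (alpha * (PI / 2))))
     with (Gamma (1 + alpha) * sin (alpha * (PI / 2)) / PI / (2 * tan (alpha * (PI / 2)))).
    rewrite E. f_equal. field. }
  rewrite E'. rewrite !RtoC_mult. unfold Cdiv.
  ring.
Qed.

Lemma caputo_const (sg b x : R) : 0 < b < 1 -> sg = 1 \/ sg = -1 ->
  is_cint (fun z => 0 / Rpower z b)%C 0%C.
Proof.
  intros Hb Hsg. assert (H := cint_cmult 0%C _ _ (caputo_cint sg b 0 x Hsg Hb)).
  rewrite Cmult_0_l in H. eapply cint_ext; [|exact H]. intros t _. cbv beta. unfold Cdiv. ring.
Qed.

Lemma is_cderive_higgins_0 y : is_cderive (higgins 0) y 0%C.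
Proof. apply is_cderive_const. Qed.

Lemma riesz_feller_const alpha gamma x : noninteger alpha -> is_riesz_feller alpha gamma (higgins 0) x 0%C.
Proof.
  intros Ha.
  assert (CL : forall b y, 0 < b < 1 -> is_caputo_left b (higgins 0) y 0%C).
  { intros b y Hb. exists (fun _ => 0%C), 0%C. split; [apply is_cderive_higgins_0|].
    split; [apply (caputo_const 1 b 0 Hb); auto|ring]. }
  assert (CR : forall b y, 0 < b < 1 -> is_caputo_right b (higgins 0) y 0%C).
  { intros b y Hb. exists (fun _ => 0%C), 0%C. split; [apply is_cderive_higgins_0|].
    split; [apply (caputo_const 1 b 0 Hb); auto|ring]. }
  destruct Ha as [Ha|Ha].
  - left. split; [exact Ha|]. exists 0%C, 0%C. split; [auto|]. split; [auto|ring].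
  - right; left. split; [exact Ha|]. exists 0%C, 0%C.
    split; [|split; [|ring]]; exists (fun _ => 0%C); (split; [|apply is_cderive_const]); intros y;
    [apply CL|apply CR]; lra.
Qed.

Lemma series_formula_0 alpha gamma s : noninteger alpha -> 0 < s < PI -> series_formula alpha gamma 0 s.
Proof.
  intros Ha Hs. exists 0%C. split.
  - assert (H := zseries_cmult 0%C _ _ (rf_zseries alpha 0 s Ha Hs)). rewrite Cmult_0_l in H.
    eapply zseries_ext; [|exact H]. intros l. cbv beta. unfold rf_term.
    replace ((1 - alpha) * 0 ^ 2 - 2 * 0 * IZR l) with 0 by ring. ring.
  - unfold series_value. rewrite Cmult_0_r. apply riesz_feller_const, Ha.
Qed.

Lemma series_formula_opp alpha gamma n s : series_formula alpha gamma (Z.of_nat n) s -> series_formula alpha gamma (- Z.of_nat n) s.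
Proof.
  intros [S [HS HR]]. exists (Cconj S). split.
  - eapply zseries_ext; [|apply zseries_conj_opp, HS]. intros l. symmetry. apply rf_term_opp.
  - apply riesz_feller_conj in HR. rewrite <- higgins_opp in HR.
    replace (series_value alpha gamma (- Z.of_nat n) s (Cconj S)) with (Cconj (series_value alpha gamma (Z.of_nat n) s S)); [exact HR|].
    unfold series_value, Cdiv. rewrite !Cmult_conj, Copp_conj, !Cmult_conj, Cconj_inv_R, !Cconj_R, Cconj_cis.
    rewrite Z.sgn_opp, opp_IZR.
    replace (- (IZR (Z.sgn (Z.of_nat n)) * gamma * (PI / 2))) with (- IZR (Z.sgn (Z.of_nat n)) * gamma * (PI / 2)) by ring.
    reflexivity.
Qed.

Lemma Z_nat_cases (P : Z -> Prop) : (forall n, P (Z.of_nat n)) -> (forall n, P (- Z.of_nat n)%Z) -> forall k, P k.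
Proof.
  intros H1 H2 k. destruct (Z_le_dec 0 k).
  - rewrite <- (Z2Nat.id k) by lia. apply H1.
  - replace k with (- Z.of_nat (Z.to_nat (- k)))%Z by lia. apply H2.
Qed.

Lemma series_formula_all alpha gamma k s : noninteger alpha -> 0 < s < PI -> series_formula alpha gamma k s.
Proof.
  intros Ha Hs.
  assert (H : forall n, series_formula alpha gamma (Z.of_nat n) s).
  { intros [|n]; [apply series_formula_0|apply series_formula_pos]; trivial. }
  apply (Z_nat_cases (fun k => series_formula alpha gamma k s)); trivial. intros n. apply series_formula_opp, H.
Qed.

Lemma order_one_nat gamma n s : 0 < s < PI ->
  is_riesz_feller 1 gamma (higgins (Z.of_nat n)) (cot s)
       (- (2) * cis (IZR (Z.sgn (Z.of_nat n)) * gamma * (PI / 2))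
        * (IZR (Z.abs (Z.of_nat n)) * sin s ^ 2)%R * cis (2 * IZR (Z.of_nat n) * s))%C.
Proof.
  intros Hs. assert (H := riesz_feller_1_higgins gamma n s Hs).
  rewrite Z.abs_eq, <- INR_IZR_INZ by lia. destruct n.
  - replace (INR 0 * sin s ^ 2) with 0 in * by (cbn; ring).
    match goal with |- is_riesz_feller _ _ _ _ ?v => replace v with (- (2) * cis (gamma * (PI / 2)) * 0 * cis (2 * INR 0 * s))%C by ring end.
    exact H.
  - replace (IZR (Z.sgn (Z.of_nat (S n))) * gamma * (PI / 2)) with (gamma * (PI / 2)) by (cbn; ring). exact H.
Qed.

Theorem corollary3p1 :
  (forall (alpha gamma : R) (k : Z) (s : R),
     (0 < alpha < 1 \/ 1 < alpha < 2) ->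
     Rabs gamma <= Rmin alpha (2 - alpha) ->
     0 < s < PI ->
     exists S : C,
       is_zseries (rf_term alpha k s) S /\
       is_riesz_feller alpha gamma (higgins k) (cot s)
         (- (frac_lap_const alpha * cis (IZR (Z.sgn k) * gamma * (PI / 2))
             * Rpower (sin s) (alpha - 1) / (2 * tan (alpha * (PI / 2)))%R)
          * S)%C)
  /\
  (forall (gamma : R) (k : Z) (s : R),
     Rabs gamma <= 1 ->
     0 < s < PI ->
     is_riesz_feller 1 gamma (higgins k) (cot s)
       (- (2) * cis (IZR (Z.sgn k) * gamma * (PI / 2))
        * (IZR (Z.abs k) * sin s ^ 2)%R * cis (2 * IZR k * s))%C).
Proof.
  split.
  - intros alpha gamma k s Ha _ Hs. apply series_formula_all; trivial.
  - intros gamma k s _ Hs. revert k. apply Z_nat_cases; [intros n; apply order_one_nat, Hs|].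
    intros n. assert (H := riesz_feller_conj _ _ _ _ _ (order_one_nat gamma n s Hs)).
    rewrite <- higgins_opp in H.
    rewrite !Cmult_conj, Copp_conj, !Cconj_R, !Cconj_cis in H.
    rewrite Z.abs_opp, Z.sgn_opp, !opp_IZR.
    replace (- (IZR (Z.sgn (Z.of_nat n)) * gamma * (PI / 2))) with (- IZR (Z.sgn (Z.of_nat n)) * gamma * (PI / 2)) in H by ring.
    replace (- (2 * IZR (Z.of_nat n) * s)) with (2 * - IZR (Z.of_nat n) * s) in H by ring.
    exact H.
Qed.
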